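(* Suppose that $\Lambda_1+\cdots+\Lambda_n=2m$ for some positive integer $m$, and let $\chi:\Gamma\to\mathbb C^\times$ be a character. Then $\epsilon\in\Sigma(\chi)$ if and only if there is a common eigenfunction $u(x)$ of $T(z)$, $z\in\mathbb C$, of the form $u(x)=\prod_{i=1}^nQ(x_i)$ with eigenvalue $\epsilon(z)$, such that $Q(x)=e^{ax}\prod_{i=1}^m\theta(x-w_i)$ for some solution $(a,w_1,\dots,w_m)$ of the Bethe ansatz equations \[A_+(w_i)\prod_{j:j\neq i}\theta(w_i-w_j-2\eta)=e^{4a\eta}A_-(w_i)\prod_{j:j\neq i}\theta(w_i-w_j+2\eta),\qquad i=1,\dots,m,\] with \[\chi(1)=(-1)^me^{a},\qquad\chi(\tau)=(-1)^me^{a\tau+2\pi i\sum_kw_k}.\]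
   Context: Let $\mathrm{Im}\,\tau>0$, $\Gamma=\mathbb Z+\tau\mathbb Z$, $\eta\in\mathbb C$ with $2\eta\notin\Gamma$, $\theta(z)=-\sum_{j\in\mathbb Z}\exp(i\pi(j+\frac12)^2\tau+2\pi i(j+\frac12)(z+\frac12))$. Let $z_1,\dots,z_n\in\mathbb C$ be distinct, $\Lambda_1,\dots,\Lambda_n\in\mathbb Z_{\ge0}$, and $A_\pm(x)=\prod_{k=1}^n\theta(x+z_k\pm\eta\Lambda_k)$. The operator $T(z)$ acts on meromorphic functions $u$ of $x_1,\dots,x_n\in\mathbb C$ by \[T(-z)u(x_1,\dots,x_n)=\sum_{i=1}^n\frac{\theta(\lambda-z+x_i)}{\theta(\lambda)}\prod_{j\ne i}\frac{\theta(z-x_j)}{\theta(x_i-x_j)}\Bigl(A_+(x_i)u(x_1,\dots,x_i-2\eta,\dots,x_n)+A_-(x_i)u(x_1,\dots,x_i+2\eta,\dots,x_n)\Bigr),\] where $\lambda=-\sum_{k=1}^n(x_k+z_k)$. A common eigenfunction with eigenvalue $\epsilon$ is a non-zero $u$ with $T(z)u=\epsilon(z)u$ for all $z\in\mathbb C$. $\mathcal H_m(\chi)$ is the space of meromorphic functions $u(x_1,\dots,x_n)$ such that for every $i$: $u(\dots,x_i+1,\dots)=\chi(1)u(\dots,x_i,\dots)$ and $u(\dots,x_i+\tau,\dots)=\chi(\tau)e^{-\pi im(2x_i+\tau)}u(\dots,x_i,\dots)$. $\Theta_n(\chi_0)$ is the space of entire functions $\epsilon$ with $\epsilon(z+1)=(-1)^n\epsilon(z)$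 and $\epsilon(z+\tau)=(-1)^ne^{2\pi i\sum_kz_k}e^{-\pi in(2z+\tau)}\epsilon(z)$. $\Sigma(\chi)\subset\Theta_n(\chi_0)$ is the set of functions $\epsilon$ for which there exists a holomorphic common eigenfunction $u\in\mathcal H_m(\chi)$ of $T(z)$, $z\in\mathbb C$, with eigenvalue $\epsilon(z)$. *)

(* Defs.v *)
From HB Require Import structures.
From mathcomp Require Import all_boot all_order all_algebra.
From mathcomp Require Import all_classical all_reals all_analysis.
From mathcomp Require Import complex.
Set Implicit Arguments.
Unset Strict Implicit.
Unset Printing Implicit Defensive.
Import Order.TTheory GRing.Theory Num.Theory.
Import numFieldNormedType.Exports.
Local Open Scope classical_set_scope.
Local Open Scope ring_scope.
Local Open Scope complex_scope.

(* R[i] bundled as a numClosedFieldType, so that the canonical topology and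
   norm of a numFieldType (and hence [differentiable]) are inferred on it and
   on 'rV[CC R]_n. *)
Definition CC (R : realType) : numClosedFieldType := R[i].

Section Complex.
Variable R : realType.
Local Notation C := (CC R).

Definition imag (z : C) : R := complex.Im z.

Definition ci : C := Complex (0 : R) 1.

Definition cpi : C := (pi : R)%:C.

Definition cexp (z : C) : C :=
  Complex (expR (complex.Re z) * cos (complex.Im z))
          (expR (complex.Re z) * sin (complex.Im z)).

Definition theta_term (tau z : C) (j : int) : C :=
  cexp (ci * cpi * (j%:~R + 2^-1) ^+ 2 * tau
        + 2 * cpi * ci * (j%:~R + 2^-1) * (z + 2^-1)).

(* The bilateral sum is split into j >= 0 and j = - k - 1 < 0; both halves
   converge absolutely when Im tau > 0. *)
Definition theta (tau z : C) : C :=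
  - (limn (series (fun k : nat => theta_term tau z k%:Z))
     + limn (series (fun k : nat => theta_term tau z (- k%:Z - 1)))).

Definition lattice (tau : C) : set C :=
  [set g | exists a b : int, g = a%:~R + b%:~R * tau].

(* A character of the lattice, represented by a function on C of which only
   the values on the lattice are constrained. *)
Definition lattice_character (tau : C) (chi : C -> C) : Prop :=
  (forall g, lattice tau g -> chi g != 0) /\
  (forall g h, lattice tau g -> lattice tau h -> chi (g + h) = chi g * chi h).

Definition holomorphic (V : normedModType C) (f : V -> C) : Prop :=
  forall x, differentiable f x.

(* A meromorphic function is represented by a total function which is locally
   f / g, for holomorphic f, g with g vanishing identically on no nonempty open
   set.  Its values where g = 0 are irrelevant: equality of meromorphic
   functions is [mero_eq], not pointwise equality. *)
Definition meromorphic (V : normedModType C) (u : V -> C) : Prop :=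
  forall p : V, exists f g : V -> C, \forall x \near p,
    [/\ differentiable f x, differentiable g x,
        ~ (\forall y \near x, g y = 0) &
        g x != 0 -> u x = f x / g x].

Definition mero_eq (V : normedModType C) (u v : V -> C) : Prop :=
  exists D : set V, [/\ open D, dense D & forall x, D x -> u x = v x].

Definition shift_coord (n : nat) (i : 'I_n) (s : C) (x : 'rV[C]_n) : 'rV[C]_n :=
  x + s *: delta_mx 0 i.

End Complex.

Section Operator.
Variables (R : realType).
Local Notation C := (CC R).
Variables (tau eta : C) (n : nat) (zs : 'I_n -> C) (Lam : 'I_n -> nat).
Local Notation theta := (theta tau).

Definition Aplus (x : C) : C := \prod_(k < n) theta (x + zs k + eta * (Lam k)%:R).

Definition Aminus (x : C) : C := \prod_(k < n) theta (x + zs k - eta * (Lam k)%:R).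

(* At points where a denominator vanishes the value is the arbitrary one given
   by 0^-1 = 0; such points form a closed set with empty interior, which
   [mero_eq] ignores. *)
Definition transfer (s : C) (u : 'rV[C]_n -> C) (x : 'rV[C]_n) : C :=
  let z := - s in
  let lambda := - \sum_(k < n) (x 0 k + zs k) in
  \sum_(i < n) theta (lambda - z + x 0 i) / theta lambda
    * (\prod_(j < n | j != i) (theta (z - x 0 j) / theta (x 0 i - x 0 j)))
    * (Aplus (x 0 i) * u (shift_coord i (- (2 * eta)) x)
       + Aminus (x 0 i) * u (shift_coord i (2 * eta) x)).

Definition common_eigenfunction (u : 'rV[C]_n -> C) (eps : C -> C) : Prop :=
  [/\ meromorphic u, ~ mero_eq u (fun=> 0) &
      forall z, mero_eq (transfer z u) (fun x => eps z * u x)].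

Definition quasi_periodic_space (m : nat) (chi : C -> C)
    : set ('rV[C]_n -> C) :=
  [set u | meromorphic u /\ forall i : 'I_n,
     mero_eq (fun x => u (shift_coord i 1 x)) (fun x => chi 1 * u x) /\
     mero_eq (fun x => u (shift_coord i tau x))
       (fun x => chi tau * cexp (- (cpi R * ci R * m%:R * (2 * x 0 i + tau)))
                 * u x)].

Definition theta_space : set (C -> C) :=
  [set eps | [/\ holomorphic (eps : C -> C),
     forall z, eps (z + 1) = (-1) ^+ n * eps z &
     forall z, eps (z + tau) =
       (-1) ^+ n * cexp (2 * cpi R * ci R * \sum_(k < n) zs k)
       * cexp (- (cpi R * ci R * n%:R * (2 * z + tau))) * eps z]].

Definition spectrum (m : nat) (chi : C -> C) : set (C -> C) :=
  [set eps | theta_space eps /\ exists u : 'rV[C]_n -> C,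
     [/\ holomorphic u, quasi_periodic_space m chi u &
         common_eigenfunction u eps]].

Definition bethe_equations (m : nat) (a : C) (w : 'I_m -> C) : Prop :=
  forall i : 'I_m,
    Aplus (w i) * \prod_(j < m | j != i) theta (w i - w j - 2 * eta) =
    cexp (4 * a * eta) * Aminus (w i)
      * \prod_(j < m | j != i) theta (w i - w j + 2 * eta).

End Operator.

(* Main.v *)
Require Import Defs.
From HB Require Import structures.
From mathcomp Require Import all_boot all_order all_algebra.
From mathcomp Require Import all_classical all_reals all_analysis.
From mathcomp Require Import complex ring lra.
Set Implicit Arguments.
Unset Strict Implicit.
Unset Printing Implicit Defensive.
Import Order.TTheory GRing.Theory Num.Theory.
Import numFieldNormedType.Exports.
Local Open Scope classical_set_scope.
Local Open Scope ring_scope.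
Local Open Scope complex_scope.

(** The proof is Sklyanin's separation of variables.

    In the sum defining the transfer operator the coefficients are the Lagrange
    coefficients of theta-function interpolation at the nodes [x_1, ..., x_n].
    Putting the spectral parameter at the node [x_i] leaves only the [i]-th
    summand ([transfer_at_node]), so a holomorphic eigenfunction [u] satisfies,
    for each [i] separately, the difference equation
    [A_+(x_i) u(x - 2 eta e_i) + A_-(x_i) u(x + 2 eta e_i) = eps(- x_i) u(x)]
    ([separated_pointwise]).  Freezing all coordinates but one at a point where
    [u] does not vanish gives a nonzero entire function [Q] of one variable
    with the same equation and with the multipliers of a theta function of
    degree [m].  Such a function is, up to a scalar,
    [e^(a x) prod_i theta(x - w_i)] ([quasi_periodic_factorization]), and the
    difference equation at [x = w_i] is the Bethe equation, because
    [theta(2 eta)] is nonzero ([bethe_equation_of_root]).  That the product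
    [prod_i Q(x_i)] has the eigenvalue [eps] follows by comparison with [u]:
    where [u] is nonzero, its eigenvalue equation says that interpolating the
    values [eps(- x_i)] reproduces [eps] ([eigenfunction_transfer]).

    Conversely [prod_i Q(x_i)] is entire with the right multipliers, and its
    eigenvalue, read off at one point where nothing vanishes, is a linear
    combination of interpolation coefficients, which are theta functions of
    degree [n] in the spectral parameter ([eigenvalue_theta_space]).

    Holomorphy is pointwise complex differentiability, so the function theory
    starts from Goursat's lemma on rectangles.  Cauchy's formula on squares is
    used in the form: integral of [f(t)/(t - z)] equals [f(z)] times the winding
    integral, the latter being bounded away from zero at the centre.  It yields
    removable singularities, Liouville's theorem, the identity theorem and
    Weierstrass' theorem on locally uniform limits.

    For theta functions everything rests on Liouville's theorem.  An entire
    function of negative degree vanishes ([quasi_periodic_neg]) and an elliptic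
    one is constant ([elliptic_constant]).  The series theta vanishes on the
    lattice and has the multipliers of the triple product, whose zeros are
    visible and simple; their quotient is elliptic, so the zeros of theta are
    simple and form the lattice ([theta_productE]).  A function of positive
    degree has a zero, since otherwise its inverse would have negative degree;
    dividing by translates of theta lowers the degree to zero, where a nonzero
    function is zero-free and multiplicative, hence an exponential. *)

(** * Modulus and complex differentiability *)

Notation normc := (@ComplexField.Normc.normc _).

Section Modulus.
Variable R : realType.
Local Notation C := (CC R).
Implicit Types z w : C.

Lemma normE z : `|z| = (normc z)%:C :> C. Proof. by []. Qed.

Lemma normc_ge0 z : 0 <= normc z.
Proof. by case: z => a b; exact: sqrtr_ge0. Qed.

Lemma normcD z w : normc (z + w) <= normc z + normc w.
Proof. by rewrite -lecR rmorphD -!normE ler_normD. Qed.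

Lemma normcM z w : normc (z * w) = normc z * normc w.
Proof. exact: ComplexField.Normc.normcM. Qed.

Lemma normcN z : normc (- z) = normc z.
Proof. by apply: complexI; rewrite -!normE normrN. Qed.

Lemma normcB z w : normc (z - w) = normc (w - z).
Proof. by rewrite -normcN opprB. Qed.

Lemma normcV z : normc z^-1 = (normc z)^-1.
Proof. exact: ComplexField.Normc.normcV. Qed.

Lemma normc0 : normc (0 : C) = 0.
Proof. exact: ComplexField.Normc.normc0. Qed.

Lemma normc1 : normc (1 : C) = 1.
Proof. exact: ComplexField.Normc.normc1. Qed.

Lemma normcX z n : normc (z ^+ n) = normc z ^+ n.
Proof.
elim: n => [|n IH]; first by rewrite !expr0 normc1.
by rewrite !exprS normcM IH.
Qed.

Lemma normc_eq0 z : (normc z == 0) = (z == 0).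
Proof.
by apply/eqP/eqP => [/ComplexField.Normc.eq0_normc|->]//; exact: normc0.
Qed.

Lemma normc_gt0 z : (0 < normc z) = (z != 0).
Proof. by rewrite lt_def normc_ge0 andbT normc_eq0. Qed.

Lemma normc_real (x : R) : normc (x%:C : C) = `|x|.
Proof. by rewrite /= expr0n /= addr0 sqrtr_sqr. Qed.

Lemma normc_dist z w : normc z - normc w <= normc (z - w).
Proof. by rewrite lerBlDr -{1}[z](subrK w) normcD. Qed.

Lemma normc_dist3 (a b c : C) : normc (a - c) <= normc (a - b) + normc (b - c).
Proof. by rewrite -[a - c](subrKA b) normcD. Qed.

Lemma Re_le_normc z : `|complex.Re z| <= normc z.
Proof.
by case: z => a b /=; rewrite -sqrtr_sqr ler_wsqrtr // lerDl sqr_ge0.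
Qed.

Lemma Im_le_normc z : `|complex.Im z| <= normc z.
Proof.
by case: z => a b /=; rewrite -sqrtr_sqr ler_wsqrtr // lerDr sqr_ge0.
Qed.

Lemma complexRI z : z = (complex.Re z)%:C + ci R * (complex.Im z)%:C.
Proof. exact: complexE. Qed.

Lemma normc_ci : normc (ci R) = 1.
Proof. by rewrite /ci /= expr0n /= add0r expr1n sqrtr1. Qed.

Lemma normc_le_ReIm z : normc z <= `|complex.Re z| + `|complex.Im z|.
Proof.
rewrite {1}[z]complexRI (le_trans (normcD _ _)) //.
by rewrite normcM normc_ci mul1r !normc_real.
Qed.

Lemma nbhsCP z (P : set C) :
  nbhs z P <-> exists2 e : R, 0 < e & forall w, normc (w - z) < e -> P w.
Proof.
split.
  move=> /nbhs_ballP[e /= e0 eP]; have e0' := e0.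
  move: e0; rewrite ltcE => /andP[/eqP ie re].
  exists (complex.Re e) => // w we; apply: eP.
  rewrite /ball /= distrC normE ltcE /= we andbT; exact/eqP.
move=> [e e0 eP]; apply/nbhs_ballP; exists e%:C; first by rewrite /= ltcR.
move=> w; rewrite /ball /= distrC normE ltcR; exact: eP.
Qed.

Lemma cvgCP (T : Type) (F : set_system T) {FF : Filter F} (f : T -> C) (l : C) :
  (f x @[x --> F] --> l) <->
  (forall e : R, 0 < e -> \forall x \near F, normc (f x - l) < e).
Proof.
split=> [fl e e0|fl A /nbhsCP[e e0 eA]].
  by apply: (fl [set w | normc (w - l) < e]); apply/nbhsCP; exists e.
by rewrite /nbhs /=; apply: filterS (fl e e0) => x /eA.
Qed.

Lemma continuousCP (f : C -> C) z : {for z, continuous f} <->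
  (forall e : R, 0 < e -> exists2 d : R, 0 < d &
     forall w, normc (w - z) < d -> normc (f w - f z) < e).
Proof.
split.
  by move=> /(cvgCP (F:=nbhs z)) fz e e0; apply/nbhsCP; exact: fz.
move=> fz; apply/(cvgCP (F:=nbhs z)) => e e0; apply/nbhsCP; exact: fz.
Qed.

Lemma nbhsRP (x : R) (P : set R) :
  nbhs x P <-> exists2 e : R, 0 < e & forall y, `|y - x| < e -> P y.
Proof.
split.
  move=> /nbhs_ballP[e /= e0 eP]; exists e => // w we; apply: eP.
  by rewrite /ball /= distrC.
by move=> [e e0 eP]; apply/nbhs_ballP; exists e => //= w; rewrite /ball /= distrC; exact: eP.
Qed.

Lemma continuous_Re : continuous (@complex.Re R : C -> R).
Proof.
move=> z; apply/(cvgrPdist_lt (F:=nbhs z)) => e e0; apply/nbhsCP; exists e => // w we.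
by rewrite distrC -raddfB (le_lt_trans (Re_le_normc _)).
Qed.

Lemma continuous_Im : continuous (@complex.Im R : C -> R).
Proof.
move=> z; apply/(cvgrPdist_lt (F:=nbhs z)) => e e0; apply/nbhsCP; exists e => // w we.
by rewrite distrC -raddfB (le_lt_trans (Im_le_normc _)).
Qed.

Lemma continuous_ofR : continuous (fun x : R => x%:C : C).
Proof.
move=> x; apply/(cvgCP (F:=nbhs x)) => e e0; apply/nbhsRP; exists e => // y ye.
by rewrite -rmorphB normc_real.
Qed.

Lemma continuous_normc : continuous (fun z : C => normc z).
Proof.
move=> z; apply/(cvgrPdist_lt (F:=nbhs z)) => e e0; apply/nbhsCP; exists e => // w we.
rewrite distrC ltr_norml; apply/andP; split.
  by rewrite ltrNl opprB (le_lt_trans (normc_dist _ _)) // normcB.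
by rewrite (le_lt_trans (normc_dist _ _)).
Qed.

End Modulus.

Arguments ComplexField.Normc.normc : simpl never.

Section Differentiable.
Variable R : realType.
Local Notation C := (CC R).
Implicit Types f g : C -> C.

(** The form in which differentiability is used whenever an estimate uniform over
    a small rectangle is needed. *)
Lemma differentiable_epsP f z : differentiable f z <->
  exists d : C, forall e : R, 0 < e -> exists2 r : R, 0 < r &
    forall h, normc h < r -> normc (f (z + h) - f z - d * h) <= e * normc h.
Proof.
rewrite -derivable1_diffP; split.
  move=> /cvg_ex[d] /cvgCP fd; exists d => e e0.
  have /nbhsCP[r r0 rP] := fd e e0; exists r => // h hr.
  have [->|h0] := eqVneq h 0.
    by rewrite addr0 mulr0 subr0 subrr normc0 mulr0.
  have /= := rP h; rewrite subr0 => /(_ hr h0).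
  have -> : (h *: 1 + z : C) = z + h by rewrite addrC /GRing.scale /= mulr1.
  move=> /ltW H; have -> : f (z + h) - f z - d * h =
     (h^-1 *: (f (z + h) - f z) - d) * h.
    by rewrite mulrBl /GRing.scale /= mulrAC mulVf // mul1r.
  by rewrite normcM ler_wpM2r // normc_ge0.
move=> [d fd]; apply/cvg_ex; exists d; apply/cvgCP => e e0.
have e20 : 0 < e / 2 by rewrite divr_gt0.
have [r r0 rP] := fd _ e20; apply/nbhsCP; exists r => // h; rewrite subr0 => hr h0.
rewrite /=; have -> : (h *: 1 + z : C) = z + h by rewrite addrC /GRing.scale /= mulr1.
have nh : 0 < normc h by rewrite normc_gt0.
rewrite -(ltr_pM2r nh) -normcM mulrBl /GRing.scale /= mulrAC mulVf // mul1r.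
rewrite (le_lt_trans (rP h hr)) // ltr_pM2r // ltr_pdivrMr // mulrDr mulr1.
by rewrite ltrDl.
Qed.

Lemma near_eq_differentiable f g z :
  (\forall w \near z, f w = g w) -> differentiable f z -> differentiable g z.
Proof.
move=> fg /differentiable_epsP[d fd]; apply/differentiable_epsP; exists d => e e0.
have [r r0 rP] := fd e e0; have /nbhsCP[s s0 sP] := fg.
exists (Num.min r s); first by rewrite lt_min r0.
move=> h; rewrite lt_min => /andP[hr hs].
rewrite -sP; last by rewrite addrC addKr.
by rewrite -(sP z) ?subrr ?normc0 //; exact: rP.
Qed.

Lemma holomorphic_continuous f : holomorphic (f : C -> C) -> continuous f.
Proof. by move=> hf z; exact/differentiable_continuous/hf. Qed.

Lemma holomorphic_cst (c : C) : holomorphic ((fun=> c) : C -> C).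
Proof. by move=> z; exact: differentiable_cst. Qed.

Lemma holomorphic_id : holomorphic ((fun z => z) : C -> C).
Proof. by move=> z; apply: ex_diff; exact: is_diff_id. Qed.

Lemma holomorphicD f g : holomorphic (f : C -> C) -> holomorphic (g : C -> C) ->
  holomorphic ((fun z => f z + g z) : C -> C).
Proof. by move=> hf hg z; exact: (differentiableD (hf z) (hg z)). Qed.

Lemma holomorphicN f : holomorphic (f : C -> C) ->
  holomorphic ((fun z => - f z) : C -> C).
Proof. by move=> hf z; exact: (differentiableN (hf z)). Qed.

Lemma holomorphicB f g : holomorphic (f : C -> C) -> holomorphic (g : C -> C) ->
  holomorphic ((fun z => f z - g z) : C -> C).
Proof. by move=> hf hg z; exact: (differentiableB (hf z) (hg z)). Qed.

Lemma holomorphicM f g : holomorphic (f : C -> C) -> holomorphic (g : C -> C) ->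
  holomorphic ((fun z => f z * g z) : C -> C).
Proof. by move=> hf hg z; exact: (differentiableM (hf z) (hg z)). Qed.

Lemma differentiable_div f g z : differentiable f z -> differentiable g z ->
  g z != 0 -> differentiable (fun w => f w / g w) z.
Proof.
move=> df dg g0; have dV := differentiableV dg g0.
exact: (differentiableM df dV).
Qed.

Lemma holomorphic_comp f g : holomorphic (f : C -> C) -> holomorphic (g : C -> C) ->
  holomorphic ((fun z => f (g z)) : C -> C).
Proof. by move=> hf hg z; exact: (differentiable_comp (hg z) (hf _)). Qed.

Lemma holomorphic_sum n (F : 'I_n -> C -> C) (P : pred 'I_n) :
  (forall i, P i -> holomorphic (F i : C -> C)) ->
  holomorphic ((fun z => \sum_(i | P i) F i z) : C -> C).
Proof.
move=> hF; rewrite (_ : (fun z => _) = \sum_(i | P i) F i); last first.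
  by apply/funext => z; rewrite fct_sumE.
apply: (big_ind (fun G : C -> C => holomorphic (G : C -> C))).
- exact: holomorphic_cst.
- by move=> G H hG hH; exact: holomorphicD hG hH.
- exact: hF.
Qed.

Lemma holomorphic_prod n (F : 'I_n -> C -> C) (P : pred 'I_n) :
  (forall i, P i -> holomorphic (F i : C -> C)) ->
  holomorphic ((fun z => \prod_(i | P i) F i z) : C -> C).
Proof.
move=> hF; rewrite (_ : (fun z => _) = \prod_(i | P i) F i); last first.
  by apply/funext => z; rewrite fct_prodE.
apply: (big_ind (fun G : C -> C => holomorphic (G : C -> C))).
- exact: holomorphic_cst.
- by move=> G H hG hH; exact: holomorphicM hG hH.
- exact: hF.
Qed.

Lemma holomorphicX f n : holomorphic (f : C -> C) ->
  holomorphic ((fun z => f z ^+ n) : C -> C).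
Proof.
move=> hf; elim: n => [|n IH].
  by under eq_fun do rewrite expr0; exact: holomorphic_cst.
by under eq_fun do rewrite exprS; exact: holomorphicM.
Qed.

End Differentiable.

(** * Integrals of complex-valued functions of a real variable *)

Section Integral.
Variable R : realType.
Local Notation C := (CC R).
Local Notation mu := (@lebesgue_measure R).
Implicit Types (a b c : R) (g h : R -> R).

Lemma continuous_integrable a b g : continuous g ->
  mu.-integrable `[a, b] (EFin \o g).
Proof.
move=> cg; apply: continuous_compact_integrable; first exact: segment_compact.
exact: continuous_subspaceT.
Qed.

Lemma integral_split a b c g : continuous g -> a <= b -> b <= c ->
  \int[mu]_(x in `[a, c]) g x =
  \int[mu]_(x in `[a, b]) g x + \int[mu]_(x in `[b, c]) g x.
Proof.
move=> cg ab bc; have := @Rintegral_itvB R g (BLeft a) (BRight c) b.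
move=> /(_ (continuous_integrable _ _ cg)); rewrite !bnd_simp => /(_ ab bc) E.
rewrite -(@Rintegral_itv_obnd_cbnd _ b); first by rewrite -E addrC subrK.
apply: integrableS (continuous_integrable a c cg) => //.
by apply: subset_itv; rewrite bnd_simp.
Qed.

Lemma integral_cst a b (k : R) : a <= b -> \int[mu]_(x in `[a, b]) k = k * (b - a).
Proof.
move=> ab; rewrite Rintegral_cst //= lebesgue_measure_itv /= lte_fin.
have [//|ba] := ltP; rewrite /= mulr0.
by rewrite (le_anti (introT andP (conj ab ba))) subrr mulr0.
Qed.

Definition cint a b (g : R -> C) : C :=
  (\int[mu]_(x in `[a, b]) complex.Re (g x))
  +i* (\int[mu]_(x in `[a, b]) complex.Im (g x)).

Implicit Types G H : R -> C.

Let cRe G : continuous G -> continuous (fun x => complex.Re (G x)).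
Proof. by move=> cG x; exact: continuous_comp (cG x) (@continuous_Re _ _). Qed.

Let cIm G : continuous G -> continuous (fun x => complex.Im (G x)).
Proof. by move=> cG x; exact: continuous_comp (cG x) (@continuous_Im _ _). Qed.

Lemma cint_split a b c G : continuous G -> a <= b -> b <= c ->
  cint a c G = cint a b G + cint b c G.
Proof.
move=> cG ab bc; rewrite /cint (integral_split (cRe cG) ab bc).
by rewrite (integral_split (cIm cG) ab bc).
Qed.

Lemma cintD a b G H : continuous G -> continuous H ->
  cint a b (fun x => G x + H x) = cint a b G + cint a b H.
Proof.
move=> cG cH; rewrite /cint.
rewrite [X in X +i* _](_ : _ = \int[mu]_(x in `[a, b])
  (complex.Re (G x) + complex.Re (H x))); last first.
  by apply: eq_Rintegral => x _; rewrite raddfD.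
rewrite [X in _ +i* X](_ : _ = \int[mu]_(x in `[a, b])
  (complex.Im (G x) + complex.Im (H x))); last first.
  by apply: eq_Rintegral => x _; rewrite raddfD.
by rewrite !RintegralD //; apply: continuous_integrable; do ?[exact: cRe|exact: cIm].
Qed.

Lemma cintZ a b (k : C) G : continuous G ->
  cint a b (fun x => k * G x) = k * cint a b G.
Proof.
case: k => k1 k2 cG; rewrite /cint.
have i1 := continuous_integrable a b (cRe cG).
have i2 := continuous_integrable a b (cIm cG).
have mk k g : continuous g -> continuous (fun x => k * g x : R).
  by move=> cg x; apply: cvgM (cg x); exact: cvg_cst.
rewrite [X in X +i* _](_ : _ = \int[mu]_(x in `[a, b])
  (k1 * complex.Re (G x) - k2 * complex.Im (G x))); last first.
  by apply: eq_Rintegral => x _; case: (G x).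
rewrite [X in _ +i* X](_ : _ = \int[mu]_(x in `[a, b])
  (k1 * complex.Im (G x) + k2 * complex.Re (G x))); last first.
  by apply: eq_Rintegral => x _; case: (G x).
rewrite RintegralB ?RintegralD //; do ?by
  apply: continuous_integrable; apply: mk; do ?[exact: cRe|exact: cIm].
by rewrite !RintegralZl.
Qed.

Lemma cint_cst a b (k : C) : a <= b -> cint a b (fun=> k) = k * (b - a)%:C.
Proof.
move=> ab; case: k => k1 k2; rewrite /cint !integral_cst //=.
by simpc.
Qed.

Lemma cint_le a b G (M : R) : continuous G -> a <= b ->
  (forall x, a <= x <= b -> normc (G x) <= M) ->
  normc (cint a b G) <= 2 * M * (b - a).
Proof.
move=> cG ab GM; rewrite (le_trans (normc_le_ReIm _)) //=.
have B g : continuous g -> (forall x, a <= x <= b -> `|g x| <= M) ->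
    `|\int[mu]_(x in `[a, b]) g x| <= (b - a) * M.
  move=> cg gM; rewrite mulrC -(integral_cst M ab).
  have ig := continuous_integrable a b cg.
  rewrite (le_trans (le_normr_Rintegral _ ig)) //.
  apply: le_Rintegral => //.
  - by apply: continuous_integrable => x; apply: cvg_norm; exact: cg.
  - by apply: (@continuous_integrable _ _ (fun=> _)) => x; exact: cst_continuous.
rewrite (_ : 2 * M * (b - a) = (b - a) * M + (b - a) * M); last by ring.
rewrite lerD //; apply: B.
- exact: cRe.
- by move=> x /GM; exact: le_trans (Re_le_normc _).
- exact: cIm.
- by move=> x /GM; exact: le_trans (Im_le_normc _).
Qed.

Lemma Im_cint_ge a b G (m : R) : continuous G -> a <= b ->
  (forall x, a <= x <= b -> m <= complex.Im (G x)) ->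
  m * (b - a) <= complex.Im (cint a b G).
Proof.
move=> cG ab Gm /=; rewrite -integral_cst //; apply: le_Rintegral => //.
- by apply: (@continuous_integrable _ _ (fun=> _)) => x; exact: cst_continuous.
- exact: continuous_integrable (cIm cG).
Qed.

End Integral.

(** * Integration along rectangles *)

Section Rectangle.
Variable R : realType.
Local Notation C := (CC R).
Implicit Types (a b c d x y : R) (f g : C -> C) (F G : R -> C).

Lemma continuous_pair_complex :
  continuous (fun p : R * R => Complex p.1 p.2 : C).
Proof.
move=> p; apply/(cvgCP (F:=nbhs p)) => e e0.
have e2 : 0 < e / 2 by rewrite divr_gt0.
exists ([set x | `|x - p.1| < e / 2], [set y | `|y - p.2| < e / 2]) => /=.
  by split; apply/nbhsRP; exists (e / 2).
move=> q /= [q1 q2]; rewrite (le_lt_trans (normc_le_ReIm _)) // [ltRHS]splitr.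
exact: ltrD.
Qed.

Lemma continuous_hline c : continuous (fun x => Complex x c : C).
Proof.
move=> x; apply/(cvgCP (F:=nbhs x)) => e e0; apply/nbhsRP; exists e => // y ye.
by rewrite (le_lt_trans (normc_le_ReIm _)) //= subrr normr0 addr0.
Qed.

Lemma continuous_vline a : continuous (fun y => Complex a y : C).
Proof.
move=> x; apply/(cvgCP (F:=nbhs x)) => e e0; apply/nbhsRP; exists e => // y ye.
by rewrite (le_lt_trans (normc_le_ReIm _)) //= subrr normr0 add0r.
Qed.

(** Continuity along the four lines carrying the sides of a rectangle: this is
    what integrating along the boundary requires, and it allows integrands with
    poles inside the rectangle. *)
Definition side_continuous f a b c d :=
  [/\ continuous (fun x => f (Complex x c)), continuous (fun x => f (Complex x d)),
      continuous (fun y => f (Complex a y)) & continuous (fun y => f (Complex b y))].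

Definition contour f a b c d : C :=
  cint a b (fun x => f (Complex x c) - f (Complex x d))
  + ci R * cint c d (fun y => f (Complex b y) - f (Complex a y)).

Lemma continuous_side f a b c d : continuous f -> side_continuous f a b c d.
Proof.
by move=> cf; split=> x; apply: (continuous_comp (g := f)) (cf _);
  do ?[exact: continuous_hline|exact: continuous_vline].
Qed.

Let cB F G : continuous F -> continuous G -> continuous (fun x => F x - G x).
Proof. by move=> cF cG x; apply: continuousB; [exact: cF|exact: cG]. Qed.

Let cZ (k : C) F : continuous F -> continuous (fun x => k * F x).
Proof. by move=> cF x; apply: cvgM (cF x); exact: cvg_cst. Qed.

Lemma eq_contour f g a b c d :
  (forall x, f (Complex x c) = g (Complex x c)) ->
  (forall x, f (Complex x d) = g (Complex x d)) ->
  (forall y, f (Complex a y) = g (Complex a y)) ->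
  (forall y, f (Complex b y) = g (Complex b y)) ->
  contour f a b c d = contour g a b c d.
Proof.
move=> h1 h2 h3 h4; rewrite /contour; congr (cint _ _ _ + _ * cint _ _ _).
  by apply/funext => x; rewrite h1 h2.
by apply/funext => x; rewrite h3 h4.
Qed.

Lemma contourD f g a b c d :
  side_continuous f a b c d -> side_continuous g a b c d ->
  contour (fun z => f z + g z) a b c d = contour f a b c d + contour g a b c d.
Proof.
move=> [f1 f2 f3 f4] [g1 g2 g3 g4]; rewrite /contour.
under [X in cint a b X + _]eq_fun do rewrite opprD addrACA.
under [X in _ + _ * cint c d X]eq_fun do rewrite opprD addrACA.
rewrite (cintD _ _ (cB f1 f2) (cB g1 g2)) (cintD _ _ (cB f4 f3) (cB g4 g3)).
by rewrite mulrDr addrACA.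
Qed.

Lemma contourZ k f a b c d : side_continuous f a b c d ->
  contour (fun z => k * f z) a b c d = k * contour f a b c d.
Proof.
move=> [f1 f2 f3 f4]; rewrite /contour.
under [X in cint a b X + _]eq_fun do rewrite -mulrBr.
under [X in _ + _ * cint c d X]eq_fun do rewrite -mulrBr.
by rewrite (cintZ _ _ _ (cB f1 f2)) (cintZ _ _ _ (cB f4 f3)) mulrDr mulrCA.
Qed.

Lemma contourB f g a b c d :
  side_continuous f a b c d -> side_continuous g a b c d ->
  contour (fun z => f z - g z) a b c d = contour f a b c d - contour g a b c d.
Proof.
move=> sf sg; rewrite -mulN1r -(contourZ (-1) sg).
have sg' : side_continuous (fun z => -1 * g z) a b c d.
  by case: sg => g1 g2 g3 g4; split; exact: cZ.
by rewrite -(contourD sf sg'); apply: eq_contour => x; rewrite mulN1r.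
Qed.

Let subC x y x' y' : Complex x y - Complex x' y' = Complex (x - x') (y - y') :> C.
Proof. by []. Qed.

(** Opposite sides are integrated together, and on them an affine function differs
    by a constant. *)
Lemma contour_affine (k l : C) a b c d : a <= b -> c <= d ->
  contour (fun z => k * z + l) a b c d = 0.
Proof.
move=> ab cd; rewrite /contour.
under [X in cint a b X + _]eq_fun do rewrite opprD addrACA subrr addr0 -mulrBr.
under [X in _ + _ * cint c d X]eq_fun do rewrite opprD addrACA subrr addr0 -mulrBr.
have -> : (fun x => k * ((x +i* c : C) - (x +i* d))) = (fun=> k * (0 +i* (c - d))).
  by apply/funext => x; rewrite subC subrr.
have -> : (fun y => k * ((b +i* y : C) - (a +i* y))) = (fun=> k * ((b - a) +i* 0)).
  by apply/funext => x; rewrite subC subrr.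
rewrite !cint_cst // [Complex 0 _]complexRI [Complex (b - a) _]complexRI /=.
by rewrite !rmorph0 !rmorphB /=; ring.
Qed.

Lemma contour_le f a b c d (M : R) : side_continuous f a b c d ->
  a <= b -> c <= d ->
  (forall x, a <= x <= b -> normc (f (Complex x c)) <= M /\ normc (f (Complex x d)) <= M) ->
  (forall y, c <= y <= d -> normc (f (Complex a y)) <= M /\ normc (f (Complex b y)) <= M) ->
  normc (contour f a b c d) <= 4 * M * (b - a + (d - c)).
Proof.
move=> [f1 f2 f3 f4] ab cd hh hv; rewrite /contour (le_trans (normcD _ _)) //.
rewrite normcM normc_ci mul1r.
rewrite (_ : 4 * M * (b - a + (d - c)) = 2 * (M + M) * (b - a) + 2 * (M + M) * (d - c));
  last by ring.
have nB (u v : C) : normc u <= M -> normc v <= M -> normc (u - v) <= M + M.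
  by move=> um vm; rewrite (le_trans (normcD _ _)) // normcN lerD.
apply: lerD.
  by apply: (cint_le (cB f1 f2)) => // x /hh[? ?]; exact: nB.
by apply: (cint_le (cB f4 f3)) => // x /hv[? ?]; exact: nB.
Qed.

Lemma contour_hsplit f a b e c d : continuous f -> a <= e -> e <= b ->
  contour f a b c d = contour f a e c d + contour f e b c d.
Proof.
move=> cf ae eb; rewrite /contour.
have [f1 f2 f3 f4] := continuous_side a b c d cf.
have [_ _ f5 _] := continuous_side e b c d cf.
rewrite (cint_split (cB f1 f2) ae eb) [RHS]addrACA -mulrDr.
congr (_ + _ * _); rewrite -(cintD _ _ (cB f5 f3) (cB f4 f5)).
by congr cint; apply/funext => y; rewrite [RHS]addrC subrKA.
Qed.

Lemma contour_vsplit f a b c d e : continuous f -> c <= e -> e <= d ->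
  contour f a b c d = contour f a b c e + contour f a b e d.
Proof.
move=> cf ce ed; rewrite /contour.
have [f1 f2 f3 f4] := continuous_side a b c d cf.
have [f5 _ _ _] := continuous_side a b e d cf.
rewrite (cint_split (cB f4 f3) ce ed) [RHS]addrACA -mulrDr.
congr (_ + _ * _); rewrite -(cintD _ _ (cB f1 f5) (cB f5 f2)).
by congr cint; apply/funext => y; rewrite subrKA.
Qed.

End Rectangle.

(** * Goursat's lemma *)

Section Goursat.
Variable R : realType.
Local Notation C := (CC R).
Implicit Types (a b c d x y : R) (f g : C -> C).

(** The integral is the sum over the four quarters, one of which contributes at
    least a fourth of it. *)
Lemma contour_quarter f a b c d (K : R) : continuous f -> a <= b -> c <= d ->
  K <= normc (contour f a b c d) ->
  exists p : R * R,
    [/\ a <= p.1, p.1 + (b - a) / 2 <= b, c <= p.2, p.2 + (d - c) / 2 <= d &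
      K / 4 <= normc (contour f p.1 (p.1 + (b - a) / 2) p.2 (p.2 + (d - c) / 2))].
Proof.
move=> cf ab cd hK; set w := (b - a) / 2; set h := (d - c) / 2.
have w0 : 0 <= w by rewrite divr_ge0 // subr_ge0.
have h0 : 0 <= h by rewrite divr_ge0 // subr_ge0.
have bE : b = a + w + w by rewrite /w; lra.
have dE : d = c + h + h by rewrite /h; lra.
have aw : a <= a + w by rewrite lerDl.
have ch : c <= c + h by rewrite lerDl.
have wb : a + w <= b by rewrite bE lerDl.
have hd : c + h <= d by rewrite dE lerDl.
rewrite (contour_hsplit _ _ cf aw wb) in hK.
rewrite !(contour_vsplit _ _ cf ch hd) in hK.
apply: contrapT => /forallNP H.
have K1 : normc (contour f a (a + w) c (c + h)) < K / 4.
  rewrite ltNge; apply/negP => k; apply: (H (a, c)); split=> //=.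
have K2 : normc (contour f a (a + w) (c + h) d) < K / 4.
  rewrite ltNge; apply/negP => k; apply: (H (a, c + h)); split=> //=; rewrite -?dE //.
have K3 : normc (contour f (a + w) b c (c + h)) < K / 4.
  rewrite ltNge; apply/negP => k; apply: (H (a + w, c)); split=> //=; rewrite -?bE //.
have K4 : normc (contour f (a + w) b (c + h) d) < K / 4.
  rewrite ltNge; apply/negP => k; apply: (H (a + w, c + h)).
  by split=> //=; rewrite -?bE -?dE //.
have := normcD (contour f a (a + w) c (c + h) + contour f a (a + w) (c + h) d)
  (contour f (a + w) b c (c + h) + contour f (a + w) b (c + h) d).
have := normcD (contour f a (a + w) c (c + h)) (contour f a (a + w) (c + h) d).
have := normcD (contour f (a + w) b c (c + h)) (contour f (a + w) b (c + h) d).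
by move: hK K1 K2 K3 K4;
  rewrite -/w -/h; move: (contour f a _ c _) (contour f a _ _ d) (contour f _ b c _)
    (contour f _ b _ d) => t1 t2 t3 t4; lra.
Qed.

Lemma nested_cvg (xs : nat -> R) (w : R) : 0 <= w ->
  (forall n, xs n <= xs n.+1) ->
  (forall n, xs n.+1 + w / 2 ^+ n.+1 <= xs n + w / 2 ^+ n) ->
  exists l, forall n, xs n <= l <= xs n + w / 2 ^+ n.
Proof.
move=> w0 inc dec.
have nd : nondecreasing_seq xs by apply/nondecreasing_seqP.
have ni : nonincreasing_seq (fun n => xs n + w / 2 ^+ n) by apply/nonincreasing_seqP.
have le n m : xs n <= xs m + w / 2 ^+ m.
  apply: (@le_trans _ _ (xs (maxn n m))); first by apply: nd; exact: leq_maxl.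
  apply: (@le_trans _ _ (xs (maxn n m) + w / 2 ^+ (maxn n m))).
    by rewrite lerDl divr_ge0 // exprn_ge0.
  by apply: ni; exact: leq_maxr.
have ub : has_sup (range xs).
  split; first by exists (xs 0%N), 0%N.
  by exists (xs 0%N + w / 2 ^+ 0) => _ [n _ <-]; exact: le.
exists (sup (range xs)) => n; apply/andP; split.
  by apply: ub_le_sup; [case: ub|exists n].
by apply: ge_sup; [exists (xs 0%N), 0%N|move=> _ [m _ <-]; exact: le].
Qed.

(** Goursat's lemma.  The derivative may be discontinuous, so the rectangle is
    halved repeatedly until differentiability at the limit point of the nested
    rectangles contradicts the lower bound inherited from the first one. *)
Lemma goursat f a b c d : continuous f -> a <= b -> c <= d ->
  (forall x y, a <= x <= b -> c <= y <= d -> differentiable f (Complex x y : C)) ->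
  contour f a b c d = 0.
Proof.
move=> cf ab cd df; apply/eqP; rewrite -normc_eq0 eq_le normc_ge0 andbT.
set K := normc _; rewrite leNgt; apply/negP => K0.
set w := b - a; set h := d - c.
have w0 : 0 <= w by rewrite subr_ge0.
have h0 : 0 <= h by rewrite subr_ge0.
have p2 n : 0 < 2 ^+ n :> R by rewrite exprn_gt0.
pose cell (n : nat) (p : R * R) :=
  contour f p.1 (p.1 + w / 2 ^+ n) p.2 (p.2 + h / 2 ^+ n).
pose step (s t : nat * (R * R)) := t.1 = s.1.+1 /\
  (K / 4 ^+ s.1 <= normc (cell s.1 s.2) ->
   [/\ K / 4 ^+ t.1 <= normc (cell t.1 t.2),
    s.2.1 <= t.2.1 /\ t.2.1 + w / 2 ^+ t.1 <= s.2.1 + w / 2 ^+ s.1 &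
    s.2.2 <= t.2.2 /\ t.2.2 + h / 2 ^+ t.1 <= s.2.2 + h / 2 ^+ s.1]).
have stepP s : {t | step s t}.
  case: s => n p; apply: cid; rewrite /step /=.
  have [Kn|Kn] := leP (K / 4 ^+ n) (normc (cell n p)); last first.
    by exists (n.+1, p); split.
  have wn : p.1 <= p.1 + w / 2 ^+ n by rewrite lerDl divr_ge0 // ltW.
  have hn : p.2 <= p.2 + h / 2 ^+ n by rewrite lerDl divr_ge0 // ltW.
  have [q] := contour_quarter cf wn hn Kn.
  have -> (u v : R) : (v + u / 2 ^+ n - v) / 2 = u / 2 ^+ n.+1.
    by rewrite addrAC subrr add0r exprSr invfM mulrA.
  have -> (u v : R) : (v + u / 2 ^+ n - v) / 2 = u / 2 ^+ n.+1.
    by rewrite addrAC subrr add0r exprSr invfM mulrA.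
  rewrite -mulrA -invfM -exprSr => -[q1 q2 q3 q4 q5].
  by exists (n.+1, q); split.
have [s [s0 sS]] := dependent_choice stepP (0%N, (a, c)).
have s1 n : (s n).1 = n by elim: n => [|n IH]; [rewrite s0|have [-> _] := sS n; rewrite IH].
have sK n : K / 4 ^+ n <= normc (cell n (s n).2).
  elim: n => [|n IH].
    by rewrite s0 /cell /= !expr0 !divr1 /w /h !addrA ![_ + b - _]addrAC ![_ + d - _]addrAC
      !subrr !add0r.
  have [_ /=] := sS n; rewrite !s1 => /(_ IH) [] //.
have sx n : [/\ (s n).2.1 <= (s n.+1).2.1,
    (s n.+1).2.1 + w / 2 ^+ n.+1 <= (s n).2.1 + w / 2 ^+ n,
    (s n).2.2 <= (s n.+1).2.2 &
    (s n.+1).2.2 + h / 2 ^+ n.+1 <= (s n).2.2 + h / 2 ^+ n].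
  have [_ /=] := sS n; rewrite !s1 => /(_ (sK n)) [_ [? ?] [? ?]]; split=> //.
have [x xP] := @nested_cvg (fun n => (s n).2.1) w w0
  (fun n => let: And4 p _ _ _ := sx n in p) (fun n => let: And4 _ p _ _ := sx n in p).
have [y yP] := @nested_cvg (fun n => (s n).2.2) h h0
  (fun n => let: And4 _ _ p _ := sx n in p) (fun n => let: And4 _ _ _ p := sx n in p).
have xab : a <= x <= b.
  by have := xP 0%N; rewrite s0 /= expr0 divr1 /w addrA [a + b]addrC addrK.
have ycd : c <= y <= d.
  by have := yP 0%N; rewrite s0 /= expr0 divr1 /h addrA [c + d]addrC addrK.
set z := Complex x y : C.
have /differentiable_epsP[k dk] := df x y xab ycd.
(* makes the final bound 4 * (w + h) ^+ 2 * e smaller than K *)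
pose e := K / (4 * (w + h) ^+ 2 + 1).
have den0 : 0 < 4 * (w + h) ^+ 2 + 1.
  by rewrite ltr_wpDl // mulr_ge0 // sqr_ge0.
have e0 : 0 < e by rewrite divr_gt0.
have [r r0 rP] := dk e e0.
have [n nr] : exists n, (w + h) / 2 ^+ n < r.
  have [m hm] : exists m, (w + h) / r < m%:R.
    exists (Num.bound ((w + h) / r)); apply: archi_boundP.
    exact: divr_ge0 (addr_ge0 w0 h0) (ltW r0).
  exists m; rewrite ltr_pdivrMr // mulrC -ltr_pdivrMr //.
  rewrite (lt_le_trans hm) // -natrX ler_nat; exact: ltnW (ltn_expl _ _).
have := sK n; rewrite /cell; set X := (s n).2.1; set Y := (s n).2.2.
set X' := X + _; set Y' := Y + _.
have XX' : X <= X' by rewrite lerDl divr_ge0 // ltW.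
have YY' : Y <= Y' by rewrite lerDl divr_ge0 // ltW.
pose A (t : C) := k * t + (f z - k * z).
have cA : continuous A.
  move=> t; apply: continuousD; last exact: cst_continuous.
  by apply: continuousM; [exact: cst_continuous|exact: cvg_id].
have -> : contour f X X' Y Y' = contour (fun t => f t - A t) X X' Y Y'.
  rewrite contourB; [|exact: continuous_side|exact: continuous_side].
  by rewrite contour_affine // subr0.
have sfA : side_continuous (fun t => f t - A t) X X' Y Y'.
  by apply: continuous_side => t; apply: continuousB; [exact: cf|exact: cA].
have bnd u v : X <= u <= X' -> Y <= v <= Y' ->
    normc (f (Complex u v) - A (Complex u v)) <= e * ((w + h) / 2 ^+ n).
  move=> uX vY; pose t := Complex u v - z : C.
  have tn : normc t <= (w + h) / 2 ^+ n.
    rewrite (le_trans (normc_le_ReIm _)) // mulrDl lerD //=.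
      have := xP n; rewrite -/X ler_norml /X' /= in uX *.
      by move=> xX; move: uX xX; rewrite /X'; set q := w / _; lra.
    have := yP n; rewrite -/Y ler_norml /Y' /= in vY *.
    by move=> xX; move: vY xX; rewrite /Y'; set q := h / _; lra.
  have := rP t (le_lt_trans tn nr).
  rewrite [z + t]addrC /t subrK => H.
  rewrite (_ : f _ - A _ = f (Complex u v) - f z - k * (Complex u v - z)); last first.
    by rewrite /A; ring.
  by rewrite (le_trans H) // ler_wpM2l // ltW.
have := contour_le sfA XX' YY'
  (fun u uX => conj (bnd u Y uX (introT andP (conj (lexx _) YY')))
                    (bnd u Y' uX (introT andP (conj YY' (lexx _)))))
  (fun v vY => conj (bnd X v (introT andP (conj (lexx _) XX')) vY)
                    (bnd X' v (introT andP (conj XX' (lexx _))) vY)).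
move=> H1 H2; have := le_trans H2 H1.
rewrite /X' /Y' [X + _]addrC addrK [Y + _]addrC addrK -mulrDl.
have -> : 4 * (e * ((w + h) / 2 ^+ n)) * ((w + h) / 2 ^+ n) =
    4 * (w + h) ^+ 2 * e / 4 ^+ n.
  have -> : (4 : R) ^+ n = 2 ^+ n * 2 ^+ n by rewrite -exprMn -natrM.
  by field; rewrite gt_eqF.
rewrite ler_pM2r ?invr_gt0 ?exprn_gt0 //.
have KE : K = e * (4 * (w + h) ^+ 2 + 1) by rewrite /e divfK // gt_eqF.
have E : e * (4 * (w + h) ^+ 2 + 1) = 4 * (w + h) ^+ 2 * e + e by ring.
by rewrite KE E; move: (4 * _ * e) e0 => S; lra.
Qed.

End Goursat.

(** * Exceptional lines *)

Section Exceptional.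
Variable R : realType.
Local Notation C := (CC R).
Implicit Types (a b c d x y : R) (f g : C -> C).

Lemma continuous_on_plane f : continuous f ->
  continuous (fun p : R * R => f (Complex p.1 p.2)).
Proof.
by move=> cf p; apply: (continuous_comp (g := f)) (cf _);
  exact: continuous_pair_complex.
Qed.

Lemma bounded_on_rectangle f a b c d : continuous f ->
  exists2 M : R, 0 <= M &
    forall x y, a <= x <= b -> c <= y <= d -> normc (f (Complex x y)) <= M.
Proof.
move=> cf; have [ab|ba] := leP a b; last first.
  by exists 0 => // x y /andP[ax xb]; have := le_trans ax xb; rewrite leNgt ba.
have [cd|dc] := leP c d; last first.
  by exists 0 => // x y _ /andP[cy yd]; have := le_trans cy yd; rewrite leNgt dc.
have K : compact (`[a, b] `*` `[c, d])%classic.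
  by apply: compact_setX; exact: segment_compact.
have ne : (`[a, b] `*` `[c, d])%classic !=set0.
  by exists (a, c); split; rewrite /= in_itv /= lexx.
have ct : {within (`[a, b] `*` `[c, d])%classic,
    continuous (fun p : R * R => normc (f (Complex p.1 p.2)))}.
  apply: continuous_subspaceT => p.
  apply: (continuous_comp (g := fun z : C => normc z)); first exact: continuous_on_plane.
  exact: continuous_normc.
have [p _ pP] := compact_EVT_max ne K ct.
exists (normc (f (Complex p.1 p.2))); first exact: normc_ge0.
move=> x y xab ycd; apply: (pP (x, y)).
by rewrite inE; split; rewrite /= in_itv.
Qed.

(** Continuity at each point of a vertical segment is made uniform by
    compactness. *)
Lemma uniform_near_segment f a c d (e : R) : continuous f -> 0 < e ->
  exists2 r : R, 0 < r & forall x, `|x - a| < r ->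
    forall y, c <= y <= d -> normc (f (Complex x y) - f (Complex a y)) <= e.
Proof.
move=> cf e0; have cK : compact `[c, d]%classic by exact: segment_compact.
have /compact_near_coveringP cov := cK.
have e2 : 0 < e / 2 by rewrite divr_gt0.
have H : forall y, `[c, d]%classic y ->
    \forall y' \near y & x \near nbhs a,
      normc (f (Complex x y') - f (Complex a y')) <= e.
  move=> y _; have /(cvgCP (F:=nbhs (a, y))) := @continuous_on_plane f cf (a, y).
  move=> /(_ _ e2) [[A B] /= [nA nB] AB].
  exists (B, A); first by split.
  move=> [y' x] /= [By Ax].
  have h1 := AB (x, y') (conj Ax By).
  have h2 := AB (a, y') (conj (nbhs_singleton nA) By).
  rewrite (le_trans (normc_dist3 _ (f (Complex a y)) _)) // [leRHS]splitr.
  by apply: lerD; [exact: ltW|rewrite normcB; exact: ltW].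
have /nbhsRP[r r0 rP] := cov _ (nbhs a)
  (fun x y => normc (f (Complex x y) - f (Complex a y)) <= e)
  (nbhs_filter a) H.
exists r => // x xr y ycd; exact: (rP x xr).
Qed.

Lemma contour_thin f a c d (e : R) : continuous f -> c <= d -> 0 < e ->
  exists2 r : R, 0 < r & forall s t, s <= t -> `|s - a| < r -> `|t - a| < r ->
    normc (contour f s t c d) <= e.
Proof.
move=> cf cd e0.
have [M M0 fM] := bounded_on_rectangle (a - 1) (a + 1) c d cf.
have M40 : 0 < 4 * M + 1 by rewrite ltr_wpDl // mulr_ge0.
have d40 : 0 < 4 * (d - c) + 1 by rewrite ltr_wpDl // mulr_ge0 // subr_ge0.
have eta0 : 0 < e / 2 / (4 * (d - c) + 1) by rewrite !divr_gt0.
have [r1 r10 r1P] := uniform_near_segment a c d cf eta0.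
pose r := Num.min (Num.min r1 1) (e / 4 / (4 * M + 1)).
exists r; first by rewrite !lt_min r10 ltr01 !divr_gt0.
move=> s t st; rewrite !lt_min => /andP[/andP[s1 s2] s3] /andP[/andP[t1 t2] t3].
have ts : t - s <= e / 2 / (4 * M + 1).
  by move: s3 t3; rewrite !ltr_norml; move=> /andP[? ?] /andP[? ?]; lra.
have [f1 f2 f3 f4] := continuous_side s t c d cf.
have fMx x y : s <= x <= t -> c <= y <= d -> normc (f (Complex x y)) <= M.
  move=> xst; apply: fM; move: s2 t2 xst; rewrite !ltr_norml.
  by move=> /andP[? ?] /andP[? ?] /andP[? ?]; apply/andP; split; lra.
rewrite /contour (le_trans (normcD _ _)) // normcM normc_ci mul1r [leRHS]splitr.
have cB (F G : R -> C) : continuous F -> continuous G -> continuous (fun x => F x - G x).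
  by move=> cF cG x; apply: continuousB; [exact: cF|exact: cG].
apply: lerD.
  apply: (@le_trans _ _ (2 * (M + M) * (t - s))).
    apply: (cint_le (cB _ _ f1 f2)) => // x xst.
    by rewrite (le_trans (normcD _ _)) // normcN lerD // fMx // lexx cd.
  apply: (@le_trans _ _ ((4 * M + 1) * (t - s))).
    by rewrite ler_wpM2r ?subr_ge0 //; lra.
  by rewrite mulrC -ler_pdivlMr.
apply: (@le_trans _ _ (2 * (e / 2 / (4 * (d - c) + 1) + e / 2 / (4 * (d - c) + 1)) * (d - c))).
  apply: (cint_le (cB _ _ f4 f3)) => // y ycd.
  rewrite (le_trans (normc_dist3 _ (f (Complex a y)) _)) //.
  by apply: lerD; [exact: r1P|rewrite normcB; exact: r1P].
rewrite (_ : 2 * _ * _ = e / 2 * ((4 * (d - c)) / (4 * (d - c) + 1))); last first.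
  by field; rewrite gt_eqF.
rewrite -[leRHS]mulr1 ler_wpM2l ?divr_ge0 ?(ltW e0) // ler_pdivrMr // mul1r.
by rewrite lerDl.
Qed.

(** Goursat's lemma survives finitely many exceptional vertical lines, on which
    the function is only continuous: thin rectangles around such a line
    contribute arbitrarily little. *)
Lemma contour_exceptional f (X : seq R) : continuous f ->
  (forall x y, x \notin X -> differentiable f (Complex x y : C)) ->
  forall a b c d, a <= b -> c <= d -> contour f a b c d = 0.
Proof.
move=> cf df a b c d ab cd.
have {df} : forall x y, a <= x <= b -> x \notin X -> differentiable f (Complex x y : C).
  by move=> x y _; exact: df.
elim: X a b ab => [|e X IH] a b ab df.
  by apply: (goursat cf ab cd) => x y xab _; exact: (df x y xab isT).
have small (u : C) : (forall r : R, 0 < r -> normc u <= r) -> u = 0.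
  move=> H; apply/eqP; rewrite -normc_eq0 eq_le normc_ge0 andbT.
  rewrite leNgt; apply/negP => u0; have := H (normc u / 2); rewrite divr_gt0 //.
  by move=> /(_ isT); lra.
have L s t : a <= s -> s <= t -> t <= b -> (e < s) || (t < e) -> contour f s t c d = 0.
  move=> sa st tb est; apply: (IH s t st) => x y /andP[sx xt] xX; apply: df.
    by rewrite (le_trans sa) ?(le_trans xt).
  rewrite inE negb_or xX andbT; apply/eqP => xe.
  by move: est; rewrite -xe !ltNge sx xt.
have [eab|] := boolP (a <= e <= b); last first.
  by rewrite negb_and -!ltNge => h; apply: L.
case/andP: eab => ae eb.
rewrite (contour_hsplit _ _ cf ae eb).
have [->|nae] := eqVneq (contour f a e c d) 0; last first.
  exfalso; move/eqP: nae; apply; apply: small => r r0.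
  have [h h0 hP] := contour_thin e cf cd r0.
  have [lt|le] := ltP a (e - h / 2); last first.
    by apply: hP => //; rewrite ?subrr ?normr0 // ler0_norm ?subr_le0 //; lra.
  have m1 : a <= e - h / 2 by exact: ltW.
  have m2 : e - h / 2 <= e by lra.
  rewrite (contour_hsplit _ _ cf m1 m2) L ?add0r //; last 2 first.
  - by lra.
  - by apply/orP; right; lra.
  by apply: hP => //; rewrite ?subrr ?normr0 // ler0_norm; lra.
rewrite add0r; apply: small => r r0.
have [h h0 hP] := contour_thin e cf cd r0.
have [lt|le] := ltP (e + h / 2) b; last first.
  by apply: hP => //; rewrite ?subrr ?normr0 // ger0_norm ?subr_ge0 //; lra.
have m1 : e + h / 2 <= b by exact: ltW.
have m2 : e <= e + h / 2 by lra.
rewrite (contour_hsplit _ _ cf m2 m1) (L (e + h / 2)) ?addr0 //; last 2 first.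
- by lra.
- by apply/orP; left; lra.
by apply: hP => //; rewrite ?subrr ?normr0 // ger0_norm; lra.
Qed.

End Exceptional.

(** * Cauchy's formula on a square *)

Section Square.
Variable R : realType.
Local Notation C := (CC R).
Local Notation Re := (@complex.Re R).
Local Notation Im := (@complex.Im R).
Implicit Types (p z w t : C) (r s : R) (f g phi : C -> C).

(** Regularity is required on the whole lines carrying the sides, where [t - z]
    has no zero for [z] inside; bounds are required on the boundary only. *)
Definition on_lines p r t := (`|Re t - Re p| == r) || (`|Im t - Im p| == r).

Definition on_square p r t :=
  on_lines p r t /\ `|Re t - Re p| <= r /\ `|Im t - Im p| <= r.

Definition inside p r z := `|Re z - Re p| < r /\ `|Im z - Im p| < r.

Definition square_contour f p r : C :=
  contour f (Re p - r) (Re p + r) (Im p - r) (Im p + r).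

Lemma inside_center p r : 0 < r -> inside p r p.
Proof. by move=> r0; rewrite /inside !subrr normr0. Qed.

Lemma inside_near p r z : inside p r z ->
  exists2 e : R, 0 < e & forall t, on_lines p r t -> e <= normc (t - z).
Proof.
move=> [hr hi]; exists (Num.min (r - `|Re z - Re p|) (r - `|Im z - Im p|)).
  by rewrite lt_min !subr_gt0 hr hi.
move=> t /orP[] /eqP tr; rewrite ge_min; apply/orP; [left|right].
  rewrite (le_trans _ (Re_le_normc _)) // raddfB /= -{1}tr lerBlDr.
  by rewrite (le_trans _ (ler_normD _ _)) // addrA subrK.
rewrite (le_trans _ (Im_le_normc _)) // raddfB /= -{1}tr lerBlDr.
by rewrite (le_trans _ (ler_normD _ _)) // addrA subrK.
Qed.

Lemma on_lines_neq p r z t : inside p r z -> on_lines p r t -> t - z != 0.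
Proof.
move=> /inside_near[e e0 eP] /eP; rewrite -normc_eq0 => h.
by rewrite gt_eqF // (lt_le_trans e0).
Qed.

Lemma on_square_normc p r t : on_square p r t -> r <= normc (t - p).
Proof.
move=> [/orP[] /eqP <- _].
  by rewrite -raddfB; exact: Re_le_normc.
by rewrite -raddfB; exact: Im_le_normc.
Qed.

Lemma on_linesE p r : 0 <= r ->
  [/\ forall x, on_lines p r (Complex x (Im p - r)),
      forall x, on_lines p r (Complex x (Im p + r)),
      forall y, on_lines p r (Complex (Re p - r) y) &
      forall y, on_lines p r (Complex (Re p + r) y)].
Proof.
move=> r0; rewrite /on_lines; split=> x /=; apply/orP.
- by right; rewrite addrAC subrr add0r normrN ger0_norm.
- by right; rewrite addrAC subrr add0r ger0_norm.
- by left; rewrite addrAC subrr add0r normrN ger0_norm.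
- by left; rewrite addrAC subrr add0r ger0_norm.
Qed.

Lemma eq_square_contour f g p r : 0 <= r ->
  (forall t, on_lines p r t -> f t = g t) ->
  square_contour f p r = square_contour g p r.
Proof.
move=> r0 fg; have [h1 h2 h3 h4] := on_linesE p r0.
by apply: eq_contour => x; apply: fg.
Qed.

Definition continuous_on_lines f p r :=
  forall t, on_lines p r t -> {for t, continuous f}.

Lemma square_side_continuous f p r : 0 <= r -> continuous_on_lines f p r ->
  side_continuous f (Re p - r) (Re p + r) (Im p - r) (Im p + r).
Proof.
move=> r0 cf; have [h1 h2 h3 h4] := on_linesE p r0.
split=> x; apply: (continuous_comp (g := f)).
- exact: continuous_hline.
- exact/cf/h1.
- exact: continuous_hline.
- exact/cf/h2.
- exact: continuous_vline.
- exact/cf/h3.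
- exact: continuous_vline.
- exact/cf/h4.
Qed.

Lemma square_contour_le f p r (M : R) : 0 <= r -> continuous_on_lines f p r ->
  (forall t, on_square p r t -> normc (f t) <= M) ->
  normc (square_contour f p r) <= 16 * M * r.
Proof.
move=> r0 cf fM; have [h1 h2 h3 h4] := on_linesE p r0.
have le1 (u : R) : u - r <= u + r by lra.
have inr (u v : R) : u - r <= v <= u + r -> `|v - u| <= r.
  by move=> uv; rewrite ler_norml; lra.
have q1 (u : R) : `|u - r - u| <= r by rewrite addrAC subrr add0r normrN ger0_norm.
have q2 (u : R) : `|u + r - u| <= r by rewrite addrAC subrr add0r ger0_norm.
have := contour_le (square_side_continuous r0 cf) (le1 _) (le1 _).
move=> /(_ M) H; rewrite (le_trans (H _ _)) //.
- move=> x /inr xr; split; apply: fM; split => //=.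
- move=> x /inr xr; split; apply: fM; split => //=.
by rewrite le_eqVlt; apply/orP; left; apply/eqP; ring.
Qed.

Definition cauchy_integral phi p r z : C :=
  square_contour (fun t => phi t / (t - z)) p r.

Lemma cvg_inv_sub t z : t - z != 0 -> {for t, continuous (fun t => (t - z)^-1 : C)}.
Proof.
move=> tz; apply: (@cvgV _ _ (nbhs t)) => //.
by apply: (@cvgB _ _ _ (nbhs t)); [exact: cvg_id|exact: cvg_cst].
Qed.

Lemma cauchy_integrand_continuous phi p r z : continuous phi -> inside p r z ->
  continuous_on_lines (fun t => phi t / (t - z)) p r.
Proof.
move=> cphi zin t /(on_lines_neq zin) tz.
by apply: (@cvgM _ _ (nbhs t)); [exact: cphi|exact: cvg_inv_sub].
Qed.

Lemma holomorphic_sub z : holomorphic ((fun t : C => t - z) : C -> C).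
Proof. exact: (holomorphicB (@holomorphic_id _) (@holomorphic_cst _ z)). Qed.

Lemma quotient_differentiable f t z : differentiable f t -> t != z ->
  differentiable (fun t : C => (f t - f z) / (t - z)) t.
Proof.
move=> df tz; have tz0 : t - z != 0 by rewrite subr_eq0.
have d1 : differentiable (fun t : C => f t - f z) t.
  exact: (differentiableB df (@holomorphic_cst _ (f z) t)).
exact: (differentiable_div d1 (@holomorphic_sub z t) tz0).
Qed.

(** Continuous at [z] when [d] is the derivative of [f] there. *)
Definition slope f z (d : C) t := if t == z then d else (f t - f z) / (t - z).

Lemma slopeE f z d t : f t = f z + (t - z) * slope f z d t.
Proof.
rewrite /slope; case: eqVneq => [->|tz]; first by rewrite subrr mul0r addr0.
by rewrite mulrC divfK ?subr_eq0 // addrC subrK.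
Qed.

Lemma slope_near f z d t : t != z ->
  \forall u \near t, (f u - f z) / (u - z) = slope f z d u.
Proof.
move=> tz; apply/nbhsCP; exists (normc (t - z)); first by rewrite normc_gt0 subr_eq0.
move=> u ut; rewrite /slope; case: eqVneq => // uz.
by move: ut; rewrite uz normcB ltxx.
Qed.

Lemma slope_differentiable f z d t : differentiable f t -> t != z ->
  differentiable (slope f z d) t.
Proof.
move=> df tz; apply: near_eq_differentiable (quotient_differentiable df tz).
exact: slope_near.
Qed.

(** Differentiability of [f] at the single point [z] makes the slope continuous
    there; elsewhere it inherits the continuity of [f]. *)
Lemma slope_continuous f z : continuous f -> differentiable f z ->
  exists d, continuous (slope f z d).
Proof.
move=> cf /differentiable_epsP[d dP]; exists d => t.
have [->|tz] := eqVneq t z; last first.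
  have : {for t, continuous (fun u => (f u - f z) / (u - z))}.
    apply: (@cvgM _ _ (nbhs t)); last by apply: cvg_inv_sub; rewrite subr_eq0.
    by apply: (@cvgB _ _ _ (nbhs t)); [exact: cf|exact: cvg_cst].
  move=> /(cvgCP (F:=nbhs t)) H; apply/(cvgCP (F:=nbhs t)) => e e0.
  apply: filterS2 (slope_near f d tz) (H e e0) => u /= E1 E2.
  rewrite -/(slope f z d u) -E1.
  by rewrite [slope f z d t]/slope (negbTE tz).
apply/continuousCP => e e0; have e2 : 0 < e / 2 by rewrite divr_gt0.
have [s s0 sP] := dP _ e2; exists s => // w ws.
rewrite /slope eqxx; case: eqVneq => [_|wz]; first by rewrite subrr normc0.
have wz0 : 0 < normc (w - z) by rewrite normc_gt0 subr_eq0.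
rewrite -(ltr_pM2r wz0) -normcM mulrBl divfK ?subr_eq0 //.
have := sP _ ws; rewrite [z + _]addrC subrK => h.
by rewrite (le_lt_trans h) // ltr_pM2r // ltr_pdivrMr // mulrDr mulr1 ltrDl.
Qed.

(** The slope of [f] at [z] integrates to zero, [Re z] being one more exceptional
    line; expanding the slope on the boundary gives the formula. *)
Lemma cauchy_formula f (X : seq R) p r z : continuous f ->
  (forall t, Re t \notin X -> differentiable f t) ->
  inside p r z -> differentiable f z ->
  cauchy_integral f p r z = f z * cauchy_integral (fun=> 1) p r z.
Proof.
move=> cf df zin dfz; have r0 : 0 <= r.
  by case: zin => h _; rewrite ltW // (le_lt_trans _ h).
have [d cs] := slope_continuous cf dfz.
have : square_contour (slope f z d) p r = 0.
  have le1 (u : R) : u - r <= u + r by lra.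
  apply: (contour_exceptional (X := Re z :: X) cs _ (le1 _) (le1 _)).
  move=> x y; rewrite inE negb_or => /andP[xz xX].
  apply: slope_differentiable; first exact: df.
  by apply: contraNneq xz => <-.
move=> s0.
rewrite /cauchy_integral [X in _ * X](_ : _ = square_contour (fun t => (t - z)^-1) p r);
  last by apply: eq_square_contour => // t _; rewrite mul1r.
have ci : continuous_on_lines (fun t => (t - z)^-1) p r.
  by move=> t /(on_lines_neq zin) tz; exact: cvg_inv_sub.
have s2 := square_side_continuous r0 (cauchy_integrand_continuous cf zin).
have s3 : continuous_on_lines (fun t => f z * (t - z)^-1) p r.
  move=> t tl; apply: (@cvgM _ _ (nbhs t)); [exact: cvg_cst|exact: ci].
rewrite -(contourZ (f z) (square_side_continuous r0 ci)).
apply/eqP; rewrite -subr_eq0 -/(square_contour _ _ _) -(contourB s2); last first.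
  exact: square_side_continuous.
rewrite -s0; apply/eqP; apply: eq_square_contour => // t tl.
have tz := on_lines_neq zin tl; rewrite /slope -subr_eq0 (negbTE tz).
by rewrite mulrBl.
Qed.

(** Opposite sides together contribute [2r / (t^2 + r^2)], at least [1/r] on a
    side of length [2r]; this happens once horizontally and once vertically. *)
Lemma Im_winding_ge4 p r : 0 < r -> 4 <= Im (cauchy_integral (fun=> 1) p r p).
Proof.
move=> r0; rewrite /cauchy_integral.
rewrite (eq_square_contour (g := fun t => (t - p)^-1) (ltW r0)); last first.
  by move=> t _; rewrite mul1r.
rewrite /square_contour /contour.
have den x : 0 < x ^+ 2 + r ^+ 2 by rewrite ltr_wpDl ?sqr_ge0 // exprn_gt0.
set F := fun x : R => _ - _; set G := fun x : R => _ - _.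
have subp x y : Complex x y - p = Complex (x - Re p) (y - Im p) :> C.
  by case: (p).
have inv a b : (Complex a b : C)^-1 =
    Complex (a / (a ^+ 2 + b ^+ 2)) (- (b / (a ^+ 2 + b ^+ 2))) by [].
have FE x : F x = Complex 0 (2 * r / ((x - Re p) ^+ 2 + r ^+ 2)).
  rewrite /F !subp !inv (addrAC (Im p) (- r)) (addrAC (Im p) r) subrr !add0r sqrrN.
  apply/eqP; rewrite eq_complex /= subrr eqxx /=; apply/eqP.
  by field; rewrite gt_eqF.
have GE y : G y = Complex (2 * r / ((y - Im p) ^+ 2 + r ^+ 2)) 0.
  rewrite /G !subp !inv (addrAC (Re p) (- r)) (addrAC (Re p) r) subrr !add0r sqrrN.
  rewrite [r ^+ 2 + _]addrC.
  apply/eqP; rewrite eq_complex /= subrr eqxx andbT; apply/eqP.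
  by field; rewrite gt_eqF.
have cdiv (q : R) : continuous (fun x : R => 2 * r / ((x - q) ^+ 2 + r ^+ 2)).
  move=> x; apply: cvgM; first exact: cvg_cst.
  apply: cvgV; first by rewrite gt_eqF.
  apply: cvgD; last exact: cvg_cst.
  rewrite expr2; apply: (@cvgM _ _ _ _ (fun x => x - q) (fun x => x - q)); 
    by apply: cvgB; [exact: cvg_id|exact: cvg_cst].
have cF : continuous F.
  rewrite (_ : F = fun x => Complex 0 (2 * r / ((x - Re p) ^+ 2 + r ^+ 2)));
    last exact/funext.
  move=> x; exact: (continuous_comp (cdiv (Re p) x) (@continuous_vline _ 0 _)).
have cG : continuous (fun y => ci R * G y).
  rewrite (_ : (fun y => _) = fun x => Complex 0 (2 * r / ((x - Im p) ^+ 2 + r ^+ 2))).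
    move=> x; exact: (continuous_comp (cdiv (Im p) x) (@continuous_vline _ 0 _)).
  by apply/funext => y; rewrite GE /ci; apply/eqP; rewrite eq_complex /=; apply/andP;
    split; apply/eqP; ring.
have cG0 : continuous G.
  rewrite (_ : G = fun x => Complex (2 * r / ((x - Im p) ^+ 2 + r ^+ 2)) 0);
    last exact/funext.
  move=> x; exact: (continuous_comp (cdiv (Im p) x) (@continuous_hline _ 0 _)).
rewrite -cintZ //.
have low (q x : R) : q - r <= x <= q + r ->
    r^-1 <= 2 * r / ((x - q) ^+ 2 + r ^+ 2).
  move=> qx; rewrite ler_pdivlMr // mulrC ler_pdivrMr //.
  have : (x - q) ^+ 2 <= r ^+ 2.
    have h1 : 0 <= r - (x - q) by lra.
    have h2 : 0 <= r + (x - q) by lra.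
    by have := mulr_ge0 h1 h2; nra.
  by nra.
have le1 (u : R) : u - r <= u + r by lra.
have H1 := Im_cint_ge (m := r^-1) cF (le1 (Re p)).
have H2 := Im_cint_ge (m := r^-1) cG (le1 (Im p)).
have E (q : R) : r^-1 * (q + r - (q - r)) = 2.
  by rewrite (_ : q + r - (q - r) = 2 * r); [field; rewrite gt_eqF|ring].
rewrite raddfD /= (_ : 4 = 2 + 2 :> R); last by rewrite -natrD.
apply: lerD.
  rewrite -(E (Re p)); apply: H1 => x xp; rewrite FE /=; exact: low.
rewrite -(E (Im p)); apply: H2 => x xp; rewrite GE /=.
by rewrite mul0r mul1r add0r; exact: low.
Qed.

End Square.

(** * Removable singularities and their consequences *)

Section Cauchy.
Variable R : realType.
Local Notation C := (CC R).
Local Notation Re := (@complex.Re R).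
Local Notation Im := (@complex.Im R).
Implicit Types (p z w t : C) (r s : R) (f g phi : C -> C).

Let cM f g t : {for t, continuous f} -> {for t, continuous g} ->
  {for t, continuous (fun u => f u * g u)}.
Proof. by move=> cf cg; exact: (@cvgM _ _ (nbhs t) _ _ _ _ _ cf cg). Qed.

Let cB f g t : {for t, continuous f} -> {for t, continuous g} ->
  {for t, continuous (fun u => f u - g u)}.
Proof. by move=> cf cg; exact: (@cvgB _ _ _ (nbhs t) _ _ _ _ _ cf cg). Qed.

Let cC (k : C) t : {for t, continuous ((fun=> k) : C -> C)}.
Proof. exact: cst_continuous. Qed.

Lemma inside_of_normc p r z : normc (z - p) < r -> inside p r z.
Proof.
move=> h; split; rewrite -raddfB; first by rewrite (le_lt_trans (Re_le_normc _)).
by rewrite (le_lt_trans (Im_le_normc _)).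
Qed.

Lemma on_square_far p r z t : on_square p r t -> r - normc (z - p) <= normc (t - z).
Proof.
move=> /on_square_normc h; rewrite lerBlDr (le_trans h) //.
by rewrite (le_trans (normc_dist3 _ z _)).
Qed.

Lemma bounded_on_square f p r : continuous f ->
  exists2 M : R, 0 <= M & forall t, on_square p r t -> normc (f t) <= M.
Proof.
move=> cf.
have [M M0 fM] := bounded_on_rectangle (Re p - r) (Re p + r) (Im p - r) (Im p + r) cf.
exists M => // -[x y] [_ [/= hx hy]]; apply: fM.
  by move: hx; rewrite ler_norml; lra.
by move: hy; rewrite ler_norml; lra.
Qed.

Lemma cauchy_integral_le phi p r z (M : R) : continuous phi -> normc (z - p) < r ->
  (forall t, on_square p r t -> normc (phi t) <= M) ->
  normc (cauchy_integral phi p r z) <= 16 * (M / (r - normc (z - p))) * r.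
Proof.
move=> cphi zr phiM.
have zin := inside_of_normc zr.
have r0 : 0 <= r by rewrite (le_trans (normc_ge0 _) (ltW zr)).
apply: square_contour_le r0 (cauchy_integrand_continuous cphi zin) _ => t tsq.
have d0 : 0 < r - normc (z - p) by rewrite subr_gt0.
have tz := on_square_far z tsq.
rewrite normcM normcV ler_pM ?normc_ge0 ?invr_ge0 ?normc_ge0 ?phiM //.
by rewrite lef_pV2 ?posrE // (lt_le_trans d0).
Qed.

(** The candidate derivative is obtained under the integral sign; the remainder is
    [h^2] times an integral bounded in terms of the distance from [z] to the boundary. *)
Lemma cauchy_integral_differentiable phi p r z : continuous phi ->
  normc (z - p) < r -> differentiable (cauchy_integral phi p r) z.
Proof.
move=> cphi zr; have zin := inside_of_normc zr.
have r0 : 0 <= r by rewrite (le_trans (normc_ge0 _) (ltW zr)).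
set D := r - normc (z - p); have D0 : 0 < D by rewrite subr_gt0.
have [M M0 phiM] := bounded_on_square p r cphi.
have c2V t : t - z != 0 ->
    {for t, continuous (fun t : C => (t - z)^-1 * (t - z)^-1)}.
  by move=> tz; exact: cM (cvg_inv_sub tz) (cvg_inv_sub tz).
have ciV : continuous_on_lines (fun t => phi t * ((t - z)^-1 * (t - z)^-1)) p r.
  move=> t /(on_lines_neq zin) tz.
  exact: cM (cphi t) (c2V t tz).
apply/differentiable_epsP.
exists (square_contour (fun t => phi t * ((t - z)^-1 * (t - z)^-1)) p r) => e e0.
pose K := 16 * (M * 2 / D ^+ 3) * r.
have K0 : 0 <= K by rewrite !mulr_ge0 // invr_ge0 exprn_ge0 // ltW.
have K10 : 0 < K + 1 by rewrite ltr_wpDl.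
exists (Num.min (D / 2) (e / (K + 1))); first by rewrite lt_min !divr_gt0.
move=> h; rewrite lt_min => /andP[hD he].
have zhr : normc (z + h - p) < r.
  rewrite addrAC (le_lt_trans (normcD _ _)) //.
  by move: hD D0; rewrite /D; move: (normc h) (normc (z - p)) => ? ? ; lra.
have zhin := inside_of_normc zhr.
have c1 := square_side_continuous r0 (cauchy_integrand_continuous cphi zhin).
have c2 := square_side_continuous r0 (cauchy_integrand_continuous cphi zin).
have c3 := square_side_continuous r0 ciV.
rewrite /cauchy_integral.
pose G t := h ^+ 2 * (phi t / (t - (z + h)) * ((t - z)^-1 * (t - z)^-1)).
have cG0 : continuous_on_lines (fun t => phi t / (t - (z + h)) * ((t - z)^-1 * (t - z)^-1)) p r.
  move=> t tl; have tz := on_lines_neq zin tl.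
  exact: cM (cauchy_integrand_continuous cphi zhin tl) (c2V t tz).
have -> : square_contour (fun t => phi t / (t - (z + h))) p r -
    square_contour (fun t => phi t / (t - z)) p r -
    square_contour (fun t => phi t * ((t - z)^-1 * (t - z)^-1)) p r * h = square_contour G p r.
  have E := contourZ (h ^+ 2) (square_side_continuous r0 cG0).
  rewrite [RHS]E mulrC -(contourZ h c3).
  rewrite -(contourB c1 c2) -[RHS]E.
  have c4 : side_continuous (fun t => h * (phi t * ((t - z)^-1 * (t - z)^-1)))
      (Re p - r) (Re p + r) (Im p - r) (Im p + r).
    apply: (square_side_continuous r0) => t tl.
    exact: cM (@cC h t) (ciV t tl).
  have c5 : side_continuous (fun t => phi t / (t - (z + h)) - phi t / (t - z))
      (Re p - r) (Re p + r) (Im p - r) (Im p + r).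
    apply: (square_side_continuous r0) => t tl.
    exact: cB (cauchy_integrand_continuous cphi zhin tl)
              (cauchy_integrand_continuous cphi zin tl).
  rewrite -(contourB c5 c4).
  apply: (eq_square_contour r0) => t tl.
  have tz := on_lines_neq zin tl; have tzh := on_lines_neq zhin tl.
  by field; rewrite tz tzh.
have Gle : normc (square_contour G p r) <= 16 * (normc h ^+ 2 * (M * 2 / D ^+ 3)) * r.
  have cG : continuous_on_lines G p r by move=> t tl; exact: cM (@cC _ t) (cG0 t tl).
  apply: (square_contour_le r0 cG) => t tsq; rewrite /G normcM normcX ler_wpM2l ?exprn_ge0 ?normc_ge0 //.
  have tz : D <= normc (t - z) by exact: on_square_far.
  have tzh : D / 2 <= normc (t - (z + h)).
    have := normc_dist (t - z) h; rewrite opprD addrA.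
    by move: hD tz; move: (normc h) (normc _) (normc _) => ? ? ?; lra.
  rewrite !normcM !normcV.
  have -> : M * 2 / D ^+ 3 = M * (D / 2)^-1 * (D^-1 * D^-1) by field; rewrite gt_eqF.
  have D20 : 0 < D / 2 by rewrite divr_gt0.
  have q1 : (normc (t - (z + h)))^-1 <= (D / 2)^-1.
    by rewrite lef_pV2 ?posrE // (lt_le_trans D20).
  have q2 : (normc (t - z))^-1 <= D^-1.
    by rewrite lef_pV2 ?posrE // (lt_le_trans D0).
  apply: ler_pM; rewrite ?mulr_ge0 ?invr_ge0 ?normc_ge0 //.
    by apply: ler_pM; rewrite ?invr_ge0 ?normc_ge0 // phiM.
  by apply: ler_pM; rewrite ?invr_ge0 ?normc_ge0.
rewrite (le_trans Gle) //.
have -> : 16 * (normc h ^+ 2 * (M * 2 / D ^+ 3)) * r = K * normc h * normc h.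
  by rewrite /K; ring.
rewrite ler_wpM2r ?normc_ge0 //.
have : normc h * (K + 1) < e by rewrite -ltr_pdivlMr.
by have := normc_ge0 h; move: (normc h) => x x0; nra.
Qed.

Lemma winding_neq0 p r : 0 < r -> cauchy_integral (fun=> 1) p r p != 0.
Proof.
by move=> /(Im_winding_ge4 p); apply: contraTneq => ->; rewrite -ltNge.
Qed.

(** A function represented by Cauchy's formula near [p] is there a quotient of two
    integrals depending differentiably on the point; the denominator is the
    winding integral, nonzero near [p]. *)
Lemma differentiable_of_cauchy f phi p r : 0 < r -> continuous phi ->
  (\forall z \near p,
    cauchy_integral phi p r z = f z * cauchy_integral (fun=> 1) p r z) ->
  differentiable f p.
Proof.
move=> r0 cphi H.
have pr : normc (p - p) < r by rewrite subrr normc0.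
have d1 := cauchy_integral_differentiable cphi pr.
have d2 := cauchy_integral_differentiable (@cst_continuous _ _ (1 : C)) pr.
have W0 := winding_neq0 p r0.
have dd := differentiable_div d1 d2 W0.
apply: near_eq_differentiable dd.
have cW := iffLR (continuousCP _ p) (differentiable_continuous d2).
have W1 : 0 < normc (cauchy_integral (fun=> 1 : C) p r p) by rewrite normc_gt0.
have [e e0 eP] := cW _ W1.
have H2 : \forall z \near p, cauchy_integral (fun=> 1 : C) p r z != 0.
  apply/nbhsCP; exists e => // z /eP; apply: contraTneq => ->.
  by rewrite sub0r normcN ltxx.
by apply: filterS2 H H2 => z -> W; rewrite mulfK.
Qed.

(** Riemann's theorem on removable singularities: Cauchy's formula holds at the
    points other than [p], hence at [p] by continuity, and it implies
    differentiability. *)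
Lemma removable f p : continuous f -> (forall z, z != p -> differentiable f z) ->
  holomorphic (f : C -> C).
Proof.
move=> cf df z; have [->|] := eqVneq z p; last exact: df.
apply: (differentiable_of_cauchy ltr01 cf).
pose g z := cauchy_integral f p 1 z - f z * cauchy_integral (fun=> 1) p 1 z.
have pr : normc (p - p) < 1 :> R by rewrite subrr normc0 ltr01.
have d1 := cauchy_integral_differentiable cf pr.
have d2 := cauchy_integral_differentiable (@cst_continuous _ _ (1 : C)) pr.
have g0 w : w != p -> normc (w - p) < 1 -> g w = 0.
  move=> wp w1; rewrite /g; apply/eqP; rewrite subr_eq0; apply/eqP.
  apply: (cauchy_formula (X := [:: Re p]) cf _ (inside_of_normc w1) (df w wp)).
  by move=> t tX; apply: df; apply: contraNneq tX => ->; exact: mem_head.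
have cg : {for p, continuous g}.
  exact: cB (differentiable_continuous d1) (cM (cf p) (differentiable_continuous d2)).
have gp : g p = 0.
  apply/eqP/negPn/negP => gp; have gp0 : 0 < normc (g p) by rewrite normc_gt0.
  have [e e0 eP] := iffLR (continuousCP _ p) cg _ gp0.
  pose h : R := Num.min (e / 2) (1 / 2).
  have h0 : 0 < h by rewrite lt_min !divr_gt0.
  have nh : normc (p + h%:C - p) = h.
    by rewrite addrAC subrr add0r normc_real gtr0_norm.
  have h1 : normc (p + h%:C - p) < e.
    by rewrite nh gt_min; apply/orP; left; lra.
  have h2 : g (p + h%:C) = 0.
    apply: g0; first by rewrite -subr_eq0 -normc_eq0 nh gt_eqF.
    by rewrite nh gt_min; apply/orP; right; lra.
  by have := eP _ h1; rewrite h2 sub0r normcN ltxx.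
apply/nbhsCP; exists 1 => // w w1; apply/eqP; rewrite -subr_eq0; apply/eqP.
by have [->|wp] := eqVneq w p; [exact: gp|exact: g0].
Qed.

(** A weak maximum principle; the constant comes from the lower bound for the
    winding integral and the crude bound for contour integrals. *)
Lemma center_bound f p r (M : R) : holomorphic (f : C -> C) -> 0 < r ->
  (forall t, on_square p r t -> normc (f t) <= M) -> normc (f p) <= 4 * M.
Proof.
move=> hf r0 fM.
have pr : normc (p - p) < r by rewrite subrr normc0.
have cf := holomorphic_continuous hf.
have := cauchy_formula (X := [::]) cf (fun t _ => hf t) (inside_center p r0) (hf p).
have := cauchy_integral_le cf pr fM.
rewrite subrr normc0 subr0 => B E; move: B; rewrite E normcM.
have -> : 16 * (M / r) * r = 16 * M by field; rewrite gt_eqF.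
have W : 4 <= normc (cauchy_integral (fun=> 1) p r p).
  rewrite (le_trans (Im_winding_ge4 p r0)) // (le_trans (ler_norm _)) //.
  exact: Im_le_normc.
have y0 := normc_ge0 (f p); move: W y0.
set x := normc (cauchy_integral _ _ _ _); set y := normc (f p) => x4 y0 xy.
have : 0 <= y * (x - 4) by rewrite mulr_ge0 ?subr_ge0.
by lra.
Qed.

Lemma divided_difference f p : holomorphic (f : C -> C) ->
  exists2 g, holomorphic (g : C -> C) & forall z, f z = f p + (z - p) * g z.
Proof.
move=> hf; have cf := holomorphic_continuous hf.
have [d cs] := slope_continuous cf (hf p).
exists (slope f p d); last by move=> z; exact: slopeE.
by apply: (removable (p := p) cs) => z zp; exact: (slope_differentiable d (hf z) zp).
Qed.

Lemma le0_of_le_eps (u K : R) : (forall e, 0 < e -> u <= K * e) -> u <= 0.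
Proof.
move=> H; rewrite leNgt; apply/negP => u0.
have K0 : 0 < K by have := H 1 ltr01; rewrite mulr1; apply: lt_le_trans.
have := H (u / K / 2); rewrite !divr_gt0 // => /(_ isT).
by rewrite mulrA [K * _]mulrC divfK ?gt_eqF //; lra.
Qed.

(** The slope of [f] at [b] is entire and decays like the inverse of the distance,
    so it vanishes by the bound at the centre of large squares. *)
Lemma liouville f (M : R) : holomorphic (f : C -> C) ->
  (forall z, normc (f z) <= M) -> forall a b, f a = f b.
Proof.
move=> hf fM a b; have [g hg fE] := divided_difference b hf.
suff -> : f a = f b + (a - b) * 0 by rewrite mulr0 addr0.
rewrite {1}fE; congr (_ + _ * _); apply/eqP.
rewrite -normc_eq0 eq_le normc_ge0 andbT.
have M0 : 0 <= M by rewrite (le_trans (normc_ge0 (f 0))).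
apply: (@le0_of_le_eps _ (8 * M)) => e e0.
pose r := normc (b - a) + e^-1.
have r0 : 0 < r by rewrite ltr_wpDl ?normc_ge0 ?invr_gt0.
have -> : 8 * M * e = 4 * (2 * M * e) by ring.
apply: (center_bound hg r0) => t tsq.
have tb : e^-1 <= normc (t - b).
  have := on_square_far b tsq; rewrite /r addrAC subrr add0r; exact.
have tb0 : 0 < normc (t - b) by rewrite (lt_le_trans _ tb) ?invr_gt0.
have H : normc (t - b) * normc (g t) <= 2 * M.
  rewrite -normcM; have -> : (t - b) * g t = f t - f b by rewrite fE addrAC subrr add0r.
  by rewrite (le_trans (normcD _ _)) // normcN mulr2n mulrDl mul1r lerD.
rewrite -ler_pdivrMr // (le_trans _ H) // mulrC ler_wpM2r ?normc_ge0 //.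
Qed.

Lemma le0_of_le_geometric (u K q : R) : 0 <= q -> q < 1 ->
  (forall n, u <= K * q ^+ n) -> u <= 0.
Proof.
move=> q0 q1 H.
have : (fun n => K * q ^+ n) @ \oo --> K * 0.
  by apply: cvgM; [exact: cvg_cst|apply: cvg_expr; rewrite ger0_norm].
rewrite mulr0 => h; apply: (cvgr_to_ge h).
by apply: nearW => n; exact: H.
Qed.

(** A function vanishing near [p] stays entire after division by any power of
    [z - p].  On the boundary of a large square centred at [z] this power
    exceeds its value at [z] by a geometric factor. *)
Lemma identity_theorem f p : holomorphic (f : C -> C) ->
  (\forall z \near p, f z = 0) -> forall z, f z = 0.
Proof.
move=> hf fp z; have [->|zp] := eqVneq z p; first exact: nbhs_singleton fp.
have cf := holomorphic_continuous hf.
have hh k : holomorphic ((fun t : C => f t / (t - p) ^+ k) : C -> C).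
  move=> t; have [->|tp] := eqVneq t p.
    apply: (near_eq_differentiable _ (@holomorphic_cst _ 0 p)).
    by apply: filterS fp => u ->; rewrite mul0r.
  have tp0 : (t - p) ^+ k != 0 by rewrite expf_neq0 // subr_eq0.
  exact: (differentiable_div (hf t) (holomorphicX k (@holomorphic_sub _ p) t) tp0).
set rho := normc (z - p); have rho0 : 0 < rho by rewrite normc_gt0 subr_eq0.
(* every boundary point is then at distance at least rho + 1 from p *)
pose r := 2 * rho + 1; have r0 : 0 < r by rewrite /r; lra.
have [M M0 fM] := bounded_on_square z r cf.
apply/eqP; rewrite -normc_eq0 eq_le normc_ge0 andbT.
have rho1 : 0 < rho + 1 by lra.
apply: (@le0_of_le_geometric _ (4 * M) (rho / (rho + 1))).
- by rewrite divr_ge0 // ltW.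
- by rewrite ltr_pdivrMr // mul1r ltrDl.
move=> k; have rk : 0 < rho ^+ k by rewrite exprn_gt0.
have := center_bound (M := M / (rho + 1) ^+ k) (hh k) r0.
have H t : on_square z r t -> normc (f t / (t - p) ^+ k) <= M / (rho + 1) ^+ k.
  move=> tsq; rewrite normcM normcV normcX.
  have tp : rho + 1 <= normc (t - p).
    have := on_square_far p tsq; rewrite [normc (p - z)]normcB -/rho /r.
    by move: (normc _) => x; lra.
  rewrite ler_pM ?invr_ge0 ?exprn_ge0 ?normc_ge0 ?fM //.
  rewrite lef_pV2 ?posrE ?exprn_gt0 // ?(lt_le_trans rho1 tp) //.
  by apply: lerXn2r => //; rewrite nnegrE ?normc_ge0 // ltW.
move=> /(_ z H); rewrite normcM normcV normcX -/rho ler_pdivrMr // => h.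
rewrite (le_trans h) // expr_div_n le_eqVlt; apply/orP; left; apply/eqP.
by ring.
Qed.

(** Weierstrass: Cauchy's formula passes to a locally uniform limit. *)
Lemma weierstrass (f : nat -> C -> C) F : (forall n, holomorphic (f n : C -> C)) ->
  (forall M e : R, 0 < e ->
    exists n, forall z, normc z <= M -> normc (f n z - F z) <= e) ->
  holomorphic (F : C -> C).
Proof.
move=> hf fF.
have cF : continuous F.
  move=> z; apply/continuousCP => e e0; have e4 : 0 < e / 4 by rewrite divr_gt0.
  have [n nP] := fF (normc z + 1) _ e4.
  have e2 : 0 < e / 2 by rewrite divr_gt0.
  have cn : continuous (f n) by exact: holomorphic_continuous (hf n).
  have [s s0 sP] := iffLR (continuousCP _ z) (cn z) _ e2.
  exists (Num.min s 1); first by rewrite lt_min s0 ltr01.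
  move=> w; rewrite lt_min => /andP[ws w1].
  have b1 : normc (f n z - F z) <= e / 4 by apply: nP; rewrite lerDl.
  have b2 : normc (f n w - F w) <= e / 4.
    apply: nP; rewrite -{1}[w](subrK z) (le_trans (normcD _ _)) // addrC lerD2l.
    exact: ltW.
  have b3 := sP _ ws.
  have -> : F w - F z = - (f n w - F w) + ((f n w - f n z) + (f n z - F z)) by ring.
  have := normcD (f n w - f n z) (f n z - F z).
  have := normcD (- (f n w - F w)) ((f n w - f n z) + (f n z - F z)).
  rewrite normcN; move: b1 b2 b3; move: (normc _) (normc _) (normc _) (normc _) (normc _).
  by move=> ? ? ? ? ?; lra.
move=> p; apply: (differentiable_of_cauchy ltr01 cF).
apply/nbhsCP; exists (1 / 2) => [|z zp]; first by lra.
have z1 : normc (z - p) < 1 by lra.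
have zin := inside_of_normc z1.
apply/eqP; rewrite -subr_eq0 -normc_eq0 eq_le normc_ge0 andbT.
set W := cauchy_integral (fun=> 1) p 1 z.
apply: (@le0_of_le_eps _ (32 + normc W)) => e e0.
have [n nP] := fF (normc p + 3) _ e0.
have E := cauchy_formula (X := [::]) (holomorphic_continuous (hf n))
  (fun t _ => hf n t) zin (hf n z).
have cfn := holomorphic_continuous (hf n).
have cd : continuous (fun t => f n t - F t).
  by move=> t; exact: cB (cfn t) (cF t).
have -> : cauchy_integral F p 1 z - F z * W =
    - cauchy_integral (fun t => f n t - F t) p 1 z + (f n z - F z) * W.
  have -> : cauchy_integral (fun t => f n t - F t) p 1 z =
      cauchy_integral (f n) p 1 z - cauchy_integral F p 1 z.
    have c1 := square_side_continuous ler01 (cauchy_integrand_continuous cfn zin).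
    have c2 := square_side_continuous ler01 (cauchy_integrand_continuous cF zin).
    rewrite /cauchy_integral -(contourB c1 c2).
    by apply: (eq_square_contour ler01) => t _; rewrite mulrBl.
  by rewrite E -/W; ring.
rewrite (le_trans (normcD _ _)) // normcN normcM mulrDl lerD //; last first.
  rewrite mulrC ler_wpM2l ?normc_ge0 //; apply: nP.
  rewrite -[z](subrK p) (le_trans (normcD _ _)) //.
  by move: zp; move: (normc _) (normc _) => ? ?; lra.
have B : forall t, on_square p 1 t -> normc (f n t - F t) <= e.
  move=> t [_ [t1 t2]]; apply: nP.
  have := normcD (t - p) p; rewrite subrK => h; rewrite (le_trans h) //.
  have := normc_le_ReIm (t - p); rewrite !raddfB /=.
  by move: t1 t2; move: (normc _) (normc _) `|_| `|_| => ? ? ? ?; lra.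
rewrite (le_trans (cauchy_integral_le cd z1 B)) // mulr1.
have D : 1 / 2 <= 1 - normc (z - p) by lra.
have D0 : 0 < 1 - normc (z - p) by lra.
have -> : 32 * e = 16 * (2 * e) :> R by ring.
rewrite ler_wpM2l // ler_pdivrMr // mulrAC.
rewrite -[leLHS]mul1r ler_wpM2r ?(ltW e0) //; lra.
Qed.

End Cauchy.

(** * The complex exponential *)

Section Exponential.
Variable R : realType.
Local Notation C := (CC R).
Local Notation Re := (@complex.Re R).
Local Notation Im := (@complex.Im R).
Implicit Types (z w h : C).

Lemma cexpD z w : cexp (z + w) = cexp z * cexp w.
Proof.
rewrite /cexp !raddfD /= expRD cosD sinD.
by apply/eqP; rewrite eq_complex /=; apply/andP; split; apply/eqP; ring.
Qed.

Lemma cexp0 : cexp (0 : C) = 1.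
Proof. by rewrite /cexp /= expR0 cos0 sin0 mulr1 mulr0. Qed.

Lemma normc_cexp z : normc (cexp z) = expR (Re z).
Proof.
rewrite /cexp /ComplexField.Normc.normc !exprMn -mulrDr cos2Dsin2 mulr1.
by rewrite sqrtr_sqr ger0_norm // expR_ge0.
Qed.

Lemma cexp_neq0 z : cexp z != 0.
Proof. by rewrite -normc_eq0 normc_cexp gt_eqF ?expR_gt0. Qed.

Lemma cexpN z : cexp (- z) = (cexp z)^-1.
Proof.
apply: (mulfI (cexp_neq0 z)); rewrite -cexpD subrr cexp0 divff //.
exact: cexp_neq0.
Qed.

Lemma cexpX z n : cexp (z * n%:R) = cexp z ^+ n.
Proof.
elim: n => [|n IH]; first by rewrite mulr0 expr0 cexp0.
by rewrite -natr1 mulrDr mulr1 cexpD IH exprSr.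
Qed.

Lemma ci2 : ci R * ci R = -1.
Proof. by apply/eqP; rewrite eq_complex /= !mulr0 !mul0r mulr1 sub0r addr0 oppr0 !eqxx. Qed.

Lemma Re_ciM z : Re (ci R * z) = - Im z.
Proof. by case: z => a b; rewrite /ci /= mul0r mul1r sub0r. Qed.

Lemma Im_ciM z : Im (ci R * z) = Re z.
Proof. by case: z => a b; rewrite /ci /= mul0r mul1r add0r. Qed.

Lemma Re_realM (x : R) z : Re (x%:C * z) = x * Re z.
Proof. by case: z => a b /=; rewrite mul0r subr0. Qed.

Lemma Im_realM (x : R) z : Im (x%:C * z) = x * Im z.
Proof. by case: z => a b /=; rewrite mul0r addr0. Qed.

Lemma complex_eqP z w : Re z = Re w -> Im z = Im w -> z = w.
Proof. by case: z w => a b [c d] /= -> ->. Qed.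

Lemma real_increment (f : R -> R) (d : R) : is_derive (0 : R) 1 f d ->
  forall e : R, 0 < e -> exists2 r : R, 0 < r &
    forall b, `|b| < r -> `|f b - f 0 - d * b| <= e * `|b|.
Proof.
move=> [/cvg_ex[l /(cvgrPdist_lt (F := (0 : R)^')) fl] fd] e e0.
have ld : l = d.
  rewrite -fd; apply/esym/cvg_lim; first exact: norm_hausdorff.
  exact/(cvgrPdist_lt (F := (0 : R)^')).
have /nbhsRP[r r0 rP] := fl e e0; exists r => // b br.
have [->|b0] := eqVneq b 0; first by rewrite subrr mulr0 subrr normr0 mulr0.
have := rP b; rewrite subr0 => /(_ br b0) /=.
rewrite addr0 [_ *: 1]mulr1 ld => /ltW H.
have -> : f b - f 0 - d * b = - ((d - b^-1 *: (f b - f 0)) * b).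
  by rewrite mulrBl [_ *: _]mulrC -mulrA mulVf // mulr1 opprB.
by rewrite normrN normrM ler_wpM2r.
Qed.

Lemma cexp_increment (e : R) : 0 < e -> exists2 r : R, 0 < r &
  forall h, normc h < r -> normc (cexp h - 1 - h) <= e * normc h.
Proof.
move=> e0; have [s [s0 s1 se]] : exists s : R, [/\ 0 < s, s <= 1 & s <= e / 20].
  exists (Num.min (e / 20) 1); split; last by rewrite ge_min lexx.
    by rewrite lt_min divr_gt0 //= ltr01.
  by rewrite ge_min lexx orbT.
have [r1 r10 E1] := real_increment (is_derive_expR 0) s0.
have [r2 r20 E2] := real_increment (is_derive_cos 0) s0.
have [r3 r30 E3] := real_increment (is_derive_sin 0) s0.
exists (Num.min (Num.min r1 r2) (Num.min r3 s)); first by rewrite !lt_min r10 r20 r30 s0.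
move=> h; rewrite !lt_min => /andP[/andP[h1 h2] /andP[h3 h4]].
have aN := Re_le_normc h; have bN := Im_le_normc h.
set a := Re h in aN *; set b := Im h in bN *; set N := normc h in h1 h2 h3 h4 aN bN *.
have := E1 a (le_lt_trans aN h1); have := E2 b (le_lt_trans bN h2).
have := E3 b (le_lt_trans bN h3).
rewrite expR0 cos0 sin0 subr0 oppr0 mul0r subr0 !mul1r.
set E := expR a - 1 - a; set K := cos b - 1; set S := sin b - b => HS HK HE.
have N0 : 0 <= N by exact: normc_ge0.
have {}HS : `|S| <= s * N by rewrite (le_trans HS) // ler_wpM2l // ltW.
have {}HK : `|K| <= s * N by rewrite (le_trans HK) // ler_wpM2l // ltW.
have {}HE : `|E| <= s * N by rewrite (le_trans HE) // ler_wpM2l // ltW.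
have sN : s * N <= s by rewrite -[leRHS]mulr1 ler_wpM2l ?(ltW s0) // ltW // (lt_le_trans h4).
have ReE : Re (cexp h - 1 - h) = E + (1 + a + E) * K.
  rewrite !raddfB /= -/a -/b /E /K; ring.
have ImE : Im (cexp h - 1 - h) = (1 + a + E) * S + b * (a + E).
  rewrite !raddfB /= -/a -/b /E /S; ring.
have A1 : `|1 + a + E| <= 3.
  have a1 : `|a| <= 1 by rewrite (le_trans aN) // ltW // (lt_le_trans h4).
  have HE1 : `|E| <= 1 by rewrite (le_trans HE) // (le_trans sN).
  have := ler_normD (1 + a) E; have := ler_normD 1 a; rewrite normr1.
  by move: a1 HE1; lra.
have A2 : `|a + E| <= s + s.
  rewrite (le_trans (ler_normD _ _)) // lerD // ?(le_trans HE) //.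
  by rewrite (le_trans aN) // ltW.
rewrite (le_trans (normc_le_ReIm _)) // ReE ImE.
have B1 : `|E + (1 + a + E) * K| <= s * N + 3 * (s * N).
  by rewrite (le_trans (ler_normD _ _)) // lerD // normrM ler_pM.
have B2 : `|(1 + a + E) * S + b * (a + E)| <= 3 * (s * N) + N * (s + s).
  by rewrite (le_trans (ler_normD _ _)) // lerD // normrM ler_pM.
rewrite (le_trans (lerD B1 B2)) //.
have -> : s * N + 3 * (s * N) + (3 * (s * N) + N * (s + s)) = 9 * s * N by ring.
by rewrite ler_wpM2r //; lra.
Qed.

Lemma holomorphic_cexp : holomorphic (@cexp R : C -> C).
Proof.
move=> z; apply/differentiable_epsP; exists (cexp z) => e e0.
have ez : 0 < e / expR (Re z) by rewrite divr_gt0 ?expR_gt0.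
have [r r0 rP] := cexp_increment ez; exists r => // h /rP H.
rewrite cexpD -{2}[cexp z]mulr1 -!mulrBr normcM normc_cexp mulrC.
by rewrite -ler_pdivlMr ?expR_gt0 // mulrAC.
Qed.

Lemma holomorphic_cexp_affine (a b : C) :
  holomorphic ((fun z => cexp (a * z + b)) : C -> C).
Proof.
apply: (holomorphic_comp holomorphic_cexp).
apply: holomorphicD (@holomorphic_cst _ b).
exact: holomorphicM (@holomorphic_cst _ a) (@holomorphic_id _).
Qed.

Lemma cexp_pi : cexp (cpi R * ci R) = -1.
Proof.
rewrite [cpi R * _]mulrC /cexp Re_ciM Im_ciM /cpi /= oppr0 expR0 cospi sinpi !mul1r.
by apply/eqP; rewrite eq_complex /= oppr0 !eqxx.
Qed.

Lemma cexp_2pi : cexp (2 * cpi R * ci R) = 1.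
Proof. by rewrite -mulrA mulr2n mulrDl mul1r cexpD cexp_pi mulrNN mulr1. Qed.

Lemma cexp_2pi_int (k : int) : cexp (2 * cpi R * ci R * k%:~R) = 1.
Proof.
case: k => n; first by rewrite -pmulrn cexpX cexp_2pi expr1n.
by rewrite NegzE mulrNz mulrN cexpN -pmulrn cexpX cexp_2pi expr1n invr1.
Qed.

(** After subtracting a multiple of [2 pi i] the imaginary part lies in a period
    starting at [0], where the cosine takes the value [1] only at [0]. *)
Lemma cexp_eq1 z : cexp z = 1 -> exists k : int, z = 2 * cpi R * ci R * k%:~R.
Proof.
move=> z1; pose P : R := pi *+ 2; have P0 : 0 < P by rewrite mulrn_wgt0 // pi_gt0.
have ImP (k : int) : Im (2 * cpi R * ci R * k%:~R) = P * k%:~R.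
  rewrite (_ : 2 * _ * _ * _ = ci R * (P * k%:~R)%:C) ?Im_ciM //.
  by rewrite rmorphM rmorph_int rmorphMn /= /cpi; ring.
have ReP (k : int) : Re (2 * cpi R * ci R * k%:~R) = 0.
  rewrite (_ : 2 * _ * _ * _ = ci R * (P * k%:~R)%:C) ?Re_ciM /= ?oppr0 //.
  by rewrite rmorphM rmorph_int rmorphMn /= /cpi; ring.
pose k := Num.floor (Im z / P).
have kP : 0 <= Im z - P * k%:~R < P.
  have := floor_le_tmp (Im z / P); have := floorD1_gt (Im z / P).
  rewrite -/k ltr_pdivrMr // ler_pdivlMr // intrD => h1 h2.
  by move: h1 h2; rewrite mulrDl mul1r [_ * P]mulrC => *; lra.
have Rez : Re z = 0.
  apply: expR_inj; rewrite expR0 -normc_cexp z1 normc1 //.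
exists k; apply: complex_eqP; first by rewrite ReP.
rewrite ImP; apply/eqP; rewrite -subr_eq0; apply/eqP.
set b := _ - _ in kP *.
have cb : cos b = 1.
  have : cexp (z - 2 * cpi R * ci R * k%:~R) = 1.
    by rewrite cexpD cexpN cexp_2pi_int z1 invr1 mulr1.
  rewrite /cexp raddfB /= ReP Rez subr0 expR0 !mul1r raddfB /= ImP.
  by move=> /eqP; rewrite eq_complex /= => /andP[/eqP].
have [bpi|pib] := leP b pi.
  apply: cos_inj; rewrite ?in_itv /= ?lexx ?pi_ge0 ?cos0 //.
  by case/andP: kP => -> _.
have : P - b = 0.
  apply: cos_inj; rewrite ?in_itv /= ?lexx ?pi_ge0 //.
    by move: kP pib; rewrite /P mulr2n; lra.
  by rewrite cos0 addrC cosD2pi cosN.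
by move=> Pb; case/andP: kP => _; rewrite ltNge -subr_le0 Pb lexx.
Qed.

End Exponential.

(** * The theta series *)

Section GeometricLimit.
Variable R : realType.
Local Notation C := (CC R).
Local Notation Re := (@complex.Re R).
Local Notation Im := (@complex.Im R).
Implicit Types (q K M : R) (z l : C).

Lemma complex_cvg (u : nat -> C) (a b : R) :
  (fun n => Re (u n)) @ \oo --> a -> (fun n => Im (u n)) @ \oo --> b ->
  u @ \oo --> (Complex a b : C).
Proof.
move=> /cvgrPdist_lt ua /cvgrPdist_lt ub; apply/cvgCP => e e0.
have e2 : 0 < e / 2 by rewrite divr_gt0.
near=> n; rewrite (le_lt_trans (normc_le_ReIm _)) // [ltRHS]splitr !raddfB /=.
apply: ltrD; rewrite distrC; near: n; [exact: ua|exact: ub].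
Unshelve. all: by end_near. Qed.

Lemma real_geometric_cvg (u : nat -> R) K q : 0 <= q -> q < 1 ->
  (forall n, `|u n.+1 - u n| <= K * q ^+ n) -> cvgn u.
Proof.
move=> q0 q1 uK; pose v n := u n.+1 - u n.
have sv : cvgn (series v).
  apply: normed_cvg; apply: (@series_le_cvg _ _ (geometric K q)).
  - by move=> n; exact: normr_ge0.
  - by move=> n; rewrite (le_trans _ (uK n)).
  - exact: uK.
  - by apply: is_cvg_geometric_series; rewrite ger0_norm.
have -> : u = (fun n => u 0%N + series v n).
  apply/funext => n; rewrite /series /=.
  by rewrite (telescope_sumr _ (leq0n n)) addrC subrK.
by apply: is_cvgD => //; exact: is_cvg_cst.
Qed.

Lemma geometric_increment (u : nat -> C) K q : 0 <= q -> q < 1 ->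
  (forall n, normc (u n.+1 - u n) <= K * q ^+ n) ->
  forall n k, normc (u n - u (n + k)%N) <= K / (1 - q) * q ^+ n.
Proof.
move=> q0 q1 uK; have d0 : 0 < 1 - q by rewrite subr_gt0.
have K0 : 0 <= K by have := uK 0%N; rewrite expr0 mulr1; apply: le_trans; exact: normc_ge0.
move=> n k; have H : normc (u n - u (n + k)%N) <= K / (1 - q) * (q ^+ n - q ^+ (n + k)).
  elim: k => [|k IH]; first by rewrite addn0 !subrr normc0 mulr0.
  rewrite addnS (le_trans (normc_dist3 _ (u (n + k)%N) _)) //.
  have := uK (n + k)%N; rewrite normcB => h.
  rewrite (le_trans (lerD IH h)) // le_eqVlt; apply/orP; left; apply/eqP.
  by rewrite exprS; field; rewrite gt_eqF.
rewrite (le_trans H) // ler_wpM2l ?divr_ge0 ?(ltW d0) //.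
by rewrite lerBlDr lerDl exprn_ge0.
Qed.

Lemma geometric_limit (u : nat -> C) K q : 0 <= q -> q < 1 ->
  (forall n, normc (u n.+1 - u n) <= K * q ^+ n) ->
  u @ \oo --> limn u /\ forall n, normc (u n - limn u) <= K / (1 - q) * q ^+ n.
Proof.
move=> q0 q1 uK.
have cR : cvgn (fun n => Re (u n)).
  apply: (real_geometric_cvg q0 q1) => n; rewrite -raddfB.
  by rewrite (le_trans (Re_le_normc _)) //; exact: uK.
have cI : cvgn (fun n => Im (u n)).
  apply: (real_geometric_cvg q0 q1) => n; rewrite -raddfB.
  by rewrite (le_trans (Im_le_normc _)) //; exact: uK.
have ul := complex_cvg cR cI; set l := Complex _ _ in ul.
have -> : limn u = l by apply: cvg_lim ul; exact: norm_hausdorff.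
split=> // n; rewrite -subr_le0; apply: (@le0_of_le_eps _ _ 1) => e e0.
rewrite mul1r lerBlDl.
have /cvgCP/(_ e e0)[N _ NP] := ul.
have := NP (n + N)%N (leq_addl _ _) => /= h.
rewrite (le_trans (normc_dist3 _ (u (n + N)%N) _)) // lerD //; last exact: ltW.
exact: geometric_increment.
Qed.

Lemma geometric_small q K e : 0 <= q -> q < 1 -> 0 < e ->
  exists n, K * q ^+ n <= e.
Proof.
move=> q0 q1 e0; apply: contrapT => /forallNP H.
have := @le0_of_le_geometric _ e K q q0 q1.
rewrite leNgt e0 => /(_ _)/negP; apply => //.
by move=> n; rewrite leNgt; apply/negP => h; apply: (H n); exact: ltW.
Qed.

Lemma geometric_holomorphic (f : nat -> C -> C) q : 0 <= q -> q < 1 ->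
  (forall n, holomorphic (f n : C -> C)) ->
  (forall M, exists K, forall z, normc z <= M ->
     forall n, normc (f n.+1 z - f n z) <= K * q ^+ n) ->
  holomorphic ((fun z => limn (fun n => f n z)) : C -> C).
Proof.
move=> q0 q1 hf fK; apply: (weierstrass hf) => M e e0.
have [K KP] := fK M; have [n nP] := geometric_small (K / (1 - q)) q0 q1 e0.
exists n => z zM; rewrite (le_trans _ nP) //.
by have [_] := geometric_limit q0 q1 (KP z zM); apply.
Qed.

End GeometricLimit.

Section Theta.
Variable R : realType.
Local Notation C := (CC R).
Local Notation Re := (@complex.Re R).
Local Notation Im := (@complex.Im R).
Variable tau : C.
Hypothesis tau_gt0 : 0 < Im tau.
Implicit Types (z w : C).

Let q : R := expR (-1).
Let q0 : 0 <= q. Proof. exact: expR_ge0. Qed.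
Let q1 : q < 1. Proof. by rewrite /q expR_lt1 oppr_lt0 ltr01. Qed.

Definition theta_pos z k := theta_term tau z k%:Z.
Definition theta_neg z k := theta_term tau z (- k%:Z - 1).

Let half (k : nat) : R := k%:R + 2^-1.

Lemma theta_posE z k : theta_pos z k =
  cexp (ci R * cpi R * (half k)%:C ^+ 2 * tau + 2 * cpi R * ci R * (half k)%:C * (z + 2^-1)).
Proof.
rewrite /theta_pos /theta_term (_ : k%:Z%:~R + 2^-1 = (half k)%:C) //.
by rewrite /half rmorphD fmorphV !rmorph_nat -pmulrn.
Qed.

Lemma theta_negE z k : theta_neg z k = - theta_pos (- z) k.
Proof.
rewrite /theta_neg /theta_term.
have -> : (- k%:Z - 1)%:~R + 2^-1 = - (half k)%:C :> C.
  rewrite rmorphB rmorphN /= /half rmorphD fmorphV !rmorph_nat -pmulrn.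
  by field.
have -> : - theta_pos (- z) k =
    cexp (cpi R * ci R - 2 * cpi R * ci R * (k.+1)%:R) * theta_pos (- z) k.
  by rewrite cexpD cexpN cexpX cexp_2pi expr1n invr1 mulr1 cexp_pi mulN1r.
rewrite theta_posE -cexpD; congr cexp.
have -> : (half k)%:C = (k.+1)%:R - 2^-1.
  by rewrite /half rmorphD fmorphV !rmorph_nat -natr1; field.
by field.
Qed.

Lemma normc_theta_pos z k : normc (theta_pos z k) =
  expR (- (pi * half k ^+ 2 * Im tau) - 2 * pi * half k * Im z).
Proof.
rewrite theta_posE normc_cexp; congr expR.
rewrite (_ : _ + _ = (pi * half k ^+ 2)%:C * (ci R * tau)
  + (2 * pi * half k)%:C * (ci R * z) + (pi * half k)%:C * ci R); last first.
  by rewrite /cpi !(rmorphM, rmorphXn, rmorph_nat); field.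
rewrite !raddfD /= !Re_realM !Re_ciM /= !mulr0 mul0r subr0 addr0.
by rewrite !mulrN.
Qed.

(** The Gaussian decay in the index beats the exponential growth in [Im z]:
    completing the square leaves a geometric bound, uniform for [Im z] bounded
    below. *)
Lemma theta_pos_le (M : R) : exists K : R,
  forall z, - Im z <= M -> forall k, normc (theta_pos z k) <= K * q ^+ k.
Proof.
pose T := Im tau; pose b := 2 * pi * `|M| + 1.
have pT : 0 < pi * T by rewrite mulr_gt0 // pi_gt0.
exists (expR (b ^+ 2 / (4 * (pi * T)))) => z zM k.
rewrite normc_theta_pos /q -expRM_natr -expRD ler_expR -/T.
have hk : 0 <= half k by rewrite /half addr_ge0.
have H : - (2 * pi * half k * Im z) <= 2 * pi * half k * `|M|.
  rewrite -mulrN ler_wpM2l ?mulr_ge0 ?pi_ge0 //.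
  by rewrite (le_trans zM) // ler_norm.
have S : 0 <= (2 * (pi * T) * half k - b) ^+ 2 / (4 * (pi * T)).
  by rewrite divr_ge0 ?sqr_ge0 // mulr_ge0 // ltW.
have E : (2 * (pi * T) * half k - b) ^+ 2 / (4 * (pi * T)) =
    pi * half k ^+ 2 * T - half k * b + b ^+ 2 / (4 * (pi * T)).
  have -> : pi * half k ^+ 2 * T = pi * T * half k ^+ 2 by rewrite mulrAC.
  by move: (pi * T) pT => P /gt_eqF P0; field; rewrite P0.
have hb : half k * b = 2 * pi * half k * `|M| + half k by rewrite /b; ring.
have kh : k%:R <= half k by rewrite /half lerDl.
rewrite mulN1r; move: S H kh; rewrite E hb; lra.
Qed.

Lemma holomorphic_theta_pos k : holomorphic ((fun z => theta_pos z k) : C -> C).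
Proof.
under eq_fun do rewrite theta_posE.
set a := 2 * cpi R * ci R * (half k)%:C.
rewrite (_ : (fun z => _) = fun z => cexp (a * z +
  (ci R * cpi R * (half k)%:C ^+ 2 * tau + a * 2^-1))).
  exact: holomorphic_cexp_affine.
by apply/funext => z; congr cexp; ring.
Qed.

Definition theta_half z : C := limn (series (theta_pos z)).

Let seriesS (u : nat -> C) n : series u n.+1 - series u n = u n.
Proof. by rewrite seriesSB. Qed.

Lemma theta_half_cvg z : series (theta_pos z) @ \oo --> theta_half z.
Proof.
have [K KP] := theta_pos_le (- Im z).
have H n : normc (series (theta_pos z) n.+1 - series (theta_pos z) n) <= K * q ^+ n.
  by rewrite seriesS; exact: KP.
by have [] := geometric_limit q0 q1 H.
Qed.

Lemma holomorphic_theta_half : holomorphic (theta_half : C -> C).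
Proof.
apply: (geometric_holomorphic (f := fun n z => series (theta_pos z) n) q0 q1).
  move=> n; rewrite (_ : (fun z => _) = fun z => \sum_(i < n) theta_pos z i).
    by apply: holomorphic_sum => i _; exact: holomorphic_theta_pos.
  by apply/funext => z; rewrite /series /= big_mkord.
move=> M; have [K KP] := theta_pos_le M; exists K => z zM n.
rewrite seriesS; apply: KP; rewrite (le_trans _ zM) //.
by rewrite (le_trans (ler_norm _)) // normrN Im_le_normc.
Qed.

(** Pairing the index [k] with [- k - 1] makes oddness visible. *)
Lemma thetaE z : theta tau z = - (theta_half z - theta_half (- z)).
Proof.
rewrite /theta; congr (- (_ + _)).
rewrite -[X in series X]/(theta_neg z).
rewrite (_ : series (theta_neg z) = (fun n => - series (theta_pos (- z)) n)).
  apply: cvg_lim; first exact: norm_hausdorff.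
  by apply: cvgN; exact: theta_half_cvg.
apply/funext => n; rewrite /series /= -sumrN.
by apply: eq_bigr => k _; rewrite theta_negE.
Qed.

Lemma holomorphic_theta : holomorphic (theta tau : C -> C).
Proof.
rewrite (_ : theta tau = fun z => - (theta_half z - theta_half (- z))); last first.
  by apply/funext => z; rewrite thetaE.
apply: holomorphicN; apply: holomorphicB; first exact: holomorphic_theta_half.
apply: (holomorphic_comp holomorphic_theta_half).
exact: holomorphicN (@holomorphic_id _).
Qed.

Lemma thetaN z : theta tau (- z) = - theta tau z.
Proof. by rewrite !thetaE opprK !opprB. Qed.

Lemma theta0 : theta tau 0 = 0.
Proof. by rewrite thetaE oppr0 subrr oppr0. Qed.

Lemma theta_posD1 z k : theta_pos (z + 1) k = - theta_pos z k.
Proof.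
rewrite /theta_pos /theta_term -[RHS]mulN1r.
have -> : -1 = cexp (cpi R * ci R + 2 * cpi R * ci R * k%:R).
  by rewrite cexpD cexpX cexp_2pi expr1n mulr1 cexp_pi.
by rewrite -cexpD -pmulrn; congr cexp; field.
Qed.

Lemma theta_halfD1 z : theta_half (z + 1) = - theta_half z.
Proof.
apply: cvg_lim; first exact: norm_hausdorff.
rewrite (_ : series (theta_pos (z + 1)) = fun n => - series (theta_pos z) n).
  by apply: cvgN; exact: theta_half_cvg.
apply/funext => n; rewrite /series /= -sumrN.
by apply: eq_bigr => k _; rewrite theta_posD1.
Qed.

Lemma thetaD1 z : theta tau (z + 1) = - theta tau z.
Proof.
have E : theta_half (- z) = - theta_half (- (z + 1)).
  by rewrite -theta_halfD1; congr theta_half; ring.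
by rewrite !thetaE theta_halfD1 E; ring.
Qed.

Definition qfactor z : C := cexp (- (cpi R * ci R * (2 * z + tau))).

Lemma theta_posDtau z k : theta_pos (z + tau) k = - qfactor z * theta_pos z k.+1.
Proof.
rewrite /theta_pos /theta_term -mulN1r.
have -> : -1 = cexp (cpi R * ci R - 2 * cpi R * ci R).
  by rewrite cexpD cexpN cexp_2pi cexp_pi invr1 mulr1.
by rewrite -!cexpD -!pmulrn -natr1; congr cexp; field.
Qed.

Lemma theta_halfDtau z :
  theta_half (z + tau) = - qfactor z * (theta_half z - theta_pos z 0).
Proof.
apply: cvg_lim; first exact: norm_hausdorff.
rewrite (_ : series _ = fun n => - qfactor z * (series (theta_pos z) n.+1 - theta_pos z 0)).
  have h : (fun n => series (theta_pos z) n.+1) @ \oo --> theta_half z.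
    by have := @theta_half_cvg z; rewrite -(cvg_shiftS (series (theta_pos z))).
  exact: (cvgM (cvg_cst (- qfactor z)) (cvgB h (cvg_cst (theta_pos z 0)))).
apply/funext => n; rewrite /series /= big_nat_recl // addrAC subrr add0r mulr_sumr.
by apply: eq_bigr => k _; rewrite theta_posDtau.
Qed.

Lemma thetaDtau z : theta tau (z + tau) = - qfactor z * theta tau z.
Proof.
have c0 : qfactor z != 0 by exact: cexp_neq0.
have E : theta_half (- z) =
    - (qfactor z)^-1 * (theta_half (- z - tau) - theta_pos (- z - tau) 0).
  rewrite -{1}[- z](subrK tau) theta_halfDtau; congr (- _ * _).
  by rewrite /qfactor -cexpN; congr cexp; ring.
have E0 : theta_pos (- z - tau) 0 = qfactor z * theta_pos z 0.
  rewrite /theta_pos /theta_term /qfactor -cexpD; congr cexp.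
  by rewrite -pmulrn; field.
rewrite !thetaE (_ : - (z + tau) = - z - tau) ?opprD // theta_halfDtau E E0.
by field; exact: c0.
Qed.

(** As [Im z] grows the leading term is of order [e^(- pi Im z)] and the others of
    order at most [e^(- 3 pi Im z)]. *)
Lemma theta_half_tail : exists2 B : R, 0 <= B & forall z, 0 <= Im z ->
  normc (theta_half z - theta_pos z 0) <= B * expR (- (3 * pi * Im z)).
Proof.
have [K KP] := theta_pos_le 0.
have K0 : 0 <= K.
  have := KP 0 _ 0%N; rewrite /= oppr0 lexx => /(_ isT).
  by rewrite expr0 mulr1; apply: le_trans; exact: normc_ge0.
have d0 : 0 < 1 - q by rewrite subr_gt0.
exists (K * q / (1 - q)); first by rewrite divr_ge0 ?mulr_ge0 // ltW.
move=> z z0.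
have H n : normc (series (theta_pos z) n.+2 - series (theta_pos z) n.+1) <=
    K * q * expR (- (3 * pi * Im z)) * q ^+ n.
  rewrite seriesS.
  have -> : K * q * expR (- (3 * pi * Im z)) * q ^+ n =
    (K * q ^+ n.+1) * expR (- (3 * pi * Im z)) by rewrite exprS; ring.
  have h0 := KP 0 _ n.+1; rewrite /= oppr0 lexx in h0; move: (h0 isT) => {h0}.
  rewrite !normc_theta_pos /= mulr0 subr0 => h.
  rewrite expRD ler_pM ?expR_ge0 // ler_expR lerN2 ler_wpM2r //.
  rewrite [3 * pi]mulrC [2 * pi]mulrC -mulrA ler_wpM2l ?pi_ge0 //.
  by rewrite /half -natr1; have := ler0n R n; lra.
have [lc lP] := geometric_limit (u := fun n => series (theta_pos z) n.+1) q0 q1 H.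
have lE : limn (fun n => series (theta_pos z) n.+1) = theta_half z.
  apply: cvg_lim; first exact: norm_hausdorff.
  by have := @theta_half_cvg z; rewrite -(cvg_shiftS (series (theta_pos z))).
have := lP 0%N; rewrite lE expr0 mulr1 normcB /series /= big_nat1.
by rewrite mulrAC.
Qed.

(** Were theta zero, its half would be an even function; bounded in the upper
    half-plane, it would be bounded everywhere, hence constant, hence zero because
    it decays, against its leading term. *)
Lemma theta_nonzero : exists z, theta tau z != 0.
Proof.
apply: contrapT => /forallNP H.
have th0 z : theta_half z = theta_half (- z).
  have /negP := H z; rewrite negbK thetaE oppr_eq0 subr_eq0 => /eqP //.
have [B B0 BP] := theta_half_tail.
pose A := expR (- (pi * half 0 ^+ 2 * Im tau)).
have A0 : 0 < A by exact: expR_gt0.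
have T0 z : normc (theta_pos z 0) = A * expR (- (pi * Im z)).
  have -> : pi * Im z = 2 * pi * half 0 * Im z.
    by rewrite /half mulr0n add0r; field.
  by rewrite normc_theta_pos expRD.
have bnd z : 0 <= Im z -> normc (theta_half z) <= (A + B) * expR (- (pi * Im z)).
  move=> z0; rewrite -{1}[theta_half z](subrK (theta_pos z 0)) addrC.
  rewrite (le_trans (normcD _ _)) // mulrDl lerD ?T0 // (le_trans (BP z z0)) //.
  rewrite ler_wpM2l // ler_expR lerN2 -mulrA ler_peMl ?mulr_ge0 ?pi_ge0 //.
  by rewrite ler1n.
have bnd1 z : normc (theta_half z) <= A + B.
  have h w : 0 <= Im w -> normc (theta_half w) <= A + B.
    move=> w0; rewrite (le_trans (bnd w w0)) // -[leRHS]mulr1 ler_wpM2l //.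
      by rewrite addr_ge0 // ltW.
    by rewrite expR_le1 oppr_le0 mulr_ge0 ?pi_ge0.
  have [z0|z0] := leP 0 (Im z); first exact: h.
  by rewrite th0; apply: h; rewrite raddfN /= oppr_ge0 ltW.
have cst := liouville holomorphic_theta_half bnd1.
pose r := expR (- pi : R); have r0 : 0 <= r by exact: expR_ge0.
have r1 : r < 1 by rewrite expR_lt1 oppr_lt0 pi_gt0.
have Ik (k : nat) : expR (- (pi * Im (Complex 0 k%:R : C))) = r ^+ k :> R.
  by rewrite /= -mulNr expRM_natr.
have I0 (k : nat) : 0 <= Im (Complex 0 k%:R : C) by rewrite /= ler0n.
have th z : theta_half z = 0.
  apply/eqP; rewrite -normc_eq0 eq_le normc_ge0 andbT.
  apply: (@le0_of_le_geometric _ _ (A + B) r) => // k.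
  by rewrite (cst z (Complex 0 k%:R)) -Ik; exact: bnd.
suff : A <= 0 by rewrite leNgt A0.
apply: (@le0_of_le_geometric _ _ B r) => // k.
have := BP _ (I0 k); rewrite th sub0r normcN T0 Ik.
have -> : expR (- (3 * pi * Im (Complex 0 k%:R : C))) = r ^+ k * r ^+ k * r ^+ k.
  by rewrite -Ik -!expRD; congr expR; ring.
have rk : 0 < r ^+ k by rewrite exprn_gt0 // expR_gt0.
have rk1 : r ^+ k <= 1 by rewrite exprn_ile1 // ltW.
move: (r ^+ k) rk rk1 => x x0 x1 h.
have h2 : A <= B * (x * x) by rewrite -(ler_pM2r x0); lra.
by rewrite (le_trans h2) // ler_wpM2l // -[leRHS]mulr1 ler_wpM2l // ltW.
Qed.

End Theta.

(** * Quasi-periodic functions *)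

Section Quotient.
Variable R : realType.
Local Notation C := (CC R).
Implicit Types (f g h : C -> C) (p z : C).

(** The cofactor is entire, so that near [p] the quotient of another function
    vanishing at [p] by [g] is a quotient with nonvanishing denominator. *)
Definition simple_zero g p := exists g1 : C -> C,
  [/\ holomorphic (g1 : C -> C), g1 p != 0 & forall z, g z = (z - p) * g1 z].

Lemma holomorphic_near_neq0 g p : holomorphic (g : C -> C) -> g p != 0 ->
  \forall z \near p, g z != 0.
Proof.
move=> hg gp; have g0 : 0 < normc (g p) by rewrite normc_gt0.
have cg : continuous g by exact: holomorphic_continuous hg.
have [e e0 eP] := iffLR (continuousCP _ p) (cg p) _ g0.
apply/nbhsCP; exists e => // z /eP; apply: contraTneq => ->.
by rewrite sub0r normcN ltxx.
Qed.

(** Equality off the zeros of [g] extends by the identity theorem. *)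
Lemma holomorphic_cancel f g h p : holomorphic (f : C -> C) ->
  holomorphic (h : C -> C) -> holomorphic (g : C -> C) -> g p != 0 ->
  (forall z, f z * g z = h z * g z) -> forall z, f z = h z.
Proof.
move=> hf hh hg gp E z; apply/eqP; rewrite -subr_eq0; apply/eqP.
apply: (@identity_theorem _ (fun z => f z - h z) p); first exact: holomorphicB hf hh.
apply: filterS (holomorphic_near_neq0 hg gp) => w w0.
apply/eqP; rewrite -(mulIr_eq0 _ (mulIf w0)) mulrBl E subrr //.
Qed.

(** The quotient is defined at each zero of [g] by the ratio of the two
    cofactors, which represents it in a neighbourhood. *)
Lemma holomorphic_quotient f g : holomorphic (f : C -> C) ->
  holomorphic (g : C -> C) ->
  (forall p, g p = 0 -> f p = 0 /\ simple_zero g p) ->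
  exists2 h, holomorphic (h : C -> C) & forall z, f z = g z * h z.
Proof.
move=> hf hg fg.
have loc p : exists k : C -> C, g p = 0 -> differentiable k p /\
    \forall z \near p, z != p -> g z != 0 /\ k z = f z / g z.
  have [gp|gp] := eqVneq (g p) 0; last by exists f => /eqP; rewrite (negbTE gp).
  have [fp [g1 [hg1 g1p gE]]] := fg p gp.
  have [f1 hf1 fE] := divided_difference p hf.
  exists (fun z => f1 z / g1 z) => _; split.
    exact: (differentiable_div (hf1 p) (hg1 p) g1p).
  apply: filterS (holomorphic_near_neq0 hg1 g1p) => z z0 zp.
  have zp0 : z - p != 0 by rewrite subr_eq0.
  rewrite gE fE fp add0r mulf_neq0 //; split=> //.
  by field; rewrite zp0 z0.
have [k kP] := choice loc.
pose h z := if g z == 0 then k z z else f z / g z.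
exists h => [p|z]; last first.
  rewrite /h; case: ifPn => [/eqP gz|gz]; last by rewrite mulrCA divff // mulr1.
  by rewrite gz mul0r; have [] := fg z gz.
have [gp|gp] := eqVneq (g p) 0.
  have [dk near_k] := kP p gp.
  apply: near_eq_differentiable dk.
  apply: filterS near_k => z; have [->|zp] := eqVneq z p; first by rewrite /h gp eqxx.
  by move=> /(_ isT)[gz ->]; rewrite /h (negbTE gz).
apply: near_eq_differentiable (differentiable_div (hf p) (hg p) gp).
by apply: filterS (holomorphic_near_neq0 hg gp) => z gz; rewrite /h (negbTE gz).
Qed.

End Quotient.

Section Lattice.
Variable R : realType.
Local Notation C := (CC R).
Local Notation Re := (@complex.Re R).
Local Notation Im := (@complex.Im R).
Variable tau : C.
Hypothesis tau_gt0 : 0 < Im tau.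
Implicit Types (z w : C) (f g h : C -> C) (m : int).

(** The automorphy factor of degree [m]; a quasi-periodic function of degree
    [m] is a section of a line bundle of degree [m] on the elliptic curve. *)
Definition tau_factor m z : C := cexp (- (cpi R * ci R * m%:~R * (2 * z + tau))).

Definition quasi_periodic m (c1 c2 : C) f :=
  (forall z, f (z + 1) = c1 * f z) /\
  (forall z, f (z + tau) = c2 * tau_factor m z * f z).

Lemma tau_factorD m k z : tau_factor (m + k) z = tau_factor m z * tau_factor k z.
Proof. by rewrite /tau_factor -cexpD rmorphD; congr cexp; ring. Qed.

Lemma tau_factor0 z : tau_factor 0 z = 1.
Proof. by rewrite /tau_factor mulr0 mul0r oppr0 cexp0. Qed.

Lemma tau_factor_neq0 m z : tau_factor m z != 0.
Proof. exact: cexp_neq0. Qed.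

Lemma holomorphic_tau_factor m : holomorphic (tau_factor m : C -> C).
Proof.
rewrite (_ : tau_factor m = fun z => cexp (- (cpi R * ci R * m%:~R * 2) * z
   + - (cpi R * ci R * m%:~R * tau))); first exact: holomorphic_cexp_affine.
by apply/funext => z; congr cexp; ring.
Qed.

Lemma holomorphic_shift f (s : C) : holomorphic (f : C -> C) ->
  holomorphic ((fun z => f (z + s)) : C -> C).
Proof.
move=> hf; apply: (holomorphic_comp hf).
exact: holomorphicD (@holomorphic_id _) (@holomorphic_cst _ s).
Qed.

Lemma quasi_periodic_quotient m1 m2 (a1 a2 b1 b2 : C) f g h p :
  b1 != 0 -> b2 != 0 ->
  holomorphic (g : C -> C) -> g p != 0 -> holomorphic (h : C -> C) ->
  (forall z, f z = g z * h z) ->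
  quasi_periodic m1 a1 a2 f -> quasi_periodic m2 b1 b2 g ->
  quasi_periodic (m1 - m2) (a1 / b1) (a2 / b2) h.
Proof.
move=> b10 b20 hg gp hh fE [f1 f2] [g1 g2]; split.
  apply: (holomorphic_cancel _ _ hg gp).
  - exact: holomorphic_shift.
  - exact: holomorphicM (@holomorphic_cst _ _) hh.
  move=> z; have := f1 z; rewrite !fE g1 => E.
  apply: (mulfI b10); rewrite [LHS](_ : _ = b1 * g z * h (z + 1)); last by ring.
  by rewrite E; field.
have hT : holomorphic ((fun z => a2 / b2 * tau_factor (m1 - m2) z) : C -> C).
  exact: holomorphicM (@holomorphic_cst _ _) (@holomorphic_tau_factor _).
apply: (holomorphic_cancel _ _ hg gp).
- exact: holomorphic_shift.
- exact: holomorphicM hT hh.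
move=> z; have := f2 z; rewrite !fE g2 => E.
have t2 := tau_factor_neq0 m2 z.
have -> : tau_factor (m1 - m2) z = tau_factor m1 z / tau_factor m2 z.
  by apply: (mulIf t2); rewrite divfK // -tau_factorD subrK.
apply: (mulfI (mulf_neq0 b20 t2)).
rewrite [LHS](_ : _ = b2 * tau_factor m2 z * g z * h (z + tau)); last by ring.
by rewrite E; field; rewrite t2 b20.
Qed.

Lemma lattice1 : lattice tau 1.
Proof. by exists 1, 0; rewrite mul0r addr0. Qed.

Lemma lattice_tau : lattice tau tau.
Proof. by exists 0, 1; rewrite mul1r add0r. Qed.

Lemma lattice_ind (P : C -> Prop) : P 1 -> P tau ->
  (forall s t, P s -> P t -> P (s + t)) -> (forall s, P s -> P (- s)) ->
  forall s, lattice tau s -> P s.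
Proof.
move=> P1 Pt PD PN; have P0 : P 0 by rewrite -(subrr 1); exact: PD P1 (PN _ P1).
have PZ s (a : int) : P s -> P (a%:~R * s).
  move=> Ps; case: a => n; last rewrite NegzE mulrNz mulNr; rewrite -pmulrn.
    elim: n => [|n IH]; first by rewrite mul0r.
    by rewrite -natr1 mulrDl mul1r; exact: PD.
  apply: PN; elim: n => [|n IH]; first by rewrite mul1r.
  by rewrite -natr1 mulrDl mul1r; exact: PD.
move=> s [a [b ->]]; apply: PD; last exact: PZ.
by rewrite -[a%:~R]mulr1; exact: PZ.
Qed.

(** The multiplier [e] depends only on the type of quasi-periodicity: it transports
    vanishing, and the order of vanishing, along lattice translations. *)
Lemma lattice_multiplier m (c1 c2 : C) : c1 != 0 -> c2 != 0 ->
  forall s, lattice tau s -> exists e : C -> C,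
  [/\ holomorphic (e : C -> C), (forall z, e z != 0) &
    forall f, quasi_periodic m c1 c2 f -> forall z, f (z + s) = e z * f z].
Proof.
move=> c10 c20.
apply: lattice_ind.
- by exists (fun=> c1); split; [exact: holomorphic_cst|move=> z|move=> f []].
- exists (fun z => c2 * tau_factor m z); split.
  + exact: holomorphicM (@holomorphic_cst _ _) (@holomorphic_tau_factor _).
  + by move=> z; rewrite mulf_neq0 // tau_factor_neq0.
  + by move=> f [_ f2] z; exact: f2.
- move=> s t [e [he e0 eP]] [k [hk k0 kP]]; exists (fun z => k (z + s) * e z); split.
  + by apply: holomorphicM he; exact: holomorphic_shift.
  + by move=> z; rewrite mulf_neq0.
  + by move=> f qf z; rewrite addrA (kP f qf) (eP f qf) mulrA.
- move=> s [e [he e0 eP]]; exists (fun z => (e (z - s))^-1); split.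
  + move=> z; have := holomorphic_shift (- s) he z => d.
    exact: (differentiableV d (e0 _)).
  + by move=> z; rewrite invr_neq0.
  + move=> f qf z; apply: (mulfI (e0 (z - s))); rewrite mulVKf //.
    by rewrite -eP // subrK.
Qed.

Lemma lattice_reduction z : exists s w, [/\ z = w + s, lattice tau s &
  0 <= Im w <= Im tau /\ `|Re w| <= 1 + `|Re tau| ].
Proof.
pose t := Im z / Im tau; pose b := Num.floor t.
pose x := Re z - t * Re tau; pose a := Num.floor x.
exists (a%:~R + b%:~R * tau), (z - (a%:~R + b%:~R * tau)); split.
- by rewrite subrK.
- by exists a, b.
have hb := floor_le_tmp t; have hb' := floorD1_gt t.
have ha := floor_le_tmp x; have ha' := floorD1_gt x.
rewrite -/a -/b !intrD in ha ha' hb hb'.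
have realint (k : int) : (k%:~R : C) = (k%:~R : R)%:C by rewrite rmorph_int.
have ImE : Im (z - (a%:~R + b%:~R * tau)) = (t - b%:~R) * Im tau.
  rewrite raddfB raddfD /= !realint Im_realM /= add0r mulrBl /t divfK // gt_eqF //.
have ReE : Re (z - (a%:~R + b%:~R * tau)) = (x - a%:~R) + (t - b%:~R) * Re tau.
  by rewrite raddfB raddfD /= !realint Re_realM /= /x; ring.
rewrite ImE ReE; split.
  rewrite mulr_ge0 ?subr_ge0 ?(ltW tau_gt0) //= -[leRHS]mul1r ler_wpM2r ?(ltW tau_gt0) //.
  lra.
have nx : `|x - a%:~R| <= 1 by rewrite ger0_norm ?subr_ge0 //; lra.
have nt : `|t - b%:~R| <= 1 by rewrite ger0_norm ?subr_ge0 //; lra.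
rewrite (le_trans (ler_normD _ _)) // normrM lerD //.
by rewrite -[leRHS]mul1r ler_wpM2r.
Qed.

(** The function takes all its values on a rectangle containing a fundamental
    domain. *)
Lemma bounded_of_periods (Phi : C -> R) : continuous Phi ->
  (forall z s, lattice tau s -> Phi (z + s) = Phi z) ->
  exists2 M, 0 <= M & forall z, `|Phi z| <= M.
Proof.
move=> cPhi per.
have cf : continuous (fun z => (Phi z)%:C : C).
  move=> z; apply: (continuous_comp (g := fun x : R => x%:C : C)) (cPhi z) _.
  exact: continuous_ofR.
have [M M0 MP] := bounded_on_rectangle (- (1 + `|Re tau|)) (1 + `|Re tau|)
  0 (Im tau) cf.
exists M => // z; have [s [w [-> sl [iw rw]]]] := lattice_reduction z.
rewrite per //; case: w iw rw => u v /= iw; rewrite ler_norml => rw.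
by rewrite -normc_real; exact: MP.
Qed.

End Lattice.

(** * Growth of quasi-periodic functions *)

Section Growth.
Variable R : realType.
Local Notation C := (CC R).
Local Notation Re := (@complex.Re R).
Local Notation Im := (@complex.Im R).
Variable tau : C.
Hypothesis tau_gt0 : 0 < Im tau.
Implicit Types (z w : C) (f g h : C -> C) (m : int).

Lemma Re_cpi_ci z : Re (cpi R * ci R * z) = - (pi * Im z).
Proof. by rewrite -mulrA Re_realM Re_ciM mulrN. Qed.

Lemma normc_tau_factor m z :
  normc (tau_factor tau m z) = expR (pi * m%:~R * (2 * Im z + Im tau)).
Proof.
rewrite normc_cexp -!mulrA [cpi R * _]mulrA raddfN /= Re_cpi_ci opprK.
congr expR; congr (_ * _).
have -> : (m%:~R : C) = (m%:~R : R)%:C by rewrite rmorph_int.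
rewrite Im_realM raddfD /=; congr (_ * (_ + _)).
by rewrite (_ : (2 : C) = 2%:C) ?Im_realM // rmorph_nat.
Qed.

(** Multiplying the modulus by a suitable Gaussian weight in [Im z] and an
    exponential weight in [Re z] makes it doubly periodic, hence bounded; the
    weights are solved for from the two multipliers. *)
Lemma quasi_periodic_growth m (c1 c2 : C) f : c1 != 0 -> c2 != 0 ->
  holomorphic (f : C -> C) -> quasi_periodic tau m c1 c2 f ->
  exists M b c : R, 0 <= M /\ forall z, normc (cexp (c%:C * z) * f z) <=
    M * expR (pi * m%:~R / Im tau * (Im z) ^+ 2 + b * Im z).
Proof.
move=> c10 c20 hf [f1 f2].
have [r1 r1E] : exists r, expR r = normc c1 by apply: expR_total; rewrite normc_gt0.
have [r2 r2E] : exists r, expR r = normc c2 by apply: expR_total; rewrite normc_gt0.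
set T := Im tau; have T0 : T != 0 by rewrite gt_eqF.
(* the weights that cancel the two multipliers *)
pose k := pi * m%:~R / T; pose c := - r1; pose b := (r2 + c * Re tau) / T.
pose E z := - (k * (Im z) ^+ 2 + b * Im z) + c * Re z.
pose Phi z := normc (f z) * expR (E z).
have cPhi : continuous Phi.
  move=> z; have cf : continuous f by exact: holomorphic_continuous hf.
  have h1 := continuous_comp (cf z) (@continuous_normc _ _).
  have cI := @continuous_Im R z; have cR := @continuous_Re R z.
  have cE : {for z, continuous E}.
    apply: (@cvgD _ _ _ (nbhs z)).
      apply: (@cvgN _ _ _ (nbhs z)); apply: (@cvgD _ _ _ (nbhs z)).
        apply: (@cvgM _ _ (nbhs z)); first exact: cvg_cst.
        exact: (@cvgM _ _ (nbhs z) _ _ _ _ _ cI cI).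
      exact: (@cvgM _ _ (nbhs z) _ _ _ _ _ (cvg_cst b) cI).
    exact: (@cvgM _ _ (nbhs z) _ _ _ _ _ (cvg_cst c) cR).
  have h2 := continuous_comp cE (@continuous_expR _ _).
  exact: (@cvgM _ _ (nbhs z) _ _ _ _ _ h1 h2).
have per : forall s, lattice tau s -> forall z, Phi (z + s) = Phi z.
  apply: lattice_ind.
  - move=> z; rewrite /Phi f1 normcM -r1E /E !raddfD /= addr0.
    rewrite [_ * normc _]mulrC -mulrA -expRD; congr (_ * expR _).
    by rewrite /c; ring.
  - move=> z; rewrite /Phi f2 !normcM -r2E normc_tau_factor /E !raddfD /= -/T.
    rewrite -expRD [_ * normc _]mulrC -[LHS]mulrA -expRD; congr (_ * expR _).
    have bT : b * T = r2 + c * Re tau by rewrite /b divfK.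
    have kT : k * T = pi * m%:~R by rewrite /k divfK.
    by rewrite -kT; lra.
  - by move=> s t Ps Pt z; rewrite addrA Pt Ps.
  - by move=> s Ps z; rewrite -Ps subrK.
have [M M0 MP] := bounded_of_periods tau_gt0 cPhi (fun z s sl => per s sl z).
exists M, b, c; split=> // z; have := MP z; rewrite ger0_norm; last first.
  by rewrite mulr_ge0 ?normc_ge0 ?expR_ge0.
rewrite /Phi /E -/k expRD expRN normcM normc_cexp Re_realM.
move=> h; rewrite -ler_pdivrMr ?expR_gt0 // (le_trans _ h) //.
by rewrite le_eqVlt; apply/orP; left; apply/eqP; ring.
Qed.

(** Quasi-periodic functions of negative degree decay in both vertical
    directions, too fast for a nonzero entire function. *)
Lemma quasi_periodic_neg m (c1 c2 : C) f : c1 != 0 -> c2 != 0 -> m < 0 ->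
  holomorphic (f : C -> C) -> quasi_periodic tau m c1 c2 f -> forall z, f z = 0.
Proof.
move=> c10 c20 m0 hf qf.
have [M [b [c [M0 MP]]]] := quasi_periodic_growth c10 c20 hf qf.
set k := pi * m%:~R / Im tau in MP.
have k0 : k < 0.
  by rewrite pmulr_llt0 ?invr_gt0 // pmulr_rlt0 ?pi_gt0 // ltrz0.
pose g z := cexp (c%:C * z) * f z.
have hg : holomorphic (g : C -> C).
  apply: holomorphicM hf; have := @holomorphic_cexp_affine _ (c%:C : C) 0.
  by under eq_fun do rewrite addr0.
have D (y d : R) : k * y ^+ 2 + d * y <= - d ^+ 2 / (4 * k).
  have S : (2 * k * y + d) ^+ 2 / (4 * k) <= 0.
    by rewrite mulr_ge0_le0 ?sqr_ge0 // invr_le0 pmulr_rle0 // ltW.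
  have kn : k != 0 by rewrite lt_eqF.
  have : (2 * k * y + d) ^+ 2 / (4 * k) = k * y ^+ 2 + d * y + d ^+ 2 / (4 * k) by field.
  by rewrite mulNr; lra.
have gb z : normc (g z) <= M * expR (- b ^+ 2 / (4 * k)).
  by rewrite (le_trans (MP z)) // ler_wpM2l // ler_expR.
have cst := liouville hg gb.
have g0 z : g z = 0.
  apply/eqP; rewrite -normc_eq0 eq_le normc_ge0 andbT.
  apply: (@le0_of_le_geometric _ _ (M * expR (- (b + 1) ^+ 2 / (4 * k))) (expR (-1))).
  - exact: expR_ge0.
  - by rewrite expR_lt1 oppr_lt0.
  move=> n; rewrite (cst z (Complex 0 n%:R)) (le_trans (MP _)) //= -mulrA ler_wpM2l //.
  rewrite -expRM_natr -expRD ler_expR.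
  by have := D n%:R (b + 1); lra.
move=> z; apply: (mulfI (cexp_neq0 (c%:C * z))); rewrite mulr0; exact: g0.
Qed.

(** Bounded by compactness, hence constant by Liouville's theorem. *)
Lemma elliptic_constant f : holomorphic (f : C -> C) ->
  quasi_periodic tau 0 1 1 f -> forall z w, f z = f w.
Proof.
move=> hf [f1 f2].
have cf : continuous (fun z => normc (f z)).
  move=> z; apply: (continuous_comp (g := fun z : C => normc z)).
    exact: holomorphic_continuous hf z.
  exact: continuous_normc.
have per : forall s, lattice tau s -> forall z, f (z + s) = f z.
  apply: lattice_ind.
  - by move=> z; rewrite f1 mul1r.
  - by move=> z; rewrite f2 tau_factor0 !mul1r.
  - by move=> s t Ps Pt z; rewrite addrA Pt Ps.
  - by move=> s Ps z; rewrite -Ps subrK.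
have pern z s : lattice tau s -> normc (f (z + s)) = normc (f z).
  by move=> sl; rewrite per.
have [M _ MP] := bounded_of_periods tau_gt0 cf pern.
apply: (liouville hf (M := M)) => z.
by rewrite (le_trans _ (MP z)) // ler_norm.
Qed.

End Growth.

(** * The triple product and the zeros of theta *)

Section Product.
Variable R : realType.
Local Notation C := (CC R).
Local Notation Re := (@complex.Re R).
Local Notation Im := (@complex.Im R).
Variable tau : C.
Hypothesis tau_gt0 : 0 < Im tau.
Implicit Types (z w x : C).

Lemma Re_2pi_ci z : Re (2 * cpi R * ci R * z) = - (2 * pi * Im z).
Proof.
rewrite -!mulrA [cpi R * _]mulrA mulr2n mulrDl mul1r raddfD /= Re_cpi_ci.
by ring.
Qed.

Lemma twopi_neq0 : 2 * cpi R * ci R != 0.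
Proof.
apply/eqP => h; have := @cexp_pi R.
rewrite (_ : cpi R * ci R = 2^-1 * (2 * cpi R * ci R)); last by field.
by rewrite h mulr0 cexp0 => /eqP; rewrite -subr_eq0 opprK -mulr2n pnatr_eq0.
Qed.

Definition nome : C := cexp (2 * cpi R * ci R * tau).

Let rho := normc nome.
Let rho0 : 0 <= rho. Proof. exact: normc_ge0. Qed.
Let rho1 : rho < 1.
Proof.
rewrite /rho normc_cexp Re_2pi_ci expR_lt1 oppr_lt0 mulr_gt0 // mulr_gt0 //.
exact: pi_gt0.
Qed.

Definition partial_product n x : C := \prod_(k < n) (1 - nome ^+ k * x).
Definition qproduct x : C := limn (fun n => partial_product n x).

Lemma partial_productS n x :
  partial_product n.+1 x - partial_product n x =
  - (partial_product n x * (nome ^+ n * x)).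
Proof. by rewrite /partial_product big_ord_recr /=; ring. Qed.

Lemma partial_product_le n x (M : R) : normc x <= M ->
  normc (partial_product n x) <= expR (M / (1 - rho)).
Proof.
move=> xM; have M0 : 0 <= M by rewrite (le_trans _ xM) // normc_ge0.
have d0 : 0 < 1 - rho by rewrite subr_gt0.
have H : normc (partial_product n x) <= expR (M * (1 - rho ^+ n) / (1 - rho)).
  elim: n => [|n IH].
    by rewrite /partial_product big_ord0 normc1 expr0 subrr mulr0 mul0r expR0.
  rewrite /partial_product big_ord_recr /= -/(partial_product n x) normcM.
  have -> : M * (1 - rho ^+ n.+1) / (1 - rho) =
      M * (1 - rho ^+ n) / (1 - rho) + rho ^+ n * M.
    by rewrite exprS; field; rewrite gt_eqF.
  rewrite expRD ler_pM ?normc_ge0 // (le_trans (normcD _ _)) //.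
  rewrite normc1 normcN normcM normcX (le_trans _ (expR_ge1Dx _)) // lerD2l.
  by rewrite ler_wpM2l // exprn_ge0.
rewrite (le_trans H) // ler_expR ler_wpM2r ?invr_ge0 ?(ltW d0) //.
by rewrite -[leRHS]mulr1 ler_wpM2l // lerBlDr lerDl exprn_ge0.
Qed.

Lemma partial_product_increment (M : R) : exists K, forall x, normc x <= M ->
  forall n, normc (partial_product n.+1 x - partial_product n x) <= K * rho ^+ n.
Proof.
exists (expR (M / (1 - rho)) * M) => x xM n.
rewrite partial_productS normcN !normcM normcX mulrAC mulrA ler_pM //.
- by rewrite mulr_ge0 ?normc_ge0 // exprn_ge0.
- exact: normc_ge0.
- by rewrite ler_wpM2r ?exprn_ge0 // partial_product_le.
Qed.

Lemma holomorphic_qproduct : holomorphic (qproduct : C -> C).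
Proof.
apply: (geometric_holomorphic rho0 rho1).
  move=> n; apply: holomorphic_prod => k _.
  apply: holomorphicB; first exact: holomorphic_cst.
  by apply: holomorphicM; [exact: holomorphic_cst|exact: holomorphic_id].
exact: partial_product_increment.
Qed.

Lemma qproduct_cvg x : (fun n => partial_product n x) @ \oo --> qproduct x.
Proof.
have [K KP] := partial_product_increment (normc x).
by have [] := geometric_limit rho0 rho1 (KP x (lexx _)).
Qed.

Lemma qproduct_shift x : qproduct x = (1 - x) * qproduct (nome * x).
Proof.
apply: cvg_lim; first exact: norm_hausdorff.
have h0 := @qproduct_cvg (nome * x); have h := cvgM (cvg_cst (1 - x)) h0.
have E : (fun n => partial_product n.+1 x) =
    (fun n => (1 - x) * partial_product n (nome * x)).
  apply/funext => n; rewrite /partial_product big_ord_recl expr0 mul1r.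
  by congr (_ * _); apply: eq_bigr => k _; rewrite exprSr mulrA.
have h2 : (fun n => partial_product n.+1 x) @ \oo --> (1 - x) * qproduct (nome * x).
  by rewrite E; exact: h.
by move: h2; rewrite (cvg_shiftS (fun n => partial_product n x)).
Qed.

Lemma qproduct0 : qproduct 0 = 1.
Proof.
apply: cvg_lim; first exact: norm_hausdorff.
rewrite (_ : (fun n => _) = fun=> 1); first exact: cvg_cst.
by apply/funext => n; apply: big1 => k _; rewrite mulr0 subr0.
Qed.

(** Otherwise the functional equation propagates the zero to the points
    [nome ^+ n * x], which tend to [0], where the product has the value [1]. *)
Lemma qproduct_eq0 x : qproduct x = 0 -> exists n, nome ^+ n * x = 1.
Proof.
move=> x0; apply: contrapT => /forallNP H.
have all0 n : qproduct (nome ^+ n * x) = 0.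
  elim: n => [|n IH]; first by rewrite expr0 mul1r.
  have h : 1 - nome ^+ n * x != 0.
    by rewrite subr_eq0 eq_sym; apply/eqP; exact: H.
  by apply: (mulfI h); rewrite mulr0 exprS -mulrA -qproduct_shift.
have cq : continuous qproduct by exact: holomorphic_continuous holomorphic_qproduct.
have [e e0 eP] := iffLR (continuousCP _ 0) (cq 0) 1 ltr01.
have e2 : 0 < e / 2 by rewrite divr_gt0.
have [n nP] := geometric_small (normc x) rho0 rho1 e2.
have := eP (nome ^+ n * x); rewrite subr0 normcM normcX all0 qproduct0 sub0r.
rewrite normcN normc1 ltxx => /(_ _)/negP; apply => //.
by rewrite mulrC (le_lt_trans nP) //; lra.
Qed.

(** The product side of Jacobi's triple product, up to a constant factor. *)
Definition theta_product z : C :=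
  cexp (- (cpi R * ci R) * z) * qproduct (cexp (2 * cpi R * ci R * z))
  * qproduct (nome * cexp (- (2 * cpi R * ci R) * z)).

Lemma holomorphic_theta_product : holomorphic (theta_product : C -> C).
Proof.
have he (a : C) : holomorphic ((fun z => cexp (a * z)) : C -> C).
  by have := @holomorphic_cexp_affine _ a 0; under eq_fun do rewrite addr0.
apply: holomorphicM; first apply: holomorphicM; first exact: he.
  exact: (holomorphic_comp holomorphic_qproduct (he _)).
apply: (holomorphic_comp holomorphic_qproduct).
exact: holomorphicM (@holomorphic_cst _ _) (he _).
Qed.

Lemma theta_productD1 z : theta_product (z + 1) = - theta_product z.
Proof.
rewrite /theta_product !mulrDr !cexpD !mulr1 !cexpN cexp_2pi cexp_pi invr1 !mulr1.
by rewrite invrN1 mulrN1 !mulNr.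
Qed.

Lemma theta_productDtau z :
  theta_product (z + tau) = - tau_factor tau 1 z * theta_product z.
Proof.
rewrite /theta_product.
set x := cexp (2 * cpi R * ci R * z); have x0 : x != 0 by exact: cexp_neq0.
have n0 : nome != 0 by exact: cexp_neq0.
have -> : cexp (2 * cpi R * ci R * (z + tau)) = nome * x.
  by rewrite mulrDr cexpD mulrC.
have -> : cexp (- (2 * cpi R * ci R) * z) = x^-1 by rewrite mulNr cexpN.
have -> : nome * cexp (- (2 * cpi R * ci R) * (z + tau)) = x^-1.
  by rewrite mulrDr cexpD !mulNr !cexpN -/nome mulrCA divff // mulr1.
rewrite [qproduct x^-1]qproduct_shift [qproduct x]qproduct_shift.
have -> : cexp (- (cpi R * ci R) * (z + tau)) =
    tau_factor tau 1 z * x * cexp (- (cpi R * ci R) * z).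
  by rewrite /x /tau_factor -!cexpD; congr cexp; ring.
by field.
Qed.

Lemma theta_product_eq0 z : theta_product z = 0 -> lattice tau z.
Proof.
have pi0 := twopi_neq0.
move=> /eqP; rewrite !mulf_eq0 (negbTE (cexp_neq0 _)) /= => /orP[] /eqP.
  move=> /qproduct_eq0[n]; rewrite /nome -cexpX -cexpD => /cexp_eq1[k E].
  exists k, (- n%:Z); apply: (mulfI pi0); rewrite rmorphN /= -pmulrn.
  rewrite mulrDr -E; ring.
move=> /qproduct_eq0[n]; rewrite mulrA -exprSr /nome -cexpX -cexpD => /cexp_eq1[k E].
exists (- k), (n.+1%:Z); apply: (mulfI pi0); rewrite rmorphN /= -pmulrn.
rewrite mulrDr mulrN -E; ring.
Qed.

(** The factor [1 - x] of the first product has a simple zero, and the remaining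
    factors do not vanish at [x = 1]. *)
Lemma simple_zero_theta_product0 : simple_zero theta_product 0.
Proof.
have he (a : C) : holomorphic ((fun z => cexp (a * z)) : C -> C).
  by have := @holomorphic_cexp_affine _ a 0; under eq_fun do rewrite addr0.
have [e1 he1 e1E] := divided_difference 0 (he (2 * cpi R * ci R)).
have x0 : cexp (2 * cpi R * ci R * 0) = 1 by rewrite mulr0 cexp0.
have e10 : e1 0 != 0.
  apply/eqP => e10.
  have ce1 : continuous e1 by exact: holomorphic_continuous he1.
  have [r r0 rP] := iffLR (continuousCP _ 0) (ce1 0) 1 ltr01.
  have [t t0 tr] : exists2 t : R, 0 < t & t < r by exists (r / 2); lra.
  (* on the negative imaginary axis the exponential is real and at least 1 + t *)
  pose w : C := - (ci R * t%:C).
  have wn : normc w = t by rewrite normcN normcM normc_ci mul1r normc_real gtr0_norm.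
  have := rP w; rewrite subr0 wn e10 subr0.
  move=> /(_ tr); apply/negP; rewrite -leNgt -(ler_pM2l t0) mulr1 -{2}wn -normcM.
  have -> : w * e1 w = cexp (2 * cpi R * ci R * w) - 1.
    by rewrite e1E x0 subr0 addrAC subrr add0r.
  have -> : 2 * cpi R * ci R * w = (2 * pi * t)%:C.
    rewrite /w !rmorphM rmorph_nat -/(cpi R).
    transitivity (- (ci R * ci R) * (2 * cpi R * t%:C)); first by ring.
    by rewrite ci2 opprK mul1r.
  rewrite (le_trans _ (Re_le_normc _)) // raddfB /= cos0 mulr1.
  rewrite (le_trans _ (ler_norm _)) // lerBrDl (le_trans _ (expR_ge1Dx _)) // lerD2l.
  have p1 : 1 <= 2 * pi :> R by have := @pi_ge2 R; lra.
  by rewrite -[leLHS]mul1r ler_wpM2r // ltW.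
pose H z := cexp (- (cpi R * ci R) * z) * qproduct (nome * cexp (2 * cpi R * ci R * z))
  * qproduct (nome * cexp (- (2 * cpi R * ci R) * z)).
have hH : holomorphic (H : C -> C).
  apply: holomorphicM; first apply: holomorphicM; first exact: he.
    exact: (holomorphic_comp holomorphic_qproduct (holomorphicM (@holomorphic_cst _ _) (he _))).
  exact: (holomorphic_comp holomorphic_qproduct (holomorphicM (@holomorphic_cst _ _) (he _))).
exists (fun z => - e1 z * H z); split.
- exact: holomorphicM (holomorphicN he1) hH.
- have qn0 : qproduct nome != 0.
    apply/eqP => /qproduct_eq0[n]; rewrite -exprSr => /(congr1 (@ComplexField.Normc.normc R)).
    rewrite normcX normc1 => h; have : rho ^+ n.+1 < 1 by rewrite exprn_ilt1.
    by rewrite /rho h ltxx.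
  by rewrite mulf_neq0 ?oppr_eq0 // /H !mulr0 !cexp0 mulr1 mul1r mulf_neq0.
- move=> z; rewrite /theta_product [qproduct (cexp (2 * _ * _ * _))]qproduct_shift.
  have := e1E z; rewrite x0 /H subr0; set X := cexp (2 * _ * _ * z) => E.
  have -> : 1 - X = - (z * e1 z) by rewrite E; ring.
  by ring.
Qed.

(** Both sides have the same multipliers, so their quotient is an elliptic
    function, which has no poles because theta vanishes on the lattice. *)
Lemma theta_productE : exists2 c, c != 0 & forall z, theta tau z = c * theta_product z.
Proof.
have qt : quasi_periodic tau 1 (-1) (-1) (theta tau).
  split=> z; first by rewrite thetaD1 // mulN1r.
  by rewrite thetaDtau // mulN1r /qfactor /tau_factor mulr1.
have qp : quasi_periodic tau 1 (-1) (-1) theta_product.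
  by split=> z; rewrite ?theta_productD1 ?theta_productDtau mulN1r.
have n10 : (-1 : C) != 0 by rewrite oppr_eq0 oner_neq0.
have [h hh hE] : exists2 h, holomorphic (h : C -> C) &
    forall z, theta tau z = theta_product z * h z.
  apply: holomorphic_quotient.
  - exact: holomorphic_theta.
  - exact: holomorphic_theta_product.
  move=> p /theta_product_eq0 pl.
  have [e [he e0 eP]] := lattice_multiplier 1 n10 n10 pl.
  split; first by have := eP _ qt 0; rewrite add0r theta0 // mulr0.
  have [g [hg g0 gE]] := simple_zero_theta_product0.
  exists (fun z => e (z - p) * g (z - p)); split.
  - exact: holomorphicM (holomorphic_shift _ he) (holomorphic_shift _ hg).
  - by rewrite mulf_neq0 ?subrr.
  - by move=> z; rewrite -{1}[z](subrK p) (eP _ qp) gE subr0; ring.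
have [p tp] := theta_nonzero tau_gt0.
have pp : theta_product p != 0 by apply: contraNneq tp => p0; rewrite hE p0 mul0r.
have := quasi_periodic_quotient n10 n10 holomorphic_theta_product pp hh hE qt qp.
rewrite subrr divff // => /(elliptic_constant tau_gt0 hh) hc.
exists (h p); first by apply: contraNneq tp => h0; rewrite hE h0 mulr0.
by move=> z; rewrite hE (hc z p) mulrC.
Qed.

Lemma theta_eq0 z : theta tau z = 0 -> lattice tau z.
Proof.
have [c c0 ->] := theta_productE.
by move=> /eqP; rewrite mulf_eq0 (negbTE c0) => /eqP/theta_product_eq0.
Qed.

Lemma simple_zero_theta0 : simple_zero (theta tau) 0.
Proof.
have [c c0 tE] := theta_productE; have [g [hg g0 gE]] := simple_zero_theta_product0.
exists (fun z => c * g z); split.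
- exact: holomorphicM (@holomorphic_cst _ _) hg.
- by rewrite mulf_neq0.
- by move=> z; rewrite tE gE mulrCA.
Qed.


End Product.

(** * Factorization of quasi-periodic functions *)

Section Multiplicative.
Variable R : realType.
Local Notation C := (CC R).
Implicit Types (z w u : C) (f g : C -> C).

Lemma normc_expr_sub1 u (d : R) n : normc (u - 1) <= d ->
  normc (u ^+ n - 1) <= (1 + d) ^+ n - 1.
Proof.
move=> ud; have d0 : 0 <= d by rewrite (le_trans _ ud) // normc_ge0.
elim: n => [|n IH]; first by rewrite !expr0 !subrr normc0.
have -> : u ^+ n.+1 - 1 = u ^+ n * (u - 1) + (u ^+ n - 1) by rewrite exprSr; ring.
rewrite (le_trans (normcD _ _)) // normcM.
have un : normc (u ^+ n) <= (1 + d) ^+ n.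
  have := normcD (u ^+ n - 1) 1; rewrite subrK normc1; lra.
have h : normc (u ^+ n) * normc (u - 1) <= (1 + d) ^+ n * d.
  by rewrite ler_pM ?normc_ge0.
rewrite (le_trans (lerD h IH)) // exprSr mulrDr mulr1.
by rewrite addrA [_ * d + _]addrC.
Qed.

(** A multiplicative entire function with vanishing derivative at the origin is
    [1]: write [g z] as the [n]-th power of [g (z / n)]. *)
Lemma multiplicative_eq1 g : (forall z w, g (z + w) = g z * g w) -> g 0 = 1 ->
  (forall e : R, 0 < e -> exists2 r : R, 0 < r &
     forall h, normc h < r -> normc (g h - 1) <= e * normc h) ->
  forall z, g z = 1.
Proof.
move=> gM g0 gd z; apply/eqP; rewrite -subr_eq0 -normc_eq0 eq_le normc_ge0 andbT.
have gX n w : g (w * n%:R) = g w ^+ n.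
  by elim: n => [|n IH]; rewrite ?mulr0 // -natr1 mulrDr mulr1 gM IH exprSr.
apply: (@le0_of_le_eps _ _ (2 * normc z)) => e e0.
pose b := 2 * (normc z + 1); have b0 : 0 < b by have := normc_ge0 z; rewrite /b; lra.
(* keeps e' * normc z below 1 / 2, where expR x <= 1 + 2 * x *)
pose e' := Num.min e b^-1.
have e'0 : 0 < e' by rewrite lt_min e0 invr_gt0.
have e'e : e' <= e by rewrite ge_min lexx.
have e'b : e' <= b^-1 by rewrite ge_min lexx orbT.
have [r r0 rP] := gd _ e'0.
have [n nP] : exists n : nat, normc z / r < n%:R.
  exists (Num.bound (normc z / r)); apply: archi_boundP.
  exact: divr_ge0 (normc_ge0 _) (ltW r0).
have n0 : 0 < n%:R :> R by rewrite (le_lt_trans _ nP) // divr_ge0 ?normc_ge0 // ltW.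
have nC : (n%:R : C) != 0 by rewrite pnatr_eq0 -(pnatr_eq0 R) gt_eqF.
have nz : normc (z / n%:R) = normc z / n%:R.
  rewrite normcM normcV; congr (_ / _).
  by rewrite -(rmorph_nat (real_complex R)) normc_real normr_nat.
have zr : normc (z / n%:R) < r.
  by rewrite nz ltr_pdivrMr // mulrC -ltr_pdivrMr.
have := normc_expr_sub1 n (rP _ zr); rewrite -gX divfK // => h.
rewrite (le_trans h) //.
set x := e' * normc z.
have x0 : 0 <= x by rewrite mulr_ge0 ?normc_ge0 // ltW.
have x2 : x <= 1 / 2.
  rewrite (@le_trans _ _ (b^-1 * normc z)) // ?ler_wpM2r ?normc_ge0 //.
  rewrite mulrC ler_pdivrMr // /b; have := normc_ge0 z; lra.
have H1 : (1 + e' * normc (z / n%:R)) ^+ n <= expR x.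
  have -> : x = e' * normc (z / n%:R) * n%:R by rewrite nz /x mulrA divfK // gt_eqF.
  rewrite expRM_natr lerXn2r ?nnegrE ?expR_ge0 ?expR_ge1Dx //.
  by rewrite addr_ge0 // mulr_ge0 ?normc_ge0 // ltW.
have H2 : expR x <= 1 + 2 * x.
  have := expR_ge1Dx (- x); rewrite expRN => H.
  have p0 : 0 < 1 - x by lra.
  have q0 := expR_gt0 x.
  have : expR x * (1 - x) <= 1.
    by rewrite mulrC -ler_pdivlMr // mul1r.
  have y0 : 0 <= (expR x - (1 + 2 * x)) + (1 + 2 * x) by rewrite subrK ltW.
  move: (expR x) q0 => y q0 h1.
  rewrite -(ler_pM2r p0) (le_trans h1) //; nra.
have H3 : x <= normc z * e by rewrite /x [leRHS]mulrC ler_wpM2r ?normc_ge0.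
by rewrite lerBlDr (le_trans H1) // (le_trans H2) // addrC lerD2r -mulrA ler_wpM2l.
Qed.

(** Dividing by the exponential with the same derivative at the origin reduces to a
    function with vanishing derivative there. *)
Lemma holomorphic_multiplicative f : holomorphic (f : C -> C) ->
  (forall z w, f (z + w) = f z * f w) -> f 0 = 1 ->
  exists a, forall z, f z = cexp (a * z).
Proof.
move=> hf fM f0.
have /differentiable_epsP[a aP] := hf 0.
exists a => z; apply: (mulfI (cexp_neq0 (- a * z))).
have -> : cexp (- a * z) * cexp (a * z) = 1.
  by rewrite -cexpD mulNr addNr cexp0.
pose g z := cexp (- a * z) * f z.
have hg : holomorphic (g : C -> C).
  apply: holomorphicM hf.
  by have := @holomorphic_cexp_affine _ (- a) 0; under eq_fun do rewrite addr0.
apply: (@multiplicative_eq1 g).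
- by move=> u w; rewrite /g fM mulrDr cexpD; ring.
- by rewrite /g mulr0 cexp0 mul1r.
move=> e e0; set A := normc a + 1.
have A0 : 0 < A by rewrite ltr_wpDl ?normc_ge0.
pose d := e / (3 * A); have d0 : 0 < d by rewrite divr_gt0 // mulr_gt0.
have [r1 r10 r1P] := aP _ d0.
have [r2 r20 r2P] := @cexp_increment R _ d0.
have [r3 r30 r3P] := @cexp_increment R _ ltr01.
exists (Num.min r1 (Num.min (r2 / A) (Num.min (r3 / A) (1 / A)))).
  by rewrite !lt_min r10 !divr_gt0.
move=> h; rewrite !lt_min => /and4P[h1]; rewrite !ltr_pdivlMr // => h2 h3 h4.
have hA : normc (a * h) <= normc h * A.
  by rewrite normcM mulrC ler_wpM2l ?normc_ge0 // lerDl.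
have hN : normc (- a * h) = normc (a * h) by rewrite mulNr normcN.
have b1 := r1P h h1; rewrite add0r f0 in b1.
have b2 := r2P _ (le_lt_trans hA h2).
have b3 : normc (cexp (- a * h) - 1 - - a * h) <= 1 * normc (- a * h).
  by apply: r3P; rewrite hN (le_lt_trans hA).
have b4 : normc (cexp (- a * h)) <= 3.
  have -> : cexp (- a * h) = (cexp (- a * h) - 1 - - a * h) + (1 + - a * h) by ring.
  have := normcD (cexp (- a * h) - 1 - - a * h) (1 + - a * h).
  have := normcD 1 (- a * h); rewrite normc1; move: b3; rewrite hN.
  by move: (le_lt_trans hA h4); lra.
have -> : g h - 1 = cexp (- a * h) * ((f h - 1 - a * h) - (cexp (a * h) - 1 - a * h)).
  have -> : (f h - 1 - a * h) - (cexp (a * h) - 1 - a * h) = f h - cexp (a * h) by ring.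
  have z0 : - a * h + a * h = 0 by ring.
  by rewrite mulrBr -cexpD z0 cexp0.
rewrite normcM (le_trans (ler_pM (normc_ge0 _) (normc_ge0 _) b4 (normcD _ _))) //.
have b5 : d * normc (a * h) <= d * normc a * normc h by rewrite normcM mulrA.
have -> : e * normc h = 3 * (d * normc h + d * normc a * normc h).
  by rewrite /d /A; field; rewrite gt_eqF.
by rewrite ler_wpM2l // normcN lerD // (le_trans b2).
Qed.


End Multiplicative.

Section Factorization.
Variable R : realType.
Local Notation C := (CC R).
Local Notation Im := (@complex.Im R).
Variable tau : C.
Hypothesis tau_gt0 : 0 < Im tau.
Implicit Types (z w : C) (f g h : C -> C).
Local Notation theta := (theta tau).
Local Notation quasi_periodic := (quasi_periodic tau).

Lemma quasi_periodic_theta w :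
  quasi_periodic 1 (-1) (- cexp (2 * cpi R * ci R * w)) (fun z => theta (z - w)).
Proof.
split=> z; first by rewrite addrAC thetaD1 // mulN1r.
rewrite addrAC thetaDtau // /qfactor /tau_factor; congr (_ * _).
by rewrite mulNr -cexpD; congr (- cexp _); ring.
Qed.

Lemma holomorphic_theta_sub w : holomorphic ((fun z => theta (z - w)) : C -> C).
Proof. exact: (holomorphic_shift (- w) (holomorphic_theta tau_gt0)). Qed.

Let mult0 w : - cexp (2 * cpi R * ci R * w) != 0 :> C.
Proof. by rewrite oppr_eq0 cexp_neq0. Qed.

Let neg10 : (-1 : C) != 0. Proof. by rewrite oppr_eq0 oner_neq0. Qed.

Lemma simple_zero_theta w p : theta (p - w) = 0 -> simple_zero (fun z => theta (z - w)) p.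
Proof.
move=> /(theta_eq0 tau_gt0) pl.
have [e [he e0 eP]] := lattice_multiplier 1 neg10 (mult0 w) pl.
have [g [hg g0 gE]] := simple_zero_theta0 tau_gt0.
exists (fun z => e (z - (p - w)) * g (z - p)); split.
- exact: holomorphicM (holomorphic_shift _ he) (holomorphic_shift _ hg).
- by rewrite mulf_neq0 // subrr.
move=> z; have := eP _ (quasi_periodic_theta w) (z - (p - w)).
rewrite subrK => ->.
by rewrite (_ : z - (p - w) - w = z - p) ?gE ?subr0; ring.
Qed.

(** The zero at [w] is repeated along [w] plus the lattice, which is exactly the
    zero set of the divisor. *)
Lemma divide_theta f m (c1 c2 : C) w : holomorphic (f : C -> C) ->
  c1 != 0 -> c2 != 0 -> quasi_periodic m c1 c2 f -> f w = 0 ->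
  exists h c1' c2', [/\ holomorphic (h : C -> C), c1' != 0, c2' != 0,
    quasi_periodic (m - 1) c1' c2' h & forall z, f z = theta (z - w) * h z].
Proof.
move=> hf c10 c20 qf fw.
have ht := holomorphic_theta_sub w.
have [h hh hE] : exists2 h, holomorphic (h : C -> C) & forall z, f z = theta (z - w) * h z.
  apply: (holomorphic_quotient hf ht) => p tp; split; last exact: simple_zero_theta.
  have [e [_ _ eP]] := lattice_multiplier m c10 c20 (theta_eq0 tau_gt0 tp).
  by have := eP f qf w; rewrite addrC subrK fw mulr0.
have [p tp] := theta_nonzero tau_gt0.
have tp' : theta (p + w - w) != 0 by rewrite addrK.
have := quasi_periodic_quotient neg10 (mult0 w) ht tp' hh hE qf (quasi_periodic_theta w).
exists h, (c1 / -1), (c2 / - cexp (2 * cpi R * ci R * w)); split=> //.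
  by rewrite mulf_neq0 ?invr_neq0.
by rewrite mulf_neq0 ?invr_neq0.
Qed.

(** A zero-free section of positive degree would have an inverse of negative
    degree. *)
Lemma exists_zero f m (c1 c2 : C) : holomorphic (f : C -> C) ->
  c1 != 0 -> c2 != 0 -> 0 < m -> quasi_periodic m c1 c2 f -> exists w, f w = 0.
Proof.
move=> hf c10 c20 m0 qf; apply: contrapT => /forallNP f0.
have {}f0 z : f z != 0 by apply/eqP; exact: f0.
have hV : holomorphic ((fun z => (f z)^-1) : C -> C).
  by move=> z; exact: (differentiableV (hf z) (f0 z)).
have q1 : quasi_periodic 0 1 1 (fun=> 1).
  by split=> z; rewrite ?tau_factor0 ?mul1r.
have E z : 1 = f z * (f z)^-1 by rewrite divff.
have qV := quasi_periodic_quotient c10 c20 hf (f0 0) hV E q1 qf.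
have m0' : 0 - m < 0 by rewrite sub0r oppr_lt0.
have a10 : 1 / c1 != 0 by rewrite mul1r invr_neq0.
have a20 : 1 / c2 != 0 by rewrite mul1r invr_neq0.
have := quasi_periodic_neg tau_gt0 a10 a20 m0' hV qV 0.
by apply/eqP; rewrite invr_neq0.
Qed.

(** A zero could be divided out, leaving a function of negative degree.  Being
    zero-free, [f (z + s) / f z] is elliptic in [z], so [f] is multiplicative up
    to its value at [0]. *)
Lemma degree0_exponential f (c1 c2 : C) p : holomorphic (f : C -> C) ->
  c1 != 0 -> c2 != 0 -> quasi_periodic 0 c1 c2 f -> f p != 0 ->
  exists c a, c != 0 /\ forall z, f z = c * cexp (a * z).
Proof.
move=> hf c10 c20 qf fp.
have f0 w : f w != 0.
  apply/eqP => fw.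
  have [h [b1 [b2 [hh b10 b20 qh hE]]]] := divide_theta hf c10 c20 qf fw.
  have := quasi_periodic_neg tau_gt0 b10 b20 (isT : (0 - 1 : int) < 0) hh qh p.
  by move=> hp; move: fp; rewrite hE hp mulr0 eqxx.
have E s z : f (z + s) = f z * (f s / f 0).
  have hq : holomorphic ((fun z => f (z + s) / f z) : C -> C).
    by move=> u; exact: (differentiable_div (holomorphic_shift s hf u) (hf u) (f0 u)).
  have qq : quasi_periodic 0 1 1 (fun z => f (z + s) / f z).
    case: qf => f1 f2; split=> u.
      by rewrite addrAC !f1; field; rewrite f0 c10.
    rewrite addrAC !f2 tau_factor0 !mulr1 mul1r.
    by rewrite /tau_factor mulr0 mul0r oppr0 cexp0; field; rewrite f0 c20.
  have := elliptic_constant tau_gt0 hq qq z 0.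
  by rewrite add0r => <-; rewrite mulrCA divff // mulr1.
have hk : holomorphic ((fun z => f z / f 0) : C -> C).
  by apply: holomorphicM hf (@holomorphic_cst _ _).
have [a aE] : exists a, forall z, f z / f 0 = cexp (a * z).
  apply: (holomorphic_multiplicative hk); last by rewrite divff.
  by move=> z w; rewrite E; ring.
by exists (f 0), a; split=> // z; rewrite -aE mulrCA divff // mulr1.
Qed.

(** Zeros are divided out one at a time, until degree zero is reached. *)
Lemma quasi_periodic_factorization (m : nat) f (c1 c2 : C) p :
  holomorphic (f : C -> C) -> c1 != 0 -> c2 != 0 ->
  quasi_periodic m c1 c2 f -> f p != 0 ->
  exists c a (w : 'I_m -> C), c != 0 /\
    forall z, f z = c * (cexp (a * z) * \prod_(i < m) theta (z - w i)).
Proof.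
elim: m f c1 c2 => [|m IH] f c1 c2 hf c10 c20 qf fp.
  have [c [a [c0 fE]]] := degree0_exponential hf c10 c20 qf fp.
  by exists c, a, (fun=> 0); split=> // z; rewrite big_ord0 mulr1.
have [w0 fw] := exists_zero hf c10 c20 (isT : 0 < m.+1%:Z) qf.
have [h [b1 [b2 [hh b10 b20 qh hE]]]] := divide_theta hf c10 c20 qf fw.
have mE : m.+1%:Z - 1 = m by rewrite -addn1 PoszD addrK.
rewrite mE in qh.
have hp : h p != 0 by apply: contraNneq fp => hp; rewrite hE hp mulr0.
have [c [a [w [c0 wE]]]] := IH h b1 b2 hh b10 b20 qh hp.
exists c, a, (fun i => if unlift ord0 i is Some j then w j else w0).
split=> // z; rewrite hE wE big_ord_recl unlift_none.
under [in RHS]eq_bigr do rewrite liftK.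
by ring.
Qed.

End Factorization.

(** * Holomorphic functions of several variables *)

Section SeveralVariables.
Variable R : realType.
Local Notation C := (CC R).
Variable n : nat.
Local Notation V := 'rV[C]_n.
Implicit Types (x y v p : V) (f g u : V -> C).

Lemma differentiable_prod_at (P : pred 'I_n) (F : 'I_n -> V -> C) x :
  (forall i, P i -> differentiable (F i) x) ->
  differentiable (fun y => \prod_(i | P i) F i y) x.
Proof.
move=> hF; rewrite (_ : (fun y => _) = \prod_(i | P i) F i); last first.
  by apply/funext => z; rewrite fct_prodE.
apply: (big_ind (fun G : V -> C => differentiable G x)).
- exact: differentiable_cst.
- by move=> G H hG hH; exact: (differentiableM hG hH).
- exact: hF.
Qed.

Lemma differentiable_sum_at (F : 'I_n -> V -> C) x :
  (forall i, differentiable (F i) x) ->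
  differentiable (fun y => \sum_i F i y) x.
Proof.
move=> hF; rewrite (_ : (fun y => _) = \sum_i F i); last first.
  by apply/funext => z; rewrite fct_sumE.
apply: (big_ind (fun G : V -> C => differentiable G x)).
- exact: differentiable_cst.
- by move=> G H hG hH; exact: (differentiableD hG hH).
- by move=> i _; exact: hF.
Qed.

Lemma differentiable_entry (i : 'I_n) x : differentiable (fun y : V => y 0 i) x.
Proof. exact: differentiable_coord. Qed.

Lemma differentiable_compose (phi : C -> C) g x : holomorphic (phi : C -> C) ->
  differentiable g x -> differentiable (fun y => phi (g y)) x.
Proof. by move=> hphi dg; exact: (differentiable_comp dg (hphi (g x))). Qed.

Lemma differentiable_shift_coord u (i : 'I_n) (s : C) x : holomorphic u ->
  differentiable (fun y => u (shift_coord i s y)) x.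
Proof.
move=> hu; have d : differentiable (shift_coord i s) x.
  have did : differentiable (fun y : V => y) x by apply: ex_diff; exact: is_diff_id.
  exact: (differentiableD did (differentiable_cst (s *: delta_mx 0 i) x)).
exact: (differentiable_comp d (hu _)).
Qed.

Lemma holomorphic_line u x v : holomorphic u ->
  holomorphic ((fun t => u (x + t *: v)) : C -> C).
Proof.
move=> hu t; have dl : differentiable (fun t : C => t *: v) t.
  by apply: ex_diff; exact: is_diff_scalel.
have d : differentiable (fun t : C => x + t *: v) t.
  exact: (differentiableD (differentiable_cst x t) dl).
exact: (differentiable_comp d (hu _)).
Qed.

(** Restriction to the complex lines through [p] reduces to one variable. *)
Lemma several_variables_identity u p : holomorphic u ->
  (\forall x \near p, u x = 0) -> forall x, u x = 0.
Proof.
move=> hu up x.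
have hl := holomorphic_line p (x - p) hu.
suff : u (p + (1 : C) *: (x - p)) = 0 by rewrite scale1r [p + _]addrC subrK.
apply: (identity_theorem (p := 0) hl).
have cl : {for (0 : C), continuous (fun t : C => p + t *: (x - p))}.
  apply: (@cvgD _ _ _ (nbhs (0 : C))); first exact: cvg_cst.
  exact: scalel_continuous.
have := cl (fun y => u y = 0); rewrite scale0r addr0; exact.
Qed.

(** Equality on a dense set extends to the points where both sides are
    continuous. *)
Lemma mero_eq_at f g x : {for x, continuous f} -> {for x, continuous g} ->
  mero_eq f g -> f x = g x.
Proof.
move=> cf cg [D [oD dD DE]].
have ch : {for x, continuous (fun y => f y - g y)}.
  exact: (@cvgB _ _ _ (nbhs x) _ _ _ _ _ cf cg).
apply/eqP; rewrite -subr_eq0; apply/negPn/negP => h0.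
have e0 : 0 < normc (f x - g x) by rewrite normc_gt0.
have /nbhs_interior N : nbhs x [set y | f y - g y != 0].
  apply: filterS (iffLR (cvgCP (F := nbhs x) _ _) ch _ e0) => y /=; apply: contraTneq => ->.
  by rewrite sub0r normcN ltxx.
have [y [Ny Dy]] := dD _ (ex_intro _ x (nbhs_singleton N)) (@open_interior _ _).
have := interior_subset Ny => /=.
by rewrite DE // subrr eqxx.
Qed.

Lemma holomorphic_cts u : holomorphic u -> continuous u.
Proof. by move=> hu x; exact/differentiable_continuous/hu. Qed.

Lemma nonzero_open u : holomorphic u -> open [set x | u x != 0].
Proof.
move=> /holomorphic_cts cu; rewrite openE => x /= u0.
have e0 : 0 < normc (u x) by rewrite normc_gt0.
apply: filterS (iffLR (cvgCP (F := nbhs x) _ _) (cu x) _ e0) => y /=; apply: contraTneq => ->.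
by rewrite sub0r normcN ltxx.
Qed.

Lemma nonzero_dense u p : holomorphic u -> u p != 0 -> dense [set x | u x != 0].
Proof.
move=> hu up O [q Oq] oO; apply: contrapT => H.
have : \forall x \near q, u x = 0.
  apply: filterS (open_nbhs_nbhs (conj oO Oq)) => x Ox.
  by apply/eqP/negPn/negP => ux; apply: H; exists x.
by move=> /(several_variables_identity hu)/(_ p)/eqP; rewrite (negbTE up).
Qed.

(** By the identity theorem such functions form a multiplicative set, and each of
    them cuts out an open dense set on which meromorphic identities may be
    checked. *)
Definition nonvanishing u := holomorphic u /\ exists p, u p != 0.

Lemma nonvanishingM f g : nonvanishing f -> nonvanishing g ->
  nonvanishing (fun x => f x * g x).
Proof.
move=> [hf [p fp]] [hg [q gq]]; split.
  by move=> x; exact: (differentiableM (hf x) (hg x)).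
have [x [/= fx gx]] := nonzero_dense hg gq (ex_intro _ p fp) (nonzero_open hf).
by exists x; rewrite mulf_neq0.
Qed.

Lemma nonvanishing_prod (P : pred 'I_n) (F : 'I_n -> V -> C) :
  (forall i, P i -> nonvanishing (F i)) ->
  nonvanishing (fun y => \prod_(i | P i) F i y).
Proof.
move=> hF; rewrite (_ : (fun y => _) = \prod_(i | P i) F i); last first.
  by apply/funext => z; rewrite fct_prodE.
apply: (big_ind nonvanishing).
- split; first by move=> x; exact: differentiable_cst.
  by exists 0; rewrite oner_neq0.
- exact: nonvanishingM.
- exact: hF.
Qed.

Lemma mero_eq_nonzero u f g : nonvanishing u ->
  (forall x, u x != 0 -> f x = g x) -> mero_eq f g.
Proof.
move=> [hu [p up]] E; exists [set x | u x != 0]; split=> //.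
  exact: nonzero_open.
exact: nonzero_dense up.
Qed.

Lemma eq_mero_eq f g : f =1 g -> mero_eq f g.
Proof.
move=> fg; apply: (@mero_eq_nonzero (fun=> 1)); last by move=> x _; exact: fg.
by split; [move=> x; exact: differentiable_cst|exists 0; rewrite oner_neq0].
Qed.

Lemma holomorphic_meromorphic u : holomorphic u -> meromorphic u.
Proof.
move=> hu p; exists u, (fun=> 1); apply: (@filterE _ (nbhs p)) => x; split.
- exact: hu.
- exact: differentiable_cst.
- by move=> /nbhs_singleton /eqP; rewrite oner_eq0.
- by move=> _; rewrite divr1.
Qed.

Lemma mero_neq0_nonvanishing u : holomorphic u -> ~ mero_eq u (fun=> 0) ->
  nonvanishing u.
Proof.
move=> hu u0; split=> //; apply: contrapT => /forallNP H; apply: u0.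
by apply: eq_mero_eq => x; apply/eqP/negPn/negP; exact: H.
Qed.

Lemma nonvanishing_mero_neq0 u : nonvanishing u -> ~ mero_eq u (fun=> 0).
Proof.
move=> [hu [p up]] m; have cu : continuous u by exact: holomorphic_cts hu.
have c0 : {for p, continuous ((fun=> 0) : V -> C)} by exact: cst_continuous.
by have /eqP := mero_eq_at (cu p) c0 m; rewrite (negbTE up).
Qed.

End SeveralVariables.

(** * Separation of variables *)

Section Separation.
Variable R : realType.
Local Notation C := (CC R).
Local Notation Im := (@complex.Im R).
Variables (tau eta : C) (n : nat) (zs : 'I_n -> C) (Lam : 'I_n -> nat).
Hypothesis tau_gt0 : 0 < Im tau.
Local Notation V := 'rV[C]_n.
Local Notation theta := (theta tau).
Local Notation Aplus := (Aplus tau eta zs Lam).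
Local Notation Aminus := (Aminus tau eta zs Lam).
Local Notation transfer := (transfer tau eta zs Lam).
Implicit Types (x : V) (u : V -> C) (s t z : C) (i j k : 'I_n).

Let htheta : holomorphic (theta : C -> C). Proof. exact: holomorphic_theta. Qed.

Definition lambda x : C := - \sum_(k < n) (x 0 k + zs k).

Definition separated u i x : C :=
  Aplus (x 0 i) * u (shift_coord i (- (2 * eta)) x)
  + Aminus (x 0 i) * u (shift_coord i (2 * eta) x).

Definition interpolation s x i : C :=
  theta (lambda x - - s + x 0 i) / theta (lambda x)
    * (\prod_(j < n | j != i) (theta (- s - x 0 j) / theta (x 0 i - x 0 j))).

Lemma transferE s u x :
  transfer s u x = \sum_(i < n) interpolation s x i * separated u i x.
Proof. by []. Qed.

(** Nonzero exactly where no denominator of the transfer operator vanishes. *)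
Definition discriminant x : C :=
  theta (lambda x) * \prod_(i < n) \prod_(j < n | j != i) theta (x 0 i - x 0 j).

Lemma discriminant_lambda x : discriminant x != 0 -> theta (lambda x) != 0.
Proof. by rewrite mulf_eq0 negb_or => /andP[]. Qed.

Lemma discriminant_sub x i j : discriminant x != 0 -> j != i ->
  theta (x 0 i - x 0 j) != 0.
Proof.
rewrite mulf_eq0 negb_or => /andP[_] /prodf_neq0/(_ i isT)/prodf_neq0; exact.
Qed.

(** At the node [z = x_i] of the interpolation only one summand survives: this
    separates the variables. *)
Lemma transfer_at_node u i x : discriminant x != 0 ->
  transfer (- x 0 i) u x = separated u i x.
Proof.
move=> dx; rewrite transferE (bigD1 i) //= big1 ?addr0; last first.
  move=> k ki; rewrite /interpolation (bigD1 i) 1?eq_sym //=.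
  by rewrite !opprK subrr theta0 // mul0r mul0r mulr0 mul0r.
rewrite /interpolation !opprK subrK divff ?discriminant_lambda // mul1r.
rewrite big1 ?mul1r // => j ji; rewrite divff //; exact: discriminant_sub.
Qed.

Lemma transfer_of_separated u s x (e : 'I_n -> C) :
  (forall i, separated u i x = e i * u x) ->
  transfer s u x = (\sum_(i < n) interpolation s x i * e i) * u x.
Proof.
move=> H; rewrite transferE mulr_suml; apply: eq_bigr => i _.
by rewrite H mulrA.
Qed.

Lemma differentiable_lambda x : differentiable lambda x.
Proof.
apply: (differentiableN (f := fun y : V => \sum_(k < n) (y 0 k + zs k))).
apply: differentiable_sum_at => k.
exact: (differentiableD (differentiable_entry k x) (differentiable_cst (zs k) x)).
Qed.

Lemma differentiable_theta_sub i j x :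
  differentiable (fun y : V => theta (y 0 i - y 0 j)) x.
Proof.
apply: (differentiable_compose htheta).
exact: (differentiableB (differentiable_entry i x) (differentiable_entry j x)).
Qed.

Lemma nonvanishing_discriminant : (0 < n)%N -> nonvanishing discriminant.
Proof.
move=> n0; have [t0 tt0] := theta_nonzero tau_gt0.
apply: nonvanishingM.
  split; first by move=> x; exact: (differentiable_compose htheta (differentiable_lambda x)).
  pose i0 := Ordinal n0.
  have S (c : C) : \sum_(k < n) (c *: delta_mx 0 i0 : V) 0 k = c.
    rewrite (bigD1 i0) //= big1 ?addr0; first by rewrite !mxE !eqxx mulr1.
    by move=> k ki; rewrite !mxE (negbTE ki) andbF mulr0.
  exists ((- t0 - \sum_(k < n) zs k) *: delta_mx 0 i0).
  by rewrite /lambda big_split /= S subrK opprK.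
apply: nonvanishing_prod => i _; apply: nonvanishing_prod => j ji.
split; first by move=> x; exact: differentiable_theta_sub.
exists (t0 *: delta_mx 0 i).
by rewrite !mxE !eqxx (negbTE ji) andbF mulr1 mulr0 subr0.
Qed.

Lemma holomorphic_A (eps : 'I_n -> C) :
  holomorphic ((fun t => \prod_(k < n) theta (t + zs k + eps k)) : C -> C).
Proof.
apply: holomorphic_prod => k _; rewrite (_ : (fun t => _) = fun t => theta (t + (zs k + eps k))).
  exact: holomorphic_shift.
by apply/funext => t; rewrite addrA.
Qed.

Lemma differentiable_separated u i x : holomorphic u ->
  differentiable (separated u i) x.
Proof.
move=> hu.
have dA := differentiable_compose (holomorphic_A (fun k => eta * (Lam k)%:R))
  (differentiable_entry i x).
have dB := differentiable_compose (holomorphic_A (fun k => - (eta * (Lam k)%:R)))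
  (differentiable_entry i x).
have d1 := differentiableM dA (differentiable_shift_coord i (- (2 * eta)) x hu).
have d2 := differentiableM dB (differentiable_shift_coord i (2 * eta) x hu).
exact: (differentiableD d1 d2).
Qed.

Lemma differentiable_divV (f g : V -> C) x : differentiable f x ->
  differentiable g x -> g x != 0 -> differentiable (fun y => f y / g y) x.
Proof.
move=> df dg g0; have dV := differentiableV dg g0.
exact: (differentiableM df dV).
Qed.

Lemma differentiable_transfer u s x : holomorphic u -> discriminant x != 0 ->
  differentiable (transfer s u) x.
Proof.
move=> hu dx.
have -> : transfer s u = fun y => \sum_(i < n) interpolation s y i * separated u i y.
  by [].
apply: differentiable_sum_at => i.
have dI : differentiable (fun y => interpolation s y i) x.
  have dl : differentiable (fun y : V => lambda y - - s + y 0 i) x.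
    have d0 := differentiableB (differentiable_lambda x) (differentiable_cst (- s) x).
    exact: (differentiableD d0 (differentiable_entry i x)).
  have d1 : differentiable (fun y => theta (lambda y - - s + y 0 i) / theta (lambda y)) x.
    apply: differentiable_divV.
    - exact: (differentiable_compose htheta dl).
    - exact: (differentiable_compose htheta (differentiable_lambda x)).
    - exact: discriminant_lambda.
  have d2 : differentiable (fun y : V =>
      \prod_(j < n | j != i) (theta (- s - y 0 j) / theta (y 0 i - y 0 j))) x.
    apply: differentiable_prod_at => j ji; apply: differentiable_divV.
    - apply: (differentiable_compose htheta).
      exact: (differentiableB (differentiable_cst (- s) x) (differentiable_entry j x)).
    - exact: differentiable_theta_sub.
    - exact: discriminant_sub.
  exact: (differentiableM d1 d2).
exact: (differentiableM dI (differentiable_separated i x hu)).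
Qed.

Lemma eigen_pointwise u (eps : C -> C) s x : holomorphic u ->
  common_eigenfunction tau eta zs Lam u eps -> discriminant x != 0 ->
  transfer s u x = eps s * u x.
Proof.
move=> hu [_ _ E] dx.
have d1 := differentiable_transfer s hu dx.
have d2 := differentiableM (differentiable_cst (eps s) x) (hu x).
exact: (mero_eq_at (differentiable_continuous d1) (differentiable_continuous d2) (E s)).
Qed.

(** The node equation holds off the zeros of the discriminant, and both sides are
    continuous everywhere. *)
Lemma separated_pointwise u (eps : C -> C) i x : (0 < n)%N -> holomorphic u ->
  holomorphic (eps : C -> C) -> common_eigenfunction tau eta zs Lam u eps ->
  separated u i x = eps (- x 0 i) * u x.
Proof.
move=> n0 hu heps E.
have d1 := differentiable_separated i x hu.
have de : differentiable (fun y : V => eps (- y 0 i)) x.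
  exact: (differentiable_compose heps (differentiableN (differentiable_entry i x))).
have d2 := differentiableM de (hu x).
apply: (mero_eq_at (differentiable_continuous d1) (differentiable_continuous d2)).
apply: (mero_eq_nonzero (nonvanishing_discriminant n0)) => y dy.
by rewrite -(transfer_at_node u i dy) (eigen_pointwise _ hu E).
Qed.

(** Where [u] is nonzero, its eigenvalue equation says that interpolating the
    values of [eps] at the nodes reproduces [eps]; a solution [v] of the same
    separated equations is therefore multiplied by [eps] as well. *)
Lemma eigenfunction_transfer u v (eps : C -> C) : (0 < n)%N -> holomorphic u ->
  holomorphic (eps : C -> C) -> common_eigenfunction tau eta zs Lam u eps ->
  holomorphic v -> (exists p, v p != 0) ->
  (forall i x, separated v i x = eps (- x 0 i) * v x) ->
  common_eigenfunction tau eta zs Lam v eps.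
Proof.
move=> n0 hu heps E hv v0 vE; split.
- exact: holomorphic_meromorphic.
- by apply: nonvanishing_mero_neq0; split.
move=> s; have [_ u0 _] := E.
have nu := mero_neq0_nonvanishing hu u0.
apply: (mero_eq_nonzero (nonvanishingM (nonvanishing_discriminant n0) nu)) => x.
rewrite mulf_eq0 negb_or => /andP[dx ux].
rewrite (transfer_of_separated s (fun i => vE i x)); congr (_ * _).
apply: (mulIf ux); rewrite -(eigen_pointwise s hu E dx).
rewrite (@transfer_of_separated u s x (fun i => eps (- x 0 i))) // => i.
exact: (separated_pointwise i x n0 hu heps E).
Qed.

(** The multipliers of the [n - 1] factors with [j != i] and of the factor
    containing [lambda] combine into a product over all [j], the same for
    every [i]. *)
Lemma interpolation_shift (mu : C) (k : C -> C) (c : C) s x i :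
  (forall y, theta (y + mu) = k y * theta y) ->
  (forall y, k (lambda x + y) = c * k y) ->
  interpolation (s + mu) x i =
    c * (\prod_(j < n) k (s + x 0 j)) * interpolation s x i.
Proof.
move=> tk kc; rewrite /interpolation.
have -> : lambda x - - (s + mu) + x 0 i = lambda x - - s + x 0 i + mu by ring.
rewrite tk.
have -> : lambda x - - s + x 0 i = lambda x + (s + x 0 i) by ring.
rewrite kc.
have -> : \prod_(j < n | j != i) (theta (- (s + mu) - x 0 j) / theta (x 0 i - x 0 j)) =
    \prod_(j < n | j != i) k (s + x 0 j) *
    \prod_(j < n | j != i) (theta (- s - x 0 j) / theta (x 0 i - x 0 j)).
  rewrite -big_split /=; apply: eq_bigr => j _.
  have -> : - (s + mu) - x 0 j = - (s + x 0 j + mu) by ring.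
  rewrite thetaN // tk.
  have -> : - s - x 0 j = - (s + x 0 j) by ring.
  by rewrite thetaN //; ring.
rewrite [\prod_(j < n) k _](bigD1 i) //=.
by ring.
Qed.

Lemma cexp_sum (F : 'I_n -> C) : \prod_i cexp (F i) = cexp (\sum_i F i).
Proof.
by rewrite (big_morph (@cexp R) (@cexpD R) (@cexp0 R)).
Qed.

(** At a point where neither the discriminant nor [u] vanishes, the eigenvalue is a
    fixed linear combination of interpolation coefficients, all of which have the
    required multipliers in the spectral parameter. *)
Lemma eigenvalue_theta_space u (eps : C -> C) : (0 < n)%N -> holomorphic u ->
  common_eigenfunction tau eta zs Lam u eps -> theta_space tau zs eps.
Proof.
move=> n0 hu E; have [_ u0 _] := E.
have nu := mero_neq0_nonvanishing hu u0.
have [_ [x]] := nonvanishingM (nonvanishing_discriminant n0) nu.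
rewrite mulf_eq0 negb_or => /andP[dx ux].
have epsE s : eps s = transfer s u x / u x.
  by rewrite (eigen_pointwise s hu E dx) mulfK.
have shift (mu : C) (k : C -> C) (c : C) s :
    (forall y, theta (y + mu) = k y * theta y) ->
    (forall y, k (lambda x + y) = c * k y) ->
    eps (s + mu) = c * (\prod_(j < n) k (s + x 0 j)) * eps s.
  move=> tk kc; rewrite !epsE !transferE mulrA mulr_sumr; congr (_ / _).
  by apply: eq_bigr => i _; rewrite (interpolation_shift s i tk kc) mulrA.
split.
- rewrite (_ : eps = fun s => (\sum_(i < n) interpolation s x i * separated u i x) / u x);
    last by apply/funext => s; rewrite epsE.
  apply: holomorphicM (@holomorphic_cst _ _).
  apply: holomorphic_sum => i _; apply: holomorphicM (@holomorphic_cst _ _).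
  apply: holomorphicM.
    apply: holomorphicM (@holomorphic_cst _ _).
    rewrite (_ : (fun s => _) = fun s => theta (s + (lambda x + x 0 i))).
      exact: holomorphic_shift.
    by apply/funext => s; congr theta; ring.
  apply: holomorphic_prod => j _; apply: holomorphicM (@holomorphic_cst _ _).
  apply: (holomorphic_comp htheta).
  exact: holomorphicB (holomorphicN (@holomorphic_id _)) (@holomorphic_cst _ _).
- move=> z; rewrite (shift 1 (fun=> -1) 1).
  + by rewrite mul1r prodr_const card_ord.
  + by move=> y; rewrite thetaD1 // mulN1r.
  + by move=> y; rewrite mul1r.
- move=> z; pose k y : C := - cexp (- (cpi R * ci R * (2 * y + tau))).
  rewrite (shift tau k (cexp (- (2 * cpi R * ci R * lambda x)))).
  + congr (_ * _).
    have -> : \prod_(j < n) k (z + x 0 j) =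
        (-1) ^+ n * cexp (\sum_(j < n) - (cpi R * ci R * (2 * (z + x 0 j) + tau))).
      by rewrite prodrN card_ord cexp_sum.
    rewrite mulrCA -cexpD -[RHS]mulrA -cexpD; congr (_ * cexp _).
    have -> : \sum_(j < n) - (cpi R * ci R * (2 * (z + x 0 j) + tau)) =
        - (cpi R * ci R * n%:R * (2 * z + tau))
        - 2 * cpi R * ci R * \sum_(j < n) x 0 j.
      rewrite (eq_bigr (fun j => - (cpi R * ci R * (2 * z + tau))
        + - (2 * cpi R * ci R) * x 0 j)); last by move=> j _; ring.
      by rewrite big_split /= sumr_const card_ord -mulr_natr -mulr_sumr; ring.
    by rewrite /lambda big_split /=; ring.
  + by move=> y; rewrite thetaDtau.
  + by move=> y; rewrite /k mulrN -cexpD; congr (- cexp _); ring.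
Qed.

End Separation.

(** * Bethe functions and the spectrum *)

Section BetheFunction.
Variable R : realType.
Local Notation C := (CC R).
Local Notation Im := (@complex.Im R).
Variable tau : C.
Hypothesis tau_gt0 : 0 < Im tau.
Local Notation theta := (theta tau).
Variables (m : nat) (a : C) (w : 'I_m -> C).
Implicit Types (t : C) (i j : 'I_m).

Definition bethe_function t : C := cexp (a * t) * \prod_(i < m) theta (t - w i).

Lemma holomorphic_bethe : holomorphic (bethe_function : C -> C).
Proof.
apply: holomorphicM.
  by have := @holomorphic_cexp_affine _ a 0; under eq_fun do rewrite addr0.
by apply: holomorphic_prod => i _; exact: holomorphic_theta_sub.
Qed.

Lemma quasi_periodic_bethe : quasi_periodic tau m ((-1) ^+ m * cexp a)
  ((-1) ^+ m * cexp (a * tau + 2 * cpi R * ci R * \sum_(k < m) w k)) bethe_function.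
Proof.
rewrite /bethe_function; split=> t.
  rewrite mulrDr mulr1 cexpD.
  under eq_bigr => i _ do rewrite addrAC thetaD1 //.
  by rewrite prodrN card_ord; ring.
rewrite mulrDr cexpD.
under eq_bigr => i _ do rewrite (quasi_periodic_theta tau_gt0 (w i)).2.
rewrite !big_split /= prodrN card_ord cexp_sum -mulr_sumr prodr_const card_ord.
rewrite /tau_factor -cexpX cexpD -pmulrn.
have -> : - (cpi R * ci R * 1%:~R * (2 * t + tau)) * m%:R =
    - (cpi R * ci R * m%:R * (2 * t + tau)) by ring.
by ring.
Qed.

(** The Bethe equation for [w i] is the separated equation at [w i], where the
    left-hand side vanishes; it is divided by [theta (2 * eta)]. *)
Lemma bethe_equation_of_root (A B : C) (eta : C) i : theta (2 * eta) != 0 ->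
  A * bethe_function (w i - 2 * eta) + B * bethe_function (w i + 2 * eta) = 0 ->
  A * \prod_(j < m | j != i) theta (w i - w j - 2 * eta) =
  cexp (4 * a * eta) * B * \prod_(j < m | j != i) theta (w i - w j + 2 * eta).
Proof.
move=> t0; rewrite /bethe_function ![\prod_(k < m) _](bigD1 i) //=.
have -> : w i - 2 * eta - w i = - (2 * eta) by ring.
have -> : w i + 2 * eta - w i = 2 * eta by ring.
rewrite thetaN //.
under [X in _ + B * (_ * (_ * X))]eq_bigr => j _ do rewrite addrAC.
under [X in A * (_ * (_ * X)) + _]eq_bigr => j _ do rewrite addrAC.
set P := \prod_(j < m | _) _; set P' := \prod_(j < m | _) _.
have -> : cexp (a * (w i + 2 * eta)) = cexp (4 * a * eta) * cexp (a * (w i - 2 * eta)).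
  by rewrite -cexpD; congr cexp; ring.
set e := cexp (a * _) => E.
have e0 : e * theta (2 * eta) != 0 by rewrite mulf_neq0 // cexp_neq0.
apply: (mulfI e0); apply/eqP; rewrite -subr_eq0 -oppr_eq0 -E; apply/eqP.
by ring.
Qed.

End BetheFunction.

Section ProductFunction.
Variable R : realType.
Local Notation C := (CC R).
Local Notation Im := (@complex.Im R).
Variables (tau eta : C) (n : nat) (zs : 'I_n -> C) (Lam : 'I_n -> nat).
Local Notation V := 'rV[C]_n.
Variable Q : C -> C.
Hypothesis hQ : holomorphic (Q : C -> C).
Implicit Types (x : V) (i : 'I_n).

Definition product_function x : C := \prod_(i < n) Q (x 0 i).

Lemma holomorphic_product : holomorphic (product_function : V -> C).
Proof.
move=> x; apply: differentiable_prod_at => i _.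
exact: (differentiable_compose hQ (differentiable_entry i x)).
Qed.

Lemma product_shift i (s : C) x : product_function (shift_coord i s x) =
  Q (x 0 i + s) * \prod_(k < n | k != i) Q (x 0 k).
Proof.
rewrite /product_function (bigD1 i) //=; congr (_ * _).
  by rewrite !mxE !eqxx mulr1.
apply: eq_bigr => k ki.
by rewrite !mxE (negbTE ki) andbF mulr0 addr0.
Qed.

Lemma productE i x :
  product_function x = Q (x 0 i) * \prod_(k < n | k != i) Q (x 0 k).
Proof. by rewrite /product_function (bigD1 i). Qed.

Lemma separated_product (e : C -> C) i x :
  (forall t, Aplus tau eta zs Lam t * Q (t - 2 * eta)
    + Aminus tau eta zs Lam t * Q (t + 2 * eta) = e t * Q t) ->
  separated tau eta zs Lam product_function i x = e (x 0 i) * product_function x.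
Proof.
move=> H; rewrite /separated !product_shift (productE i).
by rewrite mulrA [Aminus _ _ _ _ _ * _]mulrA -mulrDl H mulrA.
Qed.

Lemma product_nonzero p : Q p != 0 -> exists x, product_function x != 0.
Proof.
by move=> Qp; exists (const_mx p); apply/prodf_neq0 => i _; rewrite mxE.
Qed.

Lemma quasi_periodic_product (m : nat) (chi : C -> C) :
  quasi_periodic tau m (chi 1) (chi tau) Q ->
  quasi_periodic_space tau m chi product_function.
Proof.
move=> [Q1 Qt]; split; first exact: holomorphic_meromorphic holomorphic_product.
move=> i; split; apply: eq_mero_eq => x; rewrite product_shift (productE i).
  by rewrite Q1 mulrA.
by rewrite Qt mulrA /tau_factor -pmulrn.
Qed.

End ProductFunction.

Section Freezing.
Variable R : realType.
Local Notation C := (CC R).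
Variable n : nat.
Local Notation V := 'rV[C]_n.
Variables (u : V -> C) (x0 : V) (i : 'I_n).
Hypothesis hu : holomorphic u.

Definition frozen (t : C) : V := x0 + (t - x0 0 i) *: delta_mx 0 i.

Lemma frozen_entry t : frozen t 0 i = t.
Proof. by rewrite !mxE !eqxx mulr1 addrC subrK. Qed.

Lemma frozenD t s : frozen (t + s) = shift_coord i s (frozen t).
Proof.
rewrite /frozen /shift_coord -[RHS]addrA -scalerDl.
by congr (_ + _ *: _); ring.
Qed.

Lemma frozen_id : frozen (x0 0 i) = x0.
Proof. by rewrite /frozen subrr scale0r addr0. Qed.

Lemma holomorphic_frozen : holomorphic ((fun t => u (frozen t)) : C -> C).
Proof.
exact: (holomorphic_shift (- x0 0 i) (holomorphic_line x0 (delta_mx 0 i) hu)).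
Qed.

End Freezing.

Lemma quasi_periodic_frozen (R : realType) (tau : CC R) (n m : nat)
    (chi : CC R -> CC R) (u : 'rV[CC R]_n -> CC R) (x0 : 'rV[CC R]_n) (i : 'I_n) :
  holomorphic u -> quasi_periodic_space tau m chi u ->
  quasi_periodic tau m (chi 1) (chi tau) (fun t => u (frozen x0 i t)).
Proof.
move=> hu [_ qu]; have [q1 qt] := qu i.
have ds s (x : 'rV[CC R]_n) := differentiable_shift_coord i s x hu.
split=> t; rewrite frozenD.
  have d := differentiableM (differentiable_cst (chi 1) (frozen x0 i t)) (hu _).
  exact: (mero_eq_at (differentiable_continuous (ds 1 _)) (differentiable_continuous d) q1).
set x := frozen x0 i t.
have h2 : holomorphic ((fun s => chi tau * tau_factor tau m s) : CC R -> CC R).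
  exact: holomorphicM (@holomorphic_cst _ _) (@holomorphic_tau_factor _ _ _).
have d := differentiableM (differentiable_compose h2 (differentiable_entry i x)) (hu x).
have E : mero_eq (fun x : 'rV[CC R]_n => u (shift_coord i tau x))
    (fun x => chi tau * tau_factor tau m (x 0 i) * u x).
  exact: qt.
rewrite -[X in tau_factor _ _ X](frozen_entry x0 i t) -/x.
exact: (mero_eq_at (differentiable_continuous (ds tau x)) (differentiable_continuous d) E).
Qed.

(** A function that does not vanish identically has only one pair of multipliers
    in each degree. *)
Lemma quasi_periodic_multipliers (R : realType) (tau : CC R) (m : int)
    (c1 c2 d1 d2 : CC R) (f : CC R -> CC R) (p : CC R) : f p != 0 ->
  quasi_periodic tau m c1 c2 f -> quasi_periodic tau m d1 d2 f -> c1 = d1 /\ c2 = d2.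
Proof.
move=> fp [f1 f2] [g1 g2]; split; apply: (mulIf fp); first by rewrite -f1 g1.
have tf := tau_factor_neq0 tau m p.
by apply: (mulfI tf); have := f2 p; rewrite g2 => E; rewrite !mulrA
  [tau_factor _ _ _ * c2]mulrC [tau_factor _ _ _ * d2]mulrC -E.
Qed.

Theorem theorem3p6 (R : realType) (tau eta : CC R) (n : nat)
    (zs : 'I_n -> CC R) (Lam : 'I_n -> nat) (m : nat)
    (chi eps : CC R -> CC R)
    (tau_gt0 : 0 < imag tau)
    (eta_notin : ~ lattice tau (2 * eta))
    (zs_inj : injective zs)
    (m_gt0 : (0 < m)%N)
    (sum_Lam : (\sum_(k < n) Lam k = 2 * m)%N)
    (chi_char : lattice_character tau chi) :
  spectrum tau eta zs Lam m chi eps <->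
  exists Q : CC R -> CC R,
    common_eigenfunction tau eta zs Lam
      (fun x : 'rV[CC R]_n => \prod_(i < n) Q (x 0 i)) eps /\
    exists (a : CC R) (w : 'I_m -> CC R),
      [/\ forall x, Q x = cexp (a * x) * \prod_(i < m) theta tau (x - w i),
          bethe_equations tau eta zs Lam a w,
          chi 1 = (-1) ^+ m * cexp a &
          chi tau = (-1) ^+ m *
            cexp (a * tau + 2 * cpi R * ci R * \sum_(k < m) w k)].
Proof.
(* without variables the weights Lam would sum to 0 *)
have n0 : (0 < n)%N.
  rewrite lt0n; apply: contraTneq m_gt0 => n0; move: zs Lam zs_inj sum_Lam.
  rewrite n0 => ? ? _; rewrite big_ord0 => /esym/eqP.
  by rewrite muln_eq0 /= => /eqP ->.
split; last first.
  move=> [Q [E [a [w [QE _ chi1 chit]]]]].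
  have QE' : Q = bethe_function tau a w by apply/funext.
  have hQ : holomorphic (Q : CC R -> CC R) by rewrite QE'; exact: holomorphic_bethe.
  have hu := @holomorphic_product R n Q hQ.
  split; first exact: (eigenvalue_theta_space tau_gt0 n0 hu E).
  exists (product_function Q); split; [exact: hu| |exact: E].
  have qQ : quasi_periodic tau m (chi 1) (chi tau) Q.
    by rewrite chi1 chit QE'; exact: quasi_periodic_bethe.
  exact (@quasi_periodic_product _ _ _ _ hQ _ _ qQ).
move=> [[heps _ _] [u [hu qu E]]].
have [_ u0 _] := E; have [_ [x0 ux0]] := mero_neq0_nonvanishing hu u0.
pose i0 := Ordinal n0; pose Q0 t := u (frozen x0 i0 t).
have hQ0 : holomorphic (Q0 : CC R -> CC R) by exact: holomorphic_frozen.
have qQ0 : quasi_periodic tau m (chi 1) (chi tau) Q0 by exact: quasi_periodic_frozen.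
have chi10 : chi 1 != 0 by apply: chi_char.1; exact: lattice1.
have chit0 : chi tau != 0 by apply: chi_char.1; exact: lattice_tau.
have Qp : Q0 (x0 0 i0) != 0 by rewrite /Q0 frozen_id.
have [c [a [w [c0 Q0E]]]] := quasi_periodic_factorization tau_gt0 hQ0 chi10 chit0 qQ0 Qp.
pose Q := bethe_function tau a w.
have Q0Q t : Q0 t = c * Q t by exact: Q0E.
have hQ : holomorphic (Q : CC R -> CC R) by exact: holomorphic_bethe.
have Qp' : Q (x0 0 i0) != 0 by apply: contraNneq Qp => h; rewrite Q0Q h mulr0.
have baxter t : Aplus tau eta zs Lam t * Q (t - 2 * eta)
    + Aminus tau eta zs Lam t * Q (t + 2 * eta) = eps (- t) * Q t.
  have := separated_pointwise tau_gt0 i0 (frozen x0 i0 t) n0 hu heps E.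
  rewrite /separated -!frozenD frozen_entry -!/(Q0 _) !Q0Q => H.
  apply: (mulfI c0); rewrite [RHS]mulrCA -H; ring.
have [chi1 chit] : chi 1 = (-1) ^+ m * cexp a /\ chi tau = (-1) ^+ m *
    cexp (a * tau + 2 * cpi R * ci R * \sum_(k < m) w k).
  apply: (quasi_periodic_multipliers Qp' _ (quasi_periodic_bethe tau_gt0 a w)).
  case: qQ0 => q1 qt; split=> t; apply: (mulfI c0).
    by rewrite -/Q -Q0Q q1 Q0Q mulrCA.
  by rewrite -/Q -Q0Q qt Q0Q mulrCA.
exists Q; split.
  apply: (eigenfunction_transfer tau_gt0 n0 hu heps E).
  - exact: (@holomorphic_product R n Q hQ).
  - exact: product_nonzero Qp'.
  - move=> i x; exact: (@separated_product _ _ _ _ _ _ Q (fun t => eps (- t))).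
exists a, w; split=> // i.
apply: (bethe_equation_of_root tau_gt0).
  by apply/eqP => /(theta_eq0 tau_gt0).
rewrite -/Q baxter [Q (w i)]/Q /bethe_function (bigD1 i) //= subrr theta0 //.
by rewrite mul0r mulr0 mulr0.
Qed.
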